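(* Let $(\mathcal G^{\mathbf m}_n)_{n\ge0}\sim\mathscr P(\pi,\kappa,\mathbf m)$ on the finite attribute set $[K]$ with $\pi_a>0$ and $\kappa_{a,b}>0$ for all $a,b\in[K]$ and $\mathbf m\in\mathbb N^K$. Then, as $n\to\infty$, $\mathcal G^{\mathbf m}_n$ converges almost surely in the local weak sense (for directed marked graphs) to $\mathcal T^{\mathbf m}_A(\tau)$, where $A\sim\pi$ and $\tau$ is an independent exponential random variable with rate $2$.
   Context: Model. Fix $K\ge1$, $[K]=\{1,\dots,K\}$, a probability mass function $\pi$ on $[K]$, a matrix $\kappa=(\kappa_{a,b})_{a,b\in[K]}$ and $\mathbf m=(m_1,\dots,m_K)$ with each $m_a\ge1$ an integer. $(\mathcal G^{\mathbf m}_n)_{n\ge0}\sim\mathscr P(\pi,\kappa,\mathbf m)$ is built on one probability space as follows. $\mathcal G^{\mathbf m}_0$ is a finite connected graph whose vertices carry types in $[K]$ (with its edges given some fixed orientation). Given the past, a new vertex $v_{n+1}$ arrives with $\mathrm{type}(v_{n+1})\sim\pi$ independent of the past, and, if its type is $b$, it sends $m_b$ directed outgoing edges into $\mathcal G^{\mathbf m}_n$; these edges choose their endpoints independently, each choosing $v$ with conditional probability $$\frac{\kappa_{\mathrm{type}(v),b}\deg(v,n)}{\sum_{v'}\kappa_{\mathrm{type}(v'),b}\deg(v',n)},$$ where $\deg(v,n)$ is the total degree (in plus out) of $v$ in $\mathcal G^{\mathbf m}_n$, kept constant while the $m_b$ edges are added (if $\mathcal G^{\mathbf m}_0$ is a single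 vertex, its degree is initialized to be $1$). Derived constants. Let $V^{\mathbf m}_\pi(y)=\sum_iy_i-\frac12\sum_jm_j\pi_j\big(\log y_j+\log\sum_ky_k\kappa_{k,j}\big)$ for $y$ in the positive orthant of $\mathbb R^K$; it has a unique minimizer $\eta^{\mathbf m}$, which has strictly positive entries. Set $\nu^{\mathbf m}_b=\pi_b/\sum_l\kappa_{l,b}\eta^{\mathbf m}_l$, $\phi^{\mathbf m}_{a,b}=\kappa_{a,b}m_b\nu^{\mathbf m}_b$, $\phi^{\mathbf m}_a=\sum_b\phi^{\mathbf m}_{a,b}$ (one has $\phi^{\mathbf m}_a=2-m_a\pi_a/\eta^{\mathbf m}_a$). Branching process. $(\mathrm{BP}^{\mathbf m}_a(t))_{t\ge0}$ is the continuous-time multi-type branching process (without deaths) started from one individual (the root) of type $a$, in which, independently across individuals, an individual of type $a'$ with $N$ current children gives birth to a type-$b$ child at rate $\phi^{\mathbf m}_{a',b}(N+m_{a'})$. $\mathcal T^{\mathbf m}_a(t)$ is its family tree at time $t$, viewed as a rooted directed graph (edges from child to parent) with each vertex marked by its type. Local weak convergence of directed graphs. For a rooted directed graph with marks in $[K]$, finite in- and out-degrees and root $\emptyset$, $U_{\le k}(\emptyset)$ is the marked directed subgraph obtained by exploring from the root along incoming edges in the opposite direction up to graph distance $k$. For two such graphs put $d_{loc}=1/(\mathfrak K+1)$, where $\mathfrak K=\inf\{k\ge1:U_{\le k}(\emptyset)\not\cong U_{\le k}(\emptyset')\}$ ($\cong$ is isomorphism preserving root, marks and directed adjacency). Identifying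 graphs at distance $0$ gives a Polish space $\tilde{\mathbb G}_\star$. A sequence of finite marked directed random graphs $\mathcal G_n$ on a common probability space converges almost surely in the local weak sense to a random element $\mathcal G^*$ of $\tilde{\mathbb G}_\star$ if for every bounded continuous $f:\tilde{\mathbb G}_\star\to\mathbb R$, almost surely $\frac1{|V(\mathcal G_n)|}\sum_{v\in V(\mathcal G_n)}f(\mathcal G_n,v)\to\mathbb E[f(\mathcal G^* )]$, where $(\mathcal G_n,v)$ is $\mathcal G_n$ rooted at $v$. *)

(* Defs.v *)
From HB Require Import structures.
From mathcomp Require Import all_boot all_order all_algebra.
From mathcomp Require Import all_classical all_reals all_analysis.

Set Implicit Arguments.
Unset Strict Implicit.
Unset Printing Implicit Defensive.

Import Order.TTheory GRing.Theory Num.Theory.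
Import numFieldNormedType.Exports.

Local Open Scope classical_set_scope.
Local Open Scope ring_scope.
Local Open Scope quotient_scope.

(** Parallel edges are allowed: [mult u v] is the number of edges [u -> v]. *)
Record rgraph (K : nat) := RGraph {
  vertex :> Type;
  groot : vertex;
  mark : vertex -> 'I_K;
  mult : vertex -> vertex -> nat }.
Arguments groot {K r}.
Arguments mark {K r}.
Arguments mult {K r}.

Definition iso {K : nat} (g h : rgraph K) : Prop :=
  exists f : g -> h, [/\ bijective f,
    f groot = groot,
    forall v, mark (f v) = mark v &
    forall u v, mult (f u) (f v) = mult u v].

(** [within g k v]: a directed path of length at most [k] leads from [v] to the
    root, so that [v] is found by exploring incoming edges backwards. *)
Fixpoint within {K : nat} (g : rgraph K) (k : nat) (v : g) : Prop :=
  if k is k'.+1 then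
    within k' v \/ exists2 w, within k' w & (0 < mult v w)%N
  else v = groot.

Lemma within_root {K : nat} (g : rgraph K) k : within k (groot : g).
Proof. by elim: k => //= k IH; left. Qed.

(** The edges of [U k g] are the explored ones: those pointing to a vertex at
    distance less than [k] from the root. *)
Definition U {K : nat} (k : nat) (g : rgraph K) : rgraph K :=
  @RGraph K {v : g | within k v} (exist _ groot (within_root g k))
    (fun v => mark (sval v))
    (fun u v => if `[< exists2 j, (j < k)%N & within j (sval v) >]
                then mult (sval u) (sval v) else 0%N).

Definition locally_finite {K : nat} (g : rgraph K) : Prop :=
  forall v : g, finite_set [set u : g | (0 < mult u v)%N] /\
                finite_set [set u : g | (0 < mult v u)%N].

Record lfgraph (K : nat) := LFGraph {
  lf_graph :> rgraph K;
  lf_graphP : locally_finite lf_graph }.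

HB.instance Definition _ (K : nat) := gen_eqMixin (lfgraph K).
HB.instance Definition _ (K : nat) := gen_choiceMixin (lfgraph K).

Definition differ {K : nat} (g h : lfgraph K) : pred nat :=
  fun k => (1 <= k)%N && `[< ~ iso (U k g) (U k h) >].

(** The infimum of an empty set of radii is infinite, hence the value [0]. *)
Definition dloc (R : realType) {K : nat} (g h : lfgraph K) : R :=
  match pselect (exists k, differ g h k) with
  | left e => (ex_minn e).+1%:R^-1
  | right _ => 0
  end.

Section local_metric.
Context (R : realType) {K : nat}.
Implicit Types g h : lfgraph K.

Lemma iso_refl (g : rgraph K) : iso g g.
Proof. by exists id; split => //; exists id. Qed.

Lemma iso_sym (g h : rgraph K) : iso g h -> iso h g.
Proof.
move=> [f [[f' fK f'K] fr fm fe]]; exists f'; split.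
- by exists f.
- by rewrite -fr fK.
- by move=> v; rewrite -fm f'K.
- by move=> u v; rewrite -fe !f'K.
Qed.

Lemma iso_trans (g h l : rgraph K) : iso g h -> iso h l -> iso g l.
Proof.
move=> [f [bf fr fm fe]] [f' [bf' fr' fm' fe']]; exists (f' \o f); split.
- exact: bij_comp.
- by rewrite /= fr fr'.
- by move=> v; rewrite /= fm' fm.
- by move=> u v; rewrite /= fe' fe.
Qed.

Lemma differ_sym g h : differ g h = differ h g.
Proof.
apply/funext => k; rewrite /differ; congr andb.
by apply/asbool_equiv_eq; split => gh /iso_sym.
Qed.

Lemma differ_trans g h l k : differ g l k -> differ g h k || differ h l k.
Proof.
rewrite /differ; case: (1 <= k)%N => //= /asboolP gl.
case: asboolP => //= /contrapT gh; apply/asboolP => hl; apply: gl.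
exact: iso_trans gh hl.
Qed.

Lemma dloc_ge0 g h : 0 <= dloc R g h.
Proof. by rewrite /dloc; case: pselect => // e; rewrite invr_ge0. Qed.

Lemma dloc_sym g h : dloc R g h = dloc R h g.
Proof. by rewrite /dloc differ_sym. Qed.

Lemma dlocxx g : dloc R g g = 0.
Proof.
rewrite /dloc; case: pselect => // e; exfalso; case: e => k /andP[_ /asboolP].
by apply; exact: iso_refl.
Qed.

Lemma dloc_ge g h k : differ g h k -> k.+1%:R^-1 <= dloc R g h.
Proof.
move=> gh; rewrite /dloc; case: pselect => [e|]; last by case; exists k.
by case: ex_minnP => n _ /(_ _ gh) nk; rewrite lef_pV2 ?posrE// ler_nat.
Qed.

Lemma dloc_triangle h g l : dloc R g l <= dloc R g h + dloc R h l.
Proof.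
rewrite {1}/dloc; case: pselect => [e|_]; last by rewrite addr_ge0 ?dloc_ge0.
case: ex_minnP => k kgl _; have /orP[] := differ_trans h kgl => /dloc_ge kd.
  by rewrite (le_trans kd)// lerDl dloc_ge0.
by rewrite (le_trans kd)// lerDr dloc_ge0.
Qed.

Definition dloc0 : rel (lfgraph K) := fun g h => dloc R g h == 0.

Lemma dloc0P g h : reflect (forall l, dloc R g l = dloc R h l) (dloc0 g h).
Proof.
apply: (iffP eqP) => [gh0 l|->]; last exact: dlocxx.
have := dloc_triangle h g l; have := dloc_triangle g h l.
by rewrite (dloc_sym h g) gh0 !add0r => ? ?; apply/eqP; rewrite eq_le; apply/andP.
Qed.

Lemma dloc0_equiv : equiv_class_of dloc0.
Proof.
split=> [g|g h|h g l].
- by rewrite /dloc0 dlocxx.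
- by rewrite /dloc0 dloc_sym.
- by move=> /dloc0P gh /dloc0P hl; apply/dloc0P => x; rewrite gh.
Qed.

Canonical dloc0_equiv_rel := EquivRelPack dloc0_equiv.

End local_metric.

Definition Gstar (R : realType) (K : nat) : Type := {eq_quot (@dloc0 R K)}.

HB.instance Definition _ (R : realType) (K : nat) := Choice.on (Gstar R K).

Definition to_Gstar (R : realType) {K : nat} (g : lfgraph K) : Gstar R K :=
  \pi_({eq_quot (@dloc0 R K)}) g.

Definition of_Gstar (R : realType) {K : nat} (x : Gstar R K) : lfgraph K :=
  repr (x : {eq_quot (@dloc0 R K)}).

Definition Gstar_dist (R : realType) {K : nat} (x y : Gstar R K) : R :=
  dloc R (of_Gstar x) (of_Gstar y).

Section Gstar_metric.
Context (R : realType) (K : nat).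
Implicit Types x y : Gstar R K.

Lemma Gstar_distxx x : Gstar_dist x x = 0. Proof. exact: dlocxx. Qed.

Lemma Gstar_dist_eq0 x y : Gstar_dist x y = 0 -> x = y.
Proof.
move=> /eqP xy; rewrite -[x]reprK -[y]reprK.
by apply/(@eqmodP _ (@dloc0_equiv_rel R K)).
Qed.

Lemma Gstar_dist_sym x y : Gstar_dist x y = Gstar_dist y x.
Proof. exact: dloc_sym. Qed.

Lemma Gstar_dist_triangle y x z :
  Gstar_dist x z <= Gstar_dist x y + Gstar_dist y z.
Proof. exact: dloc_triangle. Qed.

HB.instance Definition _ := isMetric.Build R (Gstar R K)
  Gstar_distxx Gstar_dist_eq0 Gstar_dist_sym Gstar_dist_triangle.

Lemma dloc_to_Gstar (g h : lfgraph K) :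
  Gstar_dist (to_Gstar R g) (to_Gstar R h) = dloc R g h.
Proof.
have E (l : lfgraph K) : dloc0 R (of_Gstar (to_Gstar R l)) l.
  by apply/(@eqmodP _ (@dloc0_equiv_rel R K)); rewrite reprK.
by rewrite /Gstar_dist (dloc0P _ _ _ (E g)) dloc_sym (dloc0P _ _ _ (E h))
  dloc_sym.
Qed.

End Gstar_metric.

Record fmgraph (K : nat) := FGraph {
  size_fg : nat;
  fmark : 'I_size_fg -> 'I_K;
  fmult : 'I_size_fg -> 'I_size_fg -> nat }.

Section rooted_at.
Context {K : nat} (G : fmgraph K) (v : 'I_(size_fg G)).

(** ['I_n] itself cannot be used as a [vertex] type for universe reasons. *)
Let label := {i : nat | (i < size_fg G)%N}.
Let ord_of (i : label) : 'I_(size_fg G) := Ordinal (svalP i).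

Definition rooted_rgraph : rgraph K :=
  @RGraph K label (exist _ (val v) (ltn_ord v))
    (fun i => fmark (ord_of i)) (fun i j => fmult (ord_of i) (ord_of j)).

Lemma rooted_locally_finite : locally_finite rooted_rgraph.
Proof.
have fin (S : set label) : finite_set S.
  pose f (i : 'I_(size_fg G)) : label := exist _ (val i) (ltn_ord i).
  apply: (@sub_finite_set _ _ (f @` setT)); last exact/finite_image/finite_finset.
  by move=> [i ilt] _; exists (Ordinal ilt) => //; exact: eq_exist.
by move=> w; split; exact: fin.
Qed.

Definition rooted_at : lfgraph K := LFGraph rooted_locally_finite.

End rooted_at.

Definition as_local_weak_cvg {R : realType} {K : nat}
    {d : measure_display} {Omega : measurableType d} (P : probability Omega R)
    (G : nat -> Omega -> fmgraph K)
    {d' : measure_display} {Omega' : measurableType d'}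
    (Q : probability Omega' R) (T : Omega' -> Gstar R K) : Prop :=
  forall f : Gstar R K -> R,
    (exists M : R, forall x, `|f x| <= M) -> continuous f ->
    {ae P, forall w,
      (fun n => ((size_fg (G n w))%:R^-1 *
        \sum_(v < size_fg (G n w)) f (to_Gstar R (rooted_at v)))%:E)
      @ \oo --> ('E_Q[f \o T])%E}.

(** Type of the arriving vertex and list of the endpoints of its outgoing
    edges. *)
Definition arrival (K : nat) : Type := ('I_K * seq nat)%type.

(** The new vertex is [ord_max]; the older ones keep their number. *)
Definition attach {K : nat} (G : fmgraph K) (s : arrival K) : fmgraph K :=
  @FGraph K (size_fg G).+1
    (fun v => if unlift ord_max v is Some v' then fmark v' else s.1)
    (fun u v => match unlift ord_max u, unlift ord_max v with
                | Some u', Some v' => fmult u' v'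
                | None, Some v' => count_mem (val v') s.2
                | _, None => 0%N
                end).

Definition grow {K : nat} (G0 : fmgraph K) (h : seq (arrival K)) : fmgraph K :=
  foldl attach G0 h.

Definition seed_graph {K : nat} (G0 : fmgraph K) : Prop :=
  [/\ (0 < size_fg G0)%N,
      forall v : 'I_(size_fg G0), fmult v v = 0%N &
      forall u v : 'I_(size_fg G0),
        connect (fun x y => (0 < fmult x y + fmult y x)%N) u v].

Section attachment.
Context {R : realType} {K : nat}.
Variables (pi : 'I_K -> R) (kappa : 'I_K -> 'I_K -> R) (m : 'I_K -> nat).
Variable G0 : fmgraph K.

(** Total degree, where a one-vertex seed graph gives its vertex one extra unit
    of degree at all times. *)
Definition degree (G : fmgraph K) (v : 'I_(size_fg G)) : nat :=
  (\sum_(u < size_fg G) fmult u v + \sum_(u < size_fg G) fmult v u +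
   ((size_fg G0 == 1%N) && (val v == 0%N)))%N.

Definition weight (G : fmgraph K) (b : 'I_K) (v : 'I_(size_fg G)) : R :=
  kappa (fmark v) b * (degree v)%:R.

Definition choice_prob (G : fmgraph K) (b : 'I_K) (w : nat) : R :=
  if insub w is Some v then
    @weight G b v / \sum_(v' < size_fg G) @weight G b v'
  else 0.

Definition arrival_prob (G : fmgraph K) (s : arrival K) : R :=
  if size s.2 == m s.1
  then pi s.1 * \prod_(w <- s.2) choice_prob G s.1 w
  else 0.

Context {d : measure_display} {Omega : measurableType d}.
Variables (P : probability Omega R) (X : nat -> Omega -> arrival K).

Definition past (n : nat) (w : Omega) : seq (arrival K) :=
  [seq X i w | i <- iota 0 n].

(** [X n] is the arrival of [v_{n+1}]. As the past takes countably many values,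
    the conditional law of [X n] given the past is prescribed by elementary
    conditional probabilities. *)
Definition attachment_process : Prop :=
  (forall n s, measurable [set w | X n w = s]) /\
  (forall n (h : seq (arrival K)) (s : arrival K),
    P [set w | past n w = h /\ X n w = s] =
    (P [set w | past n w = h] * (arrival_prob (grow G0 h) s)%:E)%E).

Definition attachment_graph (n : nat) (w : Omega) : fmgraph K :=
  grow G0 (past n w).

End attachment.

Section constants.
Context {R : realType} {K : nat}.
Variables (pi : 'I_K -> R) (kappa : 'I_K -> 'I_K -> R) (m : 'I_K -> nat).
Implicit Types y z : {ffun 'I_K -> R}.

Definition potential y : R :=
  \sum_i y i - 2^-1 * \sum_j (m j)%:R * pi j *
    (ln (y j) + ln (\sum_k y k * kappa k j)).

Definition orthant : set {ffun 'I_K -> R} := [set y | forall i, 0 < y i].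

Definition eta : {ffun 'I_K -> R} :=
  xget [ffun=> 1] [set y | orthant y /\
                           forall z, orthant z -> potential y <= potential z].

Definition nu (b : 'I_K) : R := pi b / \sum_l kappa l b * eta l.

Definition phi (a b : 'I_K) : R := kappa a b * (m b)%:R * nu b.

End constants.

Section branching.
Context {R : realType} {K : nat}.
Variables (phi : 'I_K -> 'I_K -> R) (m : 'I_K -> nat).

(** Individuals are labelled by their ancestry: [[::]] is the root and [k :: u]
    is the [k]-th child of [u], with [k = 0] the first one.
    When [u], of type [a'], has [k] children, its next child is born when the
    first of the independent clocks [clock u k a' b], [b : 'I_K], of rate
    [phi a' b * (k + m a')] rings, and it gets the type of that clock. *)
Variables (a : 'I_K) (E : seq nat -> nat -> 'I_K -> R).

Definition clock (u : seq nat) (k : nat) (a' b : 'I_K) : R :=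
  E u k b / (phi a' b * (k + m a')%:R).

Fixpoint itype (u : seq nat) : 'I_K :=
  if u is k :: v
  then [arg min_(b < itype v) clock v k (itype v) b]%O
  else a.

Definition wait (u : seq nat) (k : nat) : R :=
  clock u k (itype u) (itype (k :: u)).

Fixpoint birth (u : seq nat) : R :=
  if u is k :: v then birth v + \sum_(j < k.+1) wait v j else 0.

Definition alive (t : R) : pred (seq nat) :=
  fun u => (u == [::]) || (birth u <= t).

Definition tree_rgraph (t : R) : rgraph K :=
  @RGraph K {u : seq nat | alive t u} (exist _ [::] isT)
    (fun u => itype (sval u))
    (fun u v => if sval u is _ :: p then nat_of_bool (p == sval v) else 0%N).

Definition singleton_fmgraph : fmgraph K :=
  @FGraph K 1 (fun=> a) (fun _ _ => 0%N).

(** The family tree at time [t]. Someone has infinitely many children at time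
    [t] only on a null event, where the tree is replaced by its root. *)
Definition family_tree (t : R) : lfgraph K :=
  match pselect (locally_finite (tree_rgraph t)) with
  | left lf => LFGraph lf
  | right _ => @rooted_at K singleton_fmgraph ord0
  end.

End branching.

(** [A ~ pi], [tau ~ Exp(2)] and the [E u k b ~ Exp(1)] are mutually
    independent; this is their joint law on cylinder sets. *)
Definition branching_inputs {R : realType} {K : nat} (pi : 'I_K -> R)
    {d : measure_display} {Omega : measurableType d} (Q : probability Omega R)
    (A : Omega -> 'I_K) (tau : Omega -> R)
    (E : seq nat -> nat -> 'I_K -> Omega -> R) : Prop :=
  [/\ forall a, measurable [set w | A w = a],
      measurable_fun setT tau,
      forall u k b, measurable_fun setT (E u k b) &
      forall (a : 'I_K) (B : set R) (s : seq (seq nat * nat * 'I_K))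
             (C : seq nat * nat * 'I_K -> set R),
        measurable B -> (forall i, measurable (C i)) -> uniq s ->
        Q [set w | [/\ A w = a, B (tau w) &
                       forall i, i \in s -> C i (E i.1.1 i.1.2 i.2 w)]] =
        ((pi a)%:E * exponential_prob 2 B *
         \prod_(i <- s) exponential_prob 1 (C i))%E].

(* Main.v *)
Require Import Defs.
From HB Require Import structures.
From mathcomp Require Import all_boot all_order all_algebra.
From mathcomp Require Import all_classical all_reals all_analysis measurable_realfun.
From mathcomp Require Import ring lra zify.

Set Implicit Arguments.
Unset Strict Implicit.
Unset Printing Implicit Defensive.

Import Order.TTheory GRing.Theory Num.Theory.
Import numFieldNormedType.Exports.

Local Open Scope classical_set_scope.
Local Open Scope ring_scope.

(** Both sides are described by birth histories, the finite sequences of births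
    (parent, type) in a growing family tree. In the graph, all but a vanishing
    fraction of the vertices have a tree of descendants for the exploration along
    incoming edges, and the number of vertices of type [a] with descent history
    [l] grows like [n * hist_law a l]: the total degree of each type grows like
    [2 n eta_a], because [eta] is the zero of the mean drift and the relative
    entropy to it is a Lyapunov function, so that each history is gained and lost
    at asymptotically constant rates, and the fluctuations are martingales with
    bounded increments, negligible by the strong law. In the branching process,
    integrating out the exponential clocks one at a time shows that
    [hist_law a l] is the probability that the root has type [a] and that the
    history at an independent exponential time of rate 2 is [l]. These
    probabilities sum to 1, as the total rate grows linearly with the population,
    which turns the convergence for each history into that of bounded averages. *)

(** * Recursions with a linear drift *)

(** The rate 2 reflects that each edge counts at both ends. As the total weight seen by a type-[b]
    newcomer is about [2 n] times the sum of [kappa l b * eta l], a type-[a] vertex of degree [k]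
    gains a type-[b] neighbour with probability about [phi a b * k / (2 n)]. In the time scale log n
    the rates are thus half those of the branching process, and the age log (n / j) of a uniform
    vertex [j] is nearly exponential of rate 1; half of that age goes with the rates [phi] and is
    exponential of rate 2. That cycles and double edges among descendants are rare is never
    estimated: such vertices are merely lost from the counts, and the limits of the remaining counts
    already have total mass 1. Recording the order of births gives each history a single
    predecessor, so that limits follow by induction on its length. One newcomer may alter the
    histories of many vertices; the increments stay bounded because each count involves histories of
    one fixed length and out-degrees are bounded. *)

Lemma harmonic_tail_unbounded (R : realType) (N : nat) (C : R) :
  exists n, C < \sum_(N <= k < n) (k.+1%:R)^-1.
Proof.
apply: contrapT => /forallNP H.
apply: (@dvg_harmonic R); apply: (@nondecreasing_is_cvgn R).
  by apply: nondecreasing_series => i _ _; exact: harmonic_ge0.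
exists (\sum_(0 <= k < N) (k.+1%:R)^-1 + C) => _ [n _ <-].
rewrite /series /=.
have [nN|Nn] := leqP n N.
  apply: (@le_trans _ _ (\sum_(0 <= k < N) (k.+1%:R)^-1 + 0)).
    rewrite addr0 (big_cat_nat _ (n := n) (p := N)) //= lerDl.
    by apply: sumr_ge0 => i _; rewrite invr_ge0.
  rewrite lerD2l; have /negP := H N; rewrite -leNgt big_geq //.
rewrite (big_cat_nat _ (n := N)) ?(ltnW Nn)//= lerD2l.
by have /negP := H n; rewrite -leNgt.
Qed.

(** Eventually the error is absorbed by the contraction acting on [d]. The excess over [d] cannot
    stay above [d], because decrements of at least [g * d / n.+1] have a divergent sum, and once
    below [d] it stays there. *)
Lemma cvg0_of_contracting_steps (R : realType) (u e : nat -> R) (g : R) :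
  0 < g -> (forall n, 0 <= u n) ->
  (\forall n \near \oo, u n.+1 <= (1 - g / n.+1%:R) * u n + e n / n.+1%:R) ->
  e @ \oo --> 0 -> u @ \oo --> 0.
Proof.
move=> g0 u0 rec e0; apply/cvgrPdist_le => eps eps0.
pose d := eps / 2; have d0 : 0 < d by rewrite divr_gt0.
have [N _ HN] : \forall n \near \oo, [/\ u n.+1 <= (1 - g / n.+1%:R) * u n + e n / n.+1%:R,
    e n <= g * d & g <= n.+1%:R].
  near=> n; split; first by near: n.
  - have : `|0 - e n| <= g * d.
      by near: n; apply: (cvgrPdist_le _ _).1 => //; rewrite mulr_gt0.
    by rewrite sub0r normrN; apply: le_trans; rewrite ler_norm.
  - rewrite -natr1; apply: ler_wpDr => //; near: n.
    by exists (Num.truncn g).+1 => // k /= gk; apply/ltW/(lt_le_trans (truncnS_gt g)); rewrite ler_nat.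
pose v n := u n - d.
have vS n : (N <= n)%N -> v n.+1 <= (1 - g / n.+1%:R) * v n.
  move=> /HN[r1 r2 _]; rewrite /v lerBlDr; apply: (le_trans r1).
  have : e n / n.+1%:R <= g * d / n.+1%:R by rewrite ler_pM2r // invr_gt0.
  by rewrite mulrAC; move: (g / _) (e n / _) => q q'; nra.
have c01 n : (N <= n)%N -> 0 <= 1 - g / n.+1%:R <= 1.
  move=> /HN[_ _ r3]; rewrite subr_ge0 ler_pdivrMr ?ltr0n// mul1r r3 /=.
  by rewrite lerBlDr lerDl divr_ge0 // ltW.
have [n1 Nn1 vn1] : exists2 n1, (N <= n1)%N & v n1 <= d.
  apply: contrapT => /forall2NP H.
  have vd n : (N <= n)%N -> d < v n.
    by move=> Nn; have [//|/negP] := H n; rewrite -ltNge.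
  have Hs n : (N <= n)%N -> v n <= v N - g * d * \sum_(N <= k < n) (k.+1%:R)^-1.
    elim: n => [|n IH]; first by rewrite leqn0 => /eqP->; rewrite big_geq// mulr0 subr0.
    rewrite leq_eqVlt => /predU1P[<-|Nn]; first by rewrite big_geq // mulr0 subr0.
    rewrite big_nat_recr //= mulrDr opprD addrA.
    apply: (le_trans (vS _ Nn)); rewrite mulrBl mul1r.
    apply: lerB; first exact: IH.
    rewrite -mulrA (mulrC d) mulrA; apply: ler_wpM2l; first by rewrite divr_ge0 // ltW.
    exact/ltW/vd.
  have [n Hn] := harmonic_tail_unbounded N (v N / (g * d)).
  have [Nn|nN] := leqP N n.
    have := Hs n Nn; rewrite ltr_pdivrMr ?mulr_gt0// in Hn.
    by have := vd _ Nn; lra.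
  move: Hn; rewrite big_geq ?(ltnW nN)// ltNge => /negP; apply.
  by rewrite divr_ge0 // ?mulr_ge0 // ?ltW // (lt_trans d0)//; exact: vd.
have vle n : (n1 <= n)%N -> v n <= d.
  elim: n => [|n IH]; first by rewrite leqn0 => /eqP <-.
  rewrite leq_eqVlt => /predU1P[<-//|n1n].
  have Nn : (N <= n)%N by exact: leq_trans Nn1 n1n.
  apply: (le_trans (vS _ Nn)); have /andP[c0 c1] := c01 _ Nn.
  have [vn|vn] := leP (v n) 0.
    by apply: (@le_trans _ _ 0); [exact: mulr_ge0_le0|exact: ltW].
  by apply: (@le_trans _ _ (v n)); [rewrite ler_piMl// ltW|exact: IH].
exists n1 => // n /= n1n; rewrite sub0r normrN ger0_norm //.
by have := vle n n1n; rewrite /v /d; lra.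
Unshelve. all: by end_near. Qed.

(* [(c n - M n) / n] satisfies a linear recursion contracting to [a / (1 + lam)]. *)
Lemma cvg_linear_growth (R : realType) (c M a l : nat -> R) (a0 lam : R) :
  0 <= lam ->
  (forall n, c n.+1 - M n.+1 = c n - M n + a n - l n * c n) ->
  (\forall n \near \oo, 0 <= l n <= 1) ->
  a @ \oo --> a0 -> (fun n => n%:R * l n) @ \oo --> lam ->
  (fun n => M n / n%:R) @ \oo --> 0 ->
  (fun n => c n / n%:R) @ \oo --> a0 / (1 + lam).
Proof.
move=> lam0 rec l01 ca cl cM.
pose y := a0 / (1 + lam).
pose Y n := (c n - M n) / n%:R.
(* [y] solves [a0 - (1 + lam) * y = 0], which makes this error vanish. The 1 in [1 + lam] comes from
   dividing by [n.+1] instead of [n]. *)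
pose e n := a n - (1 + n%:R * l n) * y - n%:R * l n * (M n / n%:R).
have ce : e @ \oo --> 0.
  have -> : 0 = a0 - (1 + lam) * y - lam * 0.
    by rewrite mulr0 subr0 /y mulrC divfK ?subrr// gt_eqF// ltr_wpDr.
  apply: cvgB; last by apply: cvgM.
  apply: cvgB => //; apply: cvgM; last exact: cvg_cst.
  by apply: cvgD => //; exact: cvg_cst.
have : (fun n => `|Y n - y|) @ \oo --> 0.
  apply: (@cvg0_of_contracting_steps _ _ (fun n => `|e n|) 1) => //; last first.
    by apply/norm_cvg0P.
  near=> n.
  have n0 : n%:R != 0 :> R by rewrite pnatr_eq0 -lt0n; near: n; exists 1%N.
  have n1 : n.+1%:R != 0 :> R by rewrite pnatr_eq0.
  have -> : Y n.+1 - y = (n%:R * (1 - l n) / n.+1%:R) * (Y n - y) + e n / n.+1%:R.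
    rewrite /Y rec /e -natr1; rewrite -natr1 in n1.
    by field; rewrite n0 n1.
  apply: (le_trans (ler_normD _ _)); rewrite !normrM; apply: lerD; last first.
    by rewrite (@ger0_norm _ (_^-1)).
  apply: ler_wpM2r => //; have /andP[l0 l1] : 0 <= l n <= 1 by near: n.
  rewrite !ger0_norm ?subr_ge0// ler_pdivrMr ?ltr0n// mulrBl divfK// mul1r.
  by rewrite -natr1 addrK ler_piMr// gerBl.
move=> /norm_cvg0 /subr_cvg0 cY.
have -> : (fun n => c n / n%:R) = (fun n => Y n + M n / n%:R).
  by apply/funext => n; rewrite /Y mulrBl subrK.
by rewrite -[X in _ --> X]addr0; exact: cvgD.
Unshelve. all: by end_near. Qed.

(** * The minimizer of the potential *)

Lemma cvg_finsum (R : realType) (T : Type) (F : set_system T) {FF : Filter F}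
    (I : Type) (r : seq I) (f : I -> T -> R) (l : I -> R) :
  (forall i, f i x @[x --> F] --> l i) ->
  (\sum_(i <- r) f i x) @[x --> F] --> \sum_(i <- r) l i.
Proof.
move=> fl; elim: r => [|i r IH].
  by rewrite big_nil; under eq_fun do rewrite big_nil; exact: cvg_cst.
by rewrite big_cons; under eq_fun do rewrite big_cons; exact: cvgD.
Qed.

Lemma ln_le_subr1 (R : realType) (x : R) : 0 < x -> ln x <= x - 1.
Proof.
move=> x0; have := @le_ln1Dx R (x - 1).
by rewrite (addrC 1) subrK; apply; rewrite ltrBDr addrC subrr.
Qed.

Lemma ln_ge_1subV (R : realType) (x : R) : 0 < x -> 1 - x^-1 <= ln x.
Proof.
move=> x0; rewrite -[ln x]opprK -lnV// -[leLHS]opprB lerN2.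
by apply: ln_le_subr1; rewrite invr_gt0.
Qed.

Section minimizer.
Context (R : realType) (K : nat) (hK : (0 < K)%N).
Variables (pi : 'I_K -> R) (kappa : 'I_K -> 'I_K -> R) (m : 'I_K -> nat).
Hypothesis (pi_gt0 : forall a, 0 < pi a).
Hypothesis (kappa_gt0 : forall a b, 0 < kappa a b) (m_ge1 : forall a, (1 <= m a)%N).

Definition edge_mass (b : 'I_K) : R := (m b)%:R * pi b.
Definition col_mass (y : 'I_K -> R) (b : 'I_K) : R := \sum_l kappa l b * y l.
(** Mean increase of the type-[a] degree in one step when degrees are proportional to [y]: the edges
    brought by type-[a] newcomers, and those that land on type [a]. The derivative of the potential
    in [y a] is [1 - mean_drift y a / (2 * y a)]. *)
Definition mean_drift (y : 'I_K -> R) (a : 'I_K) : R :=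
  edge_mass a + y a * \sum_b edge_mass b * kappa a b / col_mass y b.

Lemma edge_mass_gt0 b : 0 < edge_mass b.
Proof. by rewrite mulr_gt0 // ltr0n. Qed.

Lemma col_mass_gt0 (y : 'I_K -> R) b : (forall i, 0 < y i) -> 0 < col_mass y b.
Proof.
move=> y0; rewrite /col_mass (bigD1 (Ordinal hK))//= ltr_wpDr ?mulr_gt0//.
by apply: sumr_ge0 => i _; rewrite mulr_ge0 // ltW.
Qed.

Lemma potentialE (y : {ffun 'I_K -> R}) : potential pi kappa m y =
  \sum_i y i - 2^-1 * \sum_j edge_mass j * (ln (y j) + ln (col_mass y j)).
Proof.
congr (_ - _ * _); apply: eq_bigr => j _; congr (_ * (_ + ln _)).
by apply: eq_bigr => k _; rewrite mulrC.
Qed.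

Let one : {ffun 'I_K -> R} := [ffun=> 1].

Lemma potential_coercive : exists (lo : 'I_K -> R) (hi : R),
  (forall i, 0 < lo i) /\ forall z : {ffun 'I_K -> R}, orthant z ->
  potential pi kappa m z <= potential pi kappa m one ->
  forall i, lo i <= z i <= hi.
Proof.
pose V1 := potential pi kappa m one.
pose c := \sum_j edge_mass j.
have ec j : edge_mass j <= c.
  by rewrite /c (bigD1 j)//= lerDl sumr_ge0// => i _; exact/ltW/edge_mass_gt0.
have c0 : 0 < c by exact: lt_le_trans (edge_mass_gt0 (Ordinal hK)) (ec _).
pose kM := \sum_a \sum_b kappa a b.
have kkM a b : kappa a b <= kM.
  rewrite /kM (bigD1 a)//= (bigD1 b)//= -addrA lerDl addr_ge0//; last first.
    by apply: sumr_ge0 => i _; apply: sumr_ge0 => j _; exact: ltW.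
  by apply: sumr_ge0 => j _; exact: ltW.
have kM0 : 0 < kM by exact: lt_le_trans (kappa_gt0 (Ordinal hK) (Ordinal hK)) (kkM _ _).
(* Obtained by replacing [ln T] with its tangent at [2 * c], whose slope uses up only half of the
   linear term [T]. *)
pose hi0 := 2 * (V1 + c * ln (2 * c) - c + 2^-1 * c * ln kM).
pose hi := Num.max hi0 1.
pose B := V1 + c * ln hi + 2^-1 * (c * `|ln kM|).
pose lo i := expR (- (2 / edge_mass i * B)).
exists lo, hi; split; first by move=> i; exact: expR_gt0.
move=> z z0 zV i.
pose T := \sum_i z i.
have zT j : z j <= T.
  by rewrite /T (bigD1 j)//= lerDl sumr_ge0// => k _; exact/ltW/z0.
have T0 : 0 < T by apply: lt_le_trans (zT (Ordinal hK)); exact: z0.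
have lnz j : ln (z j) <= ln T by rewrite ler_ln ?posrE//; exact: z0.
have lnS j : ln (col_mass z j) <= ln kM + ln T.
  rewrite -lnM ?posrE// ler_ln ?posrE ?mulr_gt0// ?col_mass_gt0//.
  rewrite /T mulr_sumr; apply: ler_sum => k _; rewrite ler_wpM2r//; exact/ltW/z0.
have sumS : \sum_j edge_mass j * ln (col_mass z j) <= c * (ln kM + ln T).
  by rewrite mulr_suml; apply: ler_sum => j _; rewrite ler_wpM2l// ltW ?edge_mass_gt0.
have lnT : ln T <= T / (2 * c) + ln (2 * c) - 1.
  have -> : T / (2 * c) + ln (2 * c) - 1 = (T / (2 * c) - 1) + ln (2 * c) by ring.
  rewrite -lerBlDr -ln_div ?posrE ?mulr_gt0//.
  by apply: ln_le_subr1; rewrite divr_gt0// mulr_gt0.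
move: zV; rewrite potentialE -/V1 -/T.
under eq_bigr do rewrite mulrDr.
rewrite big_split/= => zV.
have sumz : \sum_j edge_mass j * ln (z j) <= c * ln T.
  by rewrite mulr_suml; apply: ler_sum => j _; rewrite ler_wpM2l// ltW ?edge_mass_gt0.
have Thi0 : T <= hi0.
  have h1 : c * ln T <= T / 2 + c * ln (2 * c) - c.
    have -> : T / 2 + c * ln (2 * c) - c = c * (T / (2 * c) + ln (2 * c) - 1).
      by field; rewrite gt_eqF.
    by rewrite ler_pM2l.
  by rewrite /hi0; lra.
have Thi : T <= hi by rewrite le_max Thi0.
have hi1 : 1 <= hi by rewrite le_max lexx orbT.
have lnhi : ln T <= ln hi by rewrite ler_ln ?posrE// (lt_le_trans T0).
have lnhi0 : 0 <= ln hi by exact: ln_ge0.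
apply/andP; split; last exact: le_trans (zT i) Thi.
rewrite -[z i]lnK ?posrE; last exact: z0.
rewrite ler_expR lerNl.
have sumzi : \sum_j edge_mass j * ln (z j) <= edge_mass i * ln (z i) + c * ln hi.
  rewrite (bigD1 i)//= lerD2l.
  apply: (@le_trans _ _ (\sum_(j | j != i) edge_mass j * ln hi)).
    apply: ler_sum => j _; rewrite ler_wpM2l ?(ltW (edge_mass_gt0 _))//.
    exact: le_trans (lnz j) lnhi.
  rewrite -mulr_suml ler_wpM2r// /c [leRHS](bigD1 i)//= lerDr; exact/ltW/edge_mass_gt0.
have h2 : c * (ln kM + ln T) <= c * `|ln kM| + c * ln hi.
  by rewrite -mulrDr ler_pM2l// lerD// ler_norm.
rewrite -(ler_pM2l (edge_mass_gt0 i)).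
have -> : edge_mass i * (2 / edge_mass i * B) = 2 * B.
  by field; rewrite gt_eqF// edge_mass_gt0.
by rewrite /B; nra.
Qed.

(** A minimizer on the compact box is global: outside it the potential exceeds its value at [one],
    which lies in the box. Row vectors give access to the extreme value theorem. *)
Lemma potential_has_min : exists2 y : {ffun 'I_K -> R}, orthant y &
  forall z, orthant z -> potential pi kappa m y <= potential pi kappa m z.
Proof.
have [lo [hi [lo0 box]]] := potential_coercive.
have one0 : orthant one by move=> i; rewrite ffunE.
pose g (v : 'rV[R]_K) : {ffun 'I_K -> R} := [ffun i => v ord0 i].
pose B := [set v : 'rV[R]_K | forall i, `[lo i, hi]%classic (v ord0 i)].
have B0 v : v \in B -> orthant (g v).
  rewrite inE => Bv i; rewrite ffunE; have := Bv i.
  by rewrite /= in_itv/= => /andP[+ _]; exact: lt_le_trans.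
have gB z : orthant z -> potential pi kappa m z <= potential pi kappa m one ->
    (\row_i z i) \in B /\ g (\row_i z i) = z.
  move=> z0 /(box _ z0) zb; split; last by apply/ffunP => i; rewrite ffunE mxE.
  by rewrite inE => i; rewrite /= in_itv/= mxE.
have [||| y yB ymin] := @EVT_min_rV R K (fun v => potential pi kappa m (g v)) B.
- by exists (\row_i one i); have [] := gB one one0 (lexx _); rewrite inE.
- by apply: (@rV_compact R K (fun i => `[lo i, hi]%classic)) => i; exact: segment_compact.
- apply: continuous_in_subspaceT => v /B0 gv.
  have gc i : (fun v => g v i) @ v --> g v i.
    have -> : (fun v => g v i) = (fun v : 'rV[R]_K => v ord0 i).
      by apply/funext => u; rewrite ffunE.
    by rewrite ffunE; exact: coord_continuous.
  suff : (fun u => potential pi kappa m (g u)) @ nbhs v --> potential pi kappa m (g v) by [].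
  under eq_fun do rewrite potentialE.
  rewrite potentialE.
  have : Filter (nbhs v) by exact: nbhs_filter.
  move: gc; generalize (nbhs v) => F gc FF.
  apply: cvgB; first by apply: cvg_finsum => i; exact: gc.
  apply: cvgM; first exact: cvg_cst.
  apply: cvg_finsum => j; apply: cvgM; first exact: cvg_cst.
  apply: cvgD.
    by apply: (cvg_comp _ _ (gc j)); apply: continuous_ln; exact: gv.
  have Sc : (fun v => col_mass (g v) j) @ F --> col_mass (g v) j.
    by apply: cvg_finsum => l; apply: cvgM; [exact: cvg_cst|exact: gc].
  by apply: (cvg_comp _ _ Sc); apply: continuous_ln; exact: col_mass_gt0.
exists (g y); first exact: B0.
move=> z z0.
have [zV|/ltW zV] := leP (potential pi kappa m z) (potential pi kappa m one).
  by have [zB zE] := gB _ z0 zV; rewrite -zE; exact: ymin.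
apply: le_trans zV; have [oB oE] := gB _ one0 (lexx _); rewrite -oE; exact: ymin.
Qed.

Lemma eta_min : orthant (Defs.eta pi kappa m) /\
  forall z, orthant z -> potential pi kappa m (Defs.eta pi kappa m) <= potential pi kappa m z.
Proof.
have [y y0 ymin] := potential_has_min.
exact: (@xgetPex _ one [set y | orthant y /\
  forall z, orthant z -> potential pi kappa m y <= potential pi kappa m z]
  (ex_intro _ y (conj y0 ymin))).
Qed.

Lemma eta_gt0 i : 0 < Defs.eta pi kappa m i.
Proof. by have [+ _] := eta_min; apply. Qed.

(** First-order condition in one coordinate, without differentiating: concavity of [ln] bounds twice
    the change of the potential above by [t * (2 - h t)], which is thus nonnegative for small [t] of
    either sign, and continuity of [h] forces [h 0 = 2]. *)
Lemma eta_critical a : 2 * Defs.eta pi kappa m a = mean_drift (Defs.eta pi kappa m) a.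
Proof.
have [y0 ymin] := eta_min; set y := Defs.eta pi kappa m in y0 ymin *.
pose S := col_mass y.
have S0 b : 0 < S b by exact: col_mass_gt0.
pose h t := edge_mass a / (y a + t) + \sum_b edge_mass b * (kappa a b / (S b + t * kappa a b)).
have step t : - y a < t -> (forall b, - S b < t * kappa a b) -> 0 <= t * (2 - h t).
  move=> yt St.
  pose z : {ffun 'I_K -> R} := [ffun i => if i == a then y i + t else y i].
  have z0 : orthant z.
    move=> i; rewrite ffunE; case: eqP => [->|_]; last exact: y0.
    by rewrite -ltrBlDl sub0r.
  have zS b : col_mass z b = S b + t * kappa a b.
    rewrite /S /col_mass (bigD1 a)//= [in RHS](bigD1 a)//= ffunE eqxx.
    rewrite (eq_bigr (fun l => kappa l b * y l)); first by ring.
    by move=> l /negPf la; rewrite ffunE la.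
  have := ymin _ z0; rewrite !potentialE.
  have -> : \sum_i z i = \sum_i y i + t.
    rewrite (bigD1 a)//= [in RHS](bigD1 a)//= ffunE eqxx.
    rewrite (eq_bigr (fun l => y l)); first by ring.
    by move=> l /negPf la; rewrite ffunE la.
  rewrite lerBlDr -subr_ge0.
  have -> (u v w : R) : u + t - 2^-1 * v + 2^-1 * w - u = 2^-1 * (2 * t - (v - w)).
    by field.
  rewrite pmulr_rge0// subr_ge0 -sumrB => le2.
  rewrite mulrBr subr_ge0 [X in _ <= X]mulrC; apply: le_trans le2.
  rewrite (bigD1 a)//= /h mulrDr.
  have lnge (x s : R) : 0 < x -> - x < s -> s / (x + s) <= ln (x + s) - ln x.
    move=> x0 xs; have xs0 : 0 < x + s by rewrite -ltrBlDl sub0r.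
    rewrite -ln_div ?posrE//; apply: le_trans (ln_ge_1subV _); last by rewrite divr_gt0.
    by rewrite le_eqVlt; apply/orP; left; apply/eqP; field; rewrite !gt_eqF.
  have -> : t * (\sum_b edge_mass b * (kappa a b / (S b + t * kappa a b))) =
     edge_mass a * ((t * kappa a a) / (S a + t * kappa a a)) +
     \sum_(b | b != a) edge_mass b * ((t * kappa a b) / (S b + t * kappa a b)).
    rewrite (bigD1 a)//= mulrDr mulr_sumr; congr (_ + _); first by ring.
    by apply: eq_bigr => b _; ring.
  rewrite addrA; apply: lerD.
    rewrite -mulrBr opprD addrACA zS ffunE eqxx.
    have -> (u v : R) : t * (u / v) = u * (t / v) by ring.
    rewrite -mulrDr ler_pM2l ?edge_mass_gt0//; apply: lerD; first exact: lnge.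
    exact: lnge.
  apply: ler_sum => b /negPf ba; rewrite zS ffunE ba.
  rewrite -mulrBr opprD addrACA subrr add0r ler_pM2l ?edge_mass_gt0//; exact: lnge.
have hc : h @ 0 --> h 0.
  apply: cvgD.
    apply: cvgM; first exact: cvg_cst.
    apply: cvgV; first by rewrite addr0 gt_eqF.
    by apply: cvgD; [exact: cvg_cst|exact: cvg_id].
  apply: cvg_finsum => b; apply: cvgM; first exact: cvg_cst.
  apply: cvgM; first exact: cvg_cst.
  apply: cvgV; first by rewrite mul0r addr0 gt_eqF.
  by apply: cvgD; [exact: cvg_cst|apply: cvgM; [exact: cvg_id|exact: cvg_cst]].
have gt0n (z : R) : z < 0 -> \forall t \near (0 : R), z < t.
  by move=> z0; exact: (@cvgr_gt R R (nbhs (0 : R)) _ id 0 cvg_id z z0).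
have near1 : \forall t \near (0 : R), - y a < t by apply: gt0n; rewrite oppr_lt0.
have near2 : \forall t \near (0 : R), forall b, - S b < t * kappa a b.
  apply: (@filter_forall _ _ _ (nbhs (0 : R))) => b; near=> t.
  rewrite -ltr_pdivrMr//; near: t; apply: gt0n.
  by rewrite ltr_pdivrMr// mul0r oppr_lt0.
suff h2 : h 0 = 2.
  rewrite -h2 /h /mean_drift addr0 mulrDl divfK ?gt_eqF//; congr (_ + _).
  rewrite mulrC; congr (_ * _).
  by apply: eq_bigr => b _; rewrite mul0r addr0 mulrA.
apply/eqP; rewrite eq_le; apply/andP; split; rewrite leNgt; apply/negP => h2.
- have near3 := @cvgr_gt _ _ _ _ _ _ hc 2 h2.
  have [e e0 He] : exists2 e : R, 0 < e & forall t, `|0 - t| < e ->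
     [/\ - y a < t, forall b, - S b < t * kappa a b & 2 < h t].
    have /nbhs_ballP[e /= e0 He] : \forall t \near (0:R), [/\ - y a < t, forall b, - S b < t * kappa a b & 2 < h t].
      by refine (@filterS3 _ (nbhs (0:R)) _ _ _ _ _ _ near1 near2 (near3 _)) => t ? ? ?; split.
    by exists e => // t te; exact: He.
  have [|t1 t2 t3] := He (e / 2); first by rewrite sub0r normrN gtr0_norm ?divr_gt0// gtr_pMr// invf_lt1// ltr1n.
  have := step _ t1 t2; rewrite pmulr_rge0 ?divr_gt0// subr_ge0 leNgt t3 //.
- have near3 := @cvgr_lt _ _ _ _ _ _ hc 2 h2.
  have [e e0 He] : exists2 e : R, 0 < e & forall t, `|0 - t| < e ->
     [/\ - y a < t, forall b, - S b < t * kappa a b & h t < 2].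
    have /nbhs_ballP[e /= e0 He] : \forall t \near (0:R), [/\ - y a < t, forall b, - S b < t * kappa a b & h t < 2].
      by refine (@filterS3 _ (nbhs (0:R)) _ _ _ _ _ _ near1 near2 (near3 _)) => t ? ? ?; split.
    by exists e => // t te; exact: He.
  have [|t1 t2 t3] := He (- (e / 2)); first by rewrite sub0r opprK gtr0_norm ?divr_gt0// gtr_pMr// invf_lt1// ltr1n.
  have := step _ t1 t2; rewrite mulNr oppr_ge0 pmulr_rle0 ?divr_gt0// subr_le0 leNgt t3 //.
Unshelve. all: by end_near. Qed.

End minimizer.

(** * Convergence of the degree proportions *)

Lemma cvg0_bounded_mul (R : realType) (f g : nat -> R) (C : R) :
  f @ \oo --> 0 -> (\forall n \near \oo, `|g n| <= C) ->
  (fun n => g n * f n) @ \oo --> 0.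
Proof.
move=> f0 gC; apply/norm_cvg0P.
apply: (@squeeze_cvgr _ _ _ _ (fun=> 0) (fun n => C * `|f n|)).
- near=> n; rewrite normr_ge0 normrM/= ler_wpM2r//; near: n; exact: gC.
- exact: cvg_cst.
- rewrite -(mulr0 C); apply: cvgM; first exact: cvg_cst.
  by apply/norm_cvg0P.
Unshelve. all: by end_near. Qed.

Section degree_dynamics.
Context (R : realType) (K : nat) (hK : (0 < K)%N).
Variables (pi : 'I_K -> R) (kappa : 'I_K -> 'I_K -> R) (m : 'I_K -> nat).
Hypothesis (pi_gt0 : forall a, 0 < pi a).
Hypothesis (kappa_gt0 : forall a b, 0 < kappa a b) (m_ge1 : forall a, (1 <= m a)%N).

Local Notation c := (edge_mass pi m).
Local Notation S := (col_mass kappa).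
Local Notation F := (mean_drift pi kappa m).

Let c0 a : 0 < c a. Proof. exact: edge_mass_gt0. Qed.

(** Homogeneity of degree 0: the drift sees only proportions, so degrees may be divided by [n]
    inside it. *)
Lemma mean_driftZ (t : R) (y : 'I_K -> R) a : t != 0 -> F (fun i => t * y i) a = F y a.
Proof.
move=> t0; rewrite /mean_drift; congr (_ + _).
rewrite mulr_sumr [RHS]mulr_sumr; apply: eq_bigr => b _.
have -> : S (fun i => t * y i) b = t * S y b.
  by rewrite /col_mass mulr_sumr; apply: eq_bigr => l _; rewrite mulrCA.
by rewrite invfM; move: (S y b)^-1 => s; field.
Qed.

(** Each new edge raises the total degree by two, whatever the proportions. *)
Lemma sum_mean_drift (y : 'I_K -> R) : (forall b, S y b != 0) ->
  \sum_a F y a = 2 * \sum_a c a.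
Proof.
move=> Sy; rewrite big_split/= mulrDl mul1r; congr (_ + _).
under eq_bigr do rewrite mulr_sumr.
rewrite exchange_big/=; apply: eq_bigr => b _.
rewrite (eq_bigr (fun i => c b / S y b * (kappa i b * y i))) => [|i _]; last by ring.
by rewrite -mulr_sumr divfK.
Qed.

Lemma col_mass_gt0_of_sum (y : 'I_K -> R) b : (forall i, 0 <= y i) -> 0 < \sum_i y i ->
  0 < S y b.
Proof.
move=> y0 ys; rewrite lt_neqAle eq_sym sumr_ge0 ?andbT; last first.
  by move=> i _; rewrite mulr_ge0 // ltW.
apply/negP => /eqP S0; have: \sum_i y i = 0; last by move=> ys0; rewrite ys0 ltxx in ys.
apply: big1 => i _; apply/eqP.
have /(_ S0) H := psumr_eq0P (P := predT) (fun j _ => mulr_ge0 (ltW (kappa_gt0 j b)) (y0 j)).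
by have /eqP := H i isT; rewrite mulf_eq0 (gt_eqF (kappa_gt0 i b)).
Qed.

Lemma mean_drift_ge (y : 'I_K -> R) a : (forall i, 0 <= y i) -> c a <= F y a.
Proof.
move=> y0; rewrite lerDl mulr_ge0// sumr_ge0// => b _.
apply: mulr_ge0; first by rewrite mulr_ge0// ltW.
by rewrite invr_ge0 sumr_ge0// => l _; rewrite mulr_ge0// ltW.
Qed.

Lemma col_massB (x y : 'I_K -> R) b : S (fun i => x i - y i) b = S x b - S y b.
Proof. by rewrite /col_mass -sumrB; apply: eq_bigr => l _; rewrite mulrBr. Qed.

(* Monotonicity of the gradient of the potential, with an explicit modulus. *)
Lemma mean_drift_dissipation (th y : 'I_K -> R) :
  (forall a, 0 < th a) -> (forall a, th a = F th a) -> (forall a, 0 < y a) ->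
  \sum_a (F y a - y a) * (1 - th a / y a) <= - \sum_a c a * ((y a - th a) ^+ 2 / (y a * th a)).
Proof.
move=> th0 thF y0.
have Sy b : 0 < S y b by exact: col_mass_gt0.
have Sth b : 0 < S th b by exact: col_mass_gt0.
have E a : (F y a - y a) * (1 - th a / y a) =
  - (c a * ((y a - th a) ^+ 2 / (y a * th a))) +
  \sum_b (kappa a b * (y a - th a)) * (c b * ((S y b)^-1 - (S th b)^-1)).
  have -> : (F y a - y a) * (1 - th a / y a) = (F y a / y a - F th a / th a) * (y a - th a).
    by rewrite -thF; field; rewrite !gt_eqF.
  have Fd z : 0 < z a -> F z a / z a = c a / z a + \sum_b c b * kappa a b / S z b.
    by move=> za; rewrite /mean_drift mulrDl [z a * _]mulrC mulfK// gt_eqF.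
  rewrite !Fd// opprD addrACA mulrDl -sumrB mulr_suml.
  congr (_ + _); first by field; rewrite !gt_eqF.
  by apply: eq_bigr => b _; ring.
under eq_bigr do rewrite E.
(* For each [b] the remaining sum is a negative multiple of the squared difference of the two column
   masses, and is dropped. *)
rewrite big_split/= sumrN gerDl exchange_big/= sumr_le0// => b _.
rewrite -mulr_suml.
have -> : \sum_a kappa a b * (y a - th a) = S y b - S th b by rewrite -col_massB.
have -> : (S y b - S th b) * (c b * ((S y b)^-1 - (S th b)^-1)) =
   - (c b * (S y b - S th b) ^+ 2 / (S y b * S th b)).
  by field; rewrite !gt_eqF.
rewrite oppr_le0 divr_ge0//; first by rewrite mulr_ge0 ?sqr_ge0// ltW.
by rewrite ltW// mulr_gt0.
Qed.

(** Kullback-Leibler divergence of [th] from [y], for unnormalized vectors. *)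
Definition rel_entropy (th y : 'I_K -> R) : R :=
  \sum_a (y a - th a - th a * ln (y a / th a)).

(** With [s] the square root of [y / th], the bound [ln s <= s - 1] gives
    [s ^ 2 - 1 - 2 * ln s >= (s - 1) ^ 2]. This Hellinger-type bound turns a vanishing entropy into
    convergence of each coordinate. *)
Lemma rel_entropy_sqrt (th y : 'I_K -> R) a :
  (forall a, 0 < th a) -> (forall a, 0 < y a) ->
  th a * (Num.sqrt (y a / th a) - 1) ^+ 2 <= rel_entropy th y.
Proof.
move=> th0 y0.
have H i : th i * (Num.sqrt (y i / th i) - 1) ^+ 2 <= y i - th i - th i * ln (y i / th i).
  set s := Num.sqrt _; have yth : 0 < y i / th i by rewrite divr_gt0.
  have s0 : 0 < s by rewrite sqrtr_gt0.
  have ss : y i / th i = s ^+ 2 by rewrite sqr_sqrtr// ltW.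
  have yE : y i = th i * s ^+ 2 by rewrite -ss mulrC divfK ?gt_eqF.
  rewrite ss lnXn// yE -mulr_natl.
  have := ln_le_subr1 s0; rewrite -(ler_pM2l (th0 i)).
  by move: (ln s) => l; nra.
rewrite /rel_entropy (bigD1 a)//= -[leLHS]addr0; apply: lerD; first exact: H.
by apply: sumr_ge0 => i _; apply: le_trans (H i); rewrite mulr_ge0 ?sqr_ge0// ltW.
Qed.

Lemma rel_entropy_ge0 (th y : 'I_K -> R) :
  (forall a, 0 < th a) -> (forall a, 0 < y a) -> 0 <= rel_entropy th y.
Proof.
move=> th0 y0; apply: le_trans (rel_entropy_sqrt (Ordinal hK) th0 y0).
by rewrite mulr_ge0 ?sqr_ge0// ltW.
Qed.

(** The chi-square quantity on the right is controlled by the dissipation, so the entropy decays at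
    a rate proportional to itself. *)
Lemma rel_entropy_le (th y : 'I_K -> R) :
  (forall a, 0 < th a) -> (forall a, 0 < y a) ->
  rel_entropy th y <= \sum_a (y a - th a) ^+ 2 / y a.
Proof.
move=> th0 y0; apply: ler_sum => a _.
have yth : 0 < y a / th a by rewrite divr_gt0.
have : th a * (1 - th a / y a) <= th a * ln (y a / th a).
  by rewrite ler_pM2l// -[X in 1 - X]invf_div ln_ge_1subV.
have -> : th a * (1 - th a / y a) = th a - (th a) ^+ 2 / y a by ring.
have -> : (y a - th a) ^+ 2 / y a = y a - 2 * th a + (th a)^+2 / y a.
  by field; rewrite gt_eqF.
by move: (ln _) => l; nra.
Qed.

(** First-order term plus a quadratic remainder: for increments of order 1 / n the remainder is of
    order 1 / n^2. *)
Lemma rel_entropy_step (th y y' : 'I_K -> R) :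
  (forall a, 0 < th a) -> (forall a, 0 < y a) -> (forall a, 0 < y' a) ->
  rel_entropy th y' - rel_entropy th y <=
  \sum_a ((y' a - y a) * (1 - th a / y a) + th a * (y' a - y a) ^+ 2 / (y a * y' a)).
Proof.
move=> th0 y0 y0'; rewrite -sumrB; apply: ler_sum => a _.
have yy : 0 < y' a / y a by rewrite divr_gt0.
have : th a * (1 - y a / y' a) <= th a * ln (y' a / y a).
  by rewrite ler_pM2l// -[X in 1 - X]invf_div ln_ge_1subV.
rewrite !ln_div ?posrE//.
have -> : (y' a - y a) * (1 - th a / y a) + th a * (y' a - y a) ^+ 2 / (y a * y' a) =
  y' a - y a - th a * (1 - y a / y' a) by field; rewrite !gt_eqF.
by move: (ln (y' a)) (ln (y a)) => l l'; nra.
Qed.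

Section trajectory.
Variables (D M : nat -> 'I_K -> R) (th : 'I_K -> R).
Hypothesis th0 : forall a, 0 < th a.
Hypothesis thF : forall a, th a = F th a.
Hypothesis D0 : forall n a, 0 <= D n a.
Hypothesis Dsum : forall n, 0 < \sum_a D n a.
Hypothesis M0 : forall a, M 0%N a = 0.
Hypothesis Mcvg : forall a, (fun n => M n a / n%:R) @ \oo --> 0.
Hypothesis rec : forall n a, D n.+1 a - M n.+1 a = D n a - M n a + F (D n) a.

(** Without the martingale the path moves by a function of [D n] alone. For positive [n] it stays
    above [c], hence away from the singularities of logarithms and quotients, which [z] need not do
    at early times. *)
Let Y n a := (D n a - M n a) / n%:R.
Let z n a := D n a / n%:R.
Let del n a := M n a / n%:R.

Let zE n a : z n a = Y n a + del n a.
Proof. by rewrite /z /Y /del mulrBl subrK. Qed.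

Let DM n a : n%:R * c a <= D n a - M n a.
Proof.
elim: n => [|n IH]; first by rewrite mul0r M0 subr0.
by rewrite rec -natr1 mulrDl mul1r lerD// mean_drift_ge.
Qed.

Let Yge n a : (0 < n)%N -> c a <= Y n a.
Proof. by move=> n0; rewrite ler_pdivlMr ?ltr0n// mulrC. Qed.

Let Y0 n a : (0 < n)%N -> 0 < Y n a.
Proof. by move=> n0; exact: lt_le_trans (Yge a n0). Qed.

Let csum := \sum_a c a.
Let B := \sum_a D 0%N a + 2 * csum.

Let sumDM n : \sum_a (D n a - M n a) = \sum_a D 0%N a + n%:R * (2 * csum).
Proof.
elim: n => [|n IH].
  by rewrite mul0r addr0; apply: eq_bigr => a _; rewrite M0 subr0.
under eq_bigr do rewrite rec.
rewrite big_split/= IH sum_mean_drift => [|b].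
  rewrite -[n.+1%:R]natr1; rewrite -/csum; ring.
by rewrite gt_eqF// col_mass_gt0_of_sum.
Qed.

Let Yle n a : (0 < n)%N -> Y n a <= B.
Proof.
move=> n0; have n1 : 0 < n%:R :> R by rewrite ltr0n.
rewrite ler_pdivrMr//; apply: (@le_trans _ _ (\sum_a (D n a - M n a))).
  rewrite (bigD1 a)//= lerDl; apply: sumr_ge0 => i _.
  by apply: le_trans (DM n i); rewrite mulr_ge0// ltW.
rewrite sumDM /B [leRHS]mulrDl [n%:R * _]mulrC lerD2r.
by rewrite ler_peMr ?ler1n ?sumr_ge0.
Qed.

Let recY n a : (0 < n)%N -> Y n.+1 a - Y n a = (F (z n) a - Y n a) / n.+1%:R.
Proof.
move=> n0; rewrite {1}/Y rec.
have -> : F (D n) a = F (z n) a.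
  rewrite /z -(@mean_driftZ n%:R^-1 (D n)) ?invr_eq0 ?pnatr_eq0 -?lt0n//.
  by congr (mean_drift _ _ _ _ _); apply/funext => i; rewrite mulrC.
have -> : D n a - M n a = n%:R * Y n a.
  by rewrite /Y mulrC divfK// pnatr_eq0 -lt0n.
rewrite -natr1; field; by rewrite natr1 pnatr_eq0.
Qed.

Let err n a := F (z n) a - F (Y n) a.

Let B_ge0 : 0 <= B.
Proof. by rewrite addr_ge0 ?mulr_ge0 ?sumr_ge0// => i _; exact: ltW. Qed.

(** The difference of the drifts is linear in [del], with coefficients that stay bounded because
    both column masses are eventually bounded below. *)
Let err_cvg a : (fun n => err n a) @ \oo --> 0.
Proof.
pose T n b := c b * kappa a b * ((S (z n) b)^-1 * del n a -
   Y n a / (S (z n) b * S (Y n) b) * S (del n) b).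
have Sdel b : (fun n => S (del n) b) @ \oo --> 0.
  rewrite -(_ : \sum_l kappa l b * 0 = 0 :> R); last by rewrite big1// => l _; rewrite mulr0.
  by apply: cvg_finsum => l; apply: cvgM; [exact: cvg_cst|exact: Mcvg].
have n0 : \forall n \near \oo, (0 < n)%N by exists 1%N.
(* Half of the lower bound for [Y]; the other half absorbs the martingale part. *)
pose s b := 2^-1 * S c b.
have s0 b : 0 < s b by rewrite mulr_gt0// col_mass_gt0.
have Syge b n : (0 < n)%N -> S c b <= S (Y n) b.
  move=> n1; apply: ler_sum => l _; rewrite ler_wpM2l ?(ltW (kappa_gt0 _ _))//.
  exact: Yge.
have Szge b : \forall n \near \oo, s b <= S (z n) b.
  near=> n; have n1 : (0 < n)%N by near: n.
  have -> : S (z n) b = S (Y n) b + S (del n) b.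
    rewrite /col_mass -big_split; apply: eq_bigr => l _ /=.
    by rewrite zE mulrDr.
  have h1 := Syge b n n1.
  have h2 : `|S (del n) b| <= s b by near: n; apply: cvgr0_norm_le => //; exact: Sdel.
  by have := ler_normlW (eq_ind _ (fun x => x <= s b) h2 _ (esym (normrN _))); rewrite /s in h2 *; lra.
have ET : \forall n \near \oo, err n a = \sum_b T n b.
  near=> n; have n1 : (0 < n)%N by near: n.
  rewrite /err /mean_drift opprD addrACA subrr add0r !mulr_sumr -sumrB.
  apply: eq_bigr => b _; rewrite /T.
  have Sz : 0 < S (z n) b.
    apply: (lt_le_trans (s0 b)); move: b; near: n; exact: filter_forall.
  have Sy : 0 < S (Y n) b by apply: col_mass_gt0 => // i; exact: Y0.
  have -> : S (del n) b = S (z n) b - S (Y n) b.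
    by rewrite -col_massB; apply: eq_bigr => l _; rewrite zE addrC addKr.
  have -> : del n a = z n a - Y n a by rewrite zE addrC addKr.
  by field; rewrite !gt_eqF.
suff H : (fun n => \sum_b T n b) @ \oo --> \sum_(b < K) (c b * kappa a b * (0 - 0)).
  rewrite big1 in H => [|b _]; last by rewrite subr0 mulr0.
  apply: cvg_trans H; apply: near_eq_cvg.
  by near=> n; apply: esym; near: n; exact: ET.
apply: cvg_finsum => b; apply: cvgM; first exact: cvg_cst.
apply: cvgB.
  apply: (@cvg0_bounded_mul _ _ _ (s b)^-1); first exact: Mcvg.
  near=> n; have sz : s b <= S (z n) b by near: n.
  by rewrite ger0_norm ?invr_ge0 ?lef_pV2 ?posrE// ?(lt_le_trans (s0 b))// ltW// (lt_le_trans (s0 b)).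
apply: (@cvg0_bounded_mul _ _ _ (B / (s b * S c b))); first exact: Sdel.
near=> n; have sz : s b <= S (z n) b by near: n.
have n1 : (0 < n)%N by near: n.
have Sc : 0 < S c b by exact: col_mass_gt0.
have Sy : 0 < S (Y n) b by apply: col_mass_gt0 => // i; exact: Y0.
have Sz : 0 < S (z n) b by exact: lt_le_trans (s0 b) sz.
rewrite ger0_norm; last by apply: divr_ge0; [rewrite ltW// Y0|rewrite ltW// mulr_gt0].
apply: ler_pM; [by rewrite ltW// Y0|by rewrite invr_ge0 ltW// mulr_gt0|exact: Yle|].
have SS : s b * S c b <= S (z n) b * S (Y n) b.
  by apply: ler_pM; [exact: ltW|exact: ltW|exact: sz|exact: Syge].
by rewrite lef_pV2 ?posrE; [exact: SS|exact: mulr_gt0|exact: mulr_gt0].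
Unshelve. all: by end_near. Qed.

(** The entropy relative to [th] of the corrected path obeys a contracting recursion: the
    dissipation contracts, while [err] and the quadratic remainder are vanishing errors. *)
Lemma cvg_degree_proportion a : (fun n => D n a / n%:R) @ \oo --> th a.
Proof.
(* [Y 0] involves a division by 0; the value 0 keeps [L] nonnegative at time 0. *)
pose L n := if n is 0%N then 0 else rel_entropy th (Y n).
(* A common lower bound for the ratios [c i / th i], by which the dissipation dominates the
   entropy. *)
pose g := (\sum_a th a / c a)^-1.
have S0 : 0 < \sum_a th a / c a.
  rewrite (bigD1 a)//= ltr_wpDr ?divr_gt0//.
  by apply: sumr_ge0 => i _; rewrite divr_ge0// ltW.
have g0 : 0 < g by rewrite invr_gt0.
have gle i : g <= c i / th i.
  rewrite -[c i / th i]invrK lef_pV2 ?posrE ?invr_gt0 ?divr_gt0// invf_div.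
  rewrite (bigD1 i)//= lerDl; apply: sumr_ge0 => j _; by rewrite divr_ge0// ltW.
(* [C1] bounds [F (z n) i - Y n i], that is [n.+1] times an increment of [Y]; [C2] collects the
   resulting quadratic remainders. *)
pose C1 := B + 2 * csum + 1.
pose C2 := \sum_i th i * C1 ^+ 2 / (c i * c i).
pose e n := \sum_i (1 - th i / Y n i) * err n i + C2 * harmonic n.
have n0 : \forall n \near \oo, (0 < n)%N by exists 1%N.
have csum0 : 0 <= csum by apply: sumr_ge0 => i _; exact: ltW.
have C10 : 0 <= C1 by apply: addr_ge0 => //; apply: addr_ge0 => //; exact: mulr_ge0.
have e0 : e @ \oo --> 0.
  have -> : 0 = \sum_(i < K) 0 + C2 * 0 :> R by rewrite big1// mulr0 addr0.
  apply: cvgD; last by apply: cvgM; [exact: cvg_cst|exact: cvg_harmonic].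
  apply: cvg_finsum => i; apply: (@cvg0_bounded_mul _ _ _ (1 + th i / c i)); first exact: err_cvg.
  near=> n; have n1 : (0 < n)%N by near: n.
  apply: (le_trans (ler_normB _ _)); rewrite normr1 lerD2l (ger0_norm (divr_ge0 (ltW (th0 i)) (ltW (Y0 i n1)))).
  by apply: ler_wpM2l; [exact: ltW|rewrite lef_pV2 ?posrE ?Y0//; exact: Yge].
have Lcvg : L @ \oo --> 0.
  apply: (@cvg0_of_contracting_steps _ _ e g) => //.
    by case=> [//|n]; apply: rel_entropy_ge0 => // i; exact: Y0.
  near=> n; have n1 : (0 < n)%N by near: n.
  have -> : L n = rel_entropy th (Y n) by case: (n) n1.
  rewrite /L -lerBlDl.
  have Yn0 i : 0 < Y n i by exact: Y0.
  have YS0 i : 0 < Y n.+1 i by exact: Y0.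
  have nS : 0 < n.+1%:R :> R by rewrite ltr0n.
  have diss := mean_drift_dissipation th0 thF Yn0.
  have diss2 : - \sum_i c i * ((Y n i - th i) ^+ 2 / (Y n i * th i)) <= - (g * rel_entropy th (Y n)).
    rewrite lerN2; apply: (@le_trans _ _ (g * \sum_i (Y n i - th i) ^+ 2 / Y n i)).
      by rewrite ler_pM2l// rel_entropy_le.
    rewrite mulr_sumr; apply: ler_sum => i _.
    have -> : c i * ((Y n i - th i) ^+ 2 / (Y n i * th i)) = c i / th i * ((Y n i - th i) ^+ 2 / Y n i).
      by field; rewrite !gt_eqF.
    by apply: ler_wpM2r => //; rewrite divr_ge0 ?sqr_ge0// ltW.
  have step := rel_entropy_step th0 Yn0 YS0.
  have : rel_entropy th (Y n.+1) - rel_entropy th (Y n) <=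
     (- (g * rel_entropy th (Y n)) + e n) / n.+1%:R.
    apply: (le_trans step); rewrite big_split/=.
    have -> : \sum_i (Y n.+1 i - Y n i) * (1 - th i / Y n i) =
       (\sum_i (F (Y n) i - Y n i) * (1 - th i / Y n i) +
        \sum_i (1 - th i / Y n i) * err n i) / n.+1%:R.
      rewrite -big_split/= mulr_suml; apply: eq_bigr => i _.
      by rewrite recY// /err; ring.
    have second : \sum_i th i * (Y n.+1 i - Y n i) ^+ 2 / (Y n i * Y n.+1 i) <=
        C2 * harmonic n / n.+1%:R.
      rewrite /C2 -mulrA mulr_suml; apply: ler_sum => i _.
      have h1 : (Y n.+1 i - Y n i) ^+ 2 <= (C1 / n.+1%:R) ^+ 2.
        rewrite -[leLHS]real_normK ?num_real//; apply: lerXn2r; rewrite ?nnegrE//.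
          by rewrite divr_ge0.
        rewrite recY// normrM [`|_^-1|]gtr0_norm ?invr_gt0//; apply: ler_wpM2r; first by rewrite ltW// invr_gt0.
        apply: (le_trans (ler_normB _ _)); rewrite /C1 -addrA addrC lerD//; last first.
          by rewrite ger0_norm ?Yle// ltW.
        have Fz j : 0 <= F (z n) j.
          by apply: (le_trans (ltW (c0 j))); apply: mean_drift_ge => l; rewrite divr_ge0.
        rewrite ger0_norm// ler_wpDr// -(@sum_mean_drift (z n)).
          by rewrite (bigD1 i)//= lerDl sumr_ge0.
        move=> b; rewrite gt_eqF// col_mass_gt0_of_sum// => [j|]; first by rewrite divr_ge0.
        by rewrite -mulr_suml divr_gt0// ltr0n.
      have h2 : (Y n i * Y n.+1 i)^-1 <= (c i * c i)^-1.
        have cY : c i * c i <= Y n i * Y n.+1 i.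
          by apply: ler_pM; [exact: ltW|exact: ltW|exact: Yge|exact: Yge].
        rewrite lef_pV2 ?posrE; [exact: cY|exact: mulr_gt0|exact: mulr_gt0].
      apply: (@le_trans _ _ (th i * (C1 / n.+1%:R) ^+ 2 / (c i * c i))).
        apply: ler_pM => //; last by rewrite ler_pM2l.
          by rewrite mulr_ge0 ?sqr_ge0// ltW.
        by rewrite invr_ge0 ltW// mulr_gt0.
      by rewrite le_eqVlt; apply/orP; left; apply/eqP; rewrite /harmonic/=; field; rewrite (gt_eqF (c0 i)) addrC natr1 pnatr_eq0.
    rewrite /e addrA [leRHS]mulrDl; apply: lerD => //.
    rewrite ler_pM2r ?invr_gt0// lerD2r; exact: le_trans diss diss2.
  by move: (n.+1%:R^-1) (e n) (rel_entropy _ _) (rel_entropy _ _) => q r r1 r2; lra.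
have Ycvg : (fun n => Y n a) @ \oo --> th a.
  have s1 : (fun n => (Num.sqrt (Y n a / th a) - 1) ^+ 2) @ \oo --> 0.
    apply: (@squeeze_cvgr _ _ _ _ (fun=> 0) (fun n => (th a)^-1 * L n)).
    - near=> n; have n1 : (0 < n)%N by near: n.
      rewrite sqr_ge0/= [leRHS]mulrC ler_pdivlMr// [leLHS]mulrC.
      have -> : L n = rel_entropy th (Y n) by case: (n) n1.
      by apply: rel_entropy_sqrt => // i; exact: Y0.
    - exact: cvg_cst.
    - by rewrite -(mulr0 (th a)^-1); apply: cvgM => //; exact: cvg_cst.
  have s2 : (fun n => Num.sqrt (Y n a / th a)) @ \oo --> (1 : R).
    apply/subr_cvg0/norm_cvg0P.
    have -> : (fun n => `|Num.sqrt (Y n a / th a) - 1|) =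
      Num.sqrt \o (fun n => (Num.sqrt (Y n a / th a) - 1) ^+ 2).
      by apply/funext => n; rewrite /= sqrtr_sqr.
    by rewrite -(sqrtr0 R); apply: (cvg_comp _ _ s1); exact: sqrt_continuous.
  have s3 : (fun n => th a * Num.sqrt (Y n a / th a) ^+ 2) @ \oo --> th a * (1 * 1).
    by apply: cvgM; [exact: cvg_cst|exact: cvgM].
  rewrite !mulr1 in s3; apply: cvg_trans s3; apply: near_eq_cvg.
  near=> n; have n1 : (0 < n)%N by near: n.
  by rewrite (sqr_sqrtr (divr_ge0 (ltW (Y0 a n1)) (ltW (th0 a)))) mulrC divfK ?gt_eqF.
have -> : (fun n => D n a / n%:R) = (fun n => Y n a + del n a).
  by apply/funext => n; rewrite -zE.
rewrite -[th a]addr0; apply: cvgD => //; exact: Mcvg.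
Unshelve. all: by end_near. Qed.

End trajectory.
End degree_dynamics.

(** * Strong law for chains with bounded increments *)

Lemma measure_preimage_seq (d : measure_display) (Omega : measurableType d) (R : realType)
    (mu : {measure set Omega -> \bar R}) (T : eqType) (f : Omega -> T) (l : seq T) :
  (forall x, measurable [set w | f w = x]) -> uniq l ->
  measurable [set w | f w \in l] /\
  mu [set w | f w \in l] = (\sum_(x <- l) mu [set w | f w = x])%E.
Proof.
move=> mf; elim: l => [_|x l IH /= /andP[xl ul]].
  have -> : [set w | f w \in [::]] = set0 by apply/seteqP; split.
  by rewrite measure0 big_nil.
have [ml El] := IH ul.
have -> : [set w | f w \in x :: l] = [set w | f w = x] `|` [set w | f w \in l].
  apply/seteqP; split => w /=; rewrite inE.
    by case/orP => [/eqP|]; [left|right].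
  by case=> [->|->]; rewrite ?eqxx ?orbT.
split; first exact: measurableU.
rewrite big_cons -El measureU//; apply/seteqP; split => w //= -[fx].
by rewrite fx (negbTE xl).
Qed.

Lemma ler_sum_seq (R : numDomainType) (I : eqType) (s : seq I) (F G : I -> R) :
  (forall i, i \in s -> F i <= G i) -> \sum_(i <- s) F i <= \sum_(i <- s) G i.
Proof. by move=> FG; rewrite big_seq [leRHS]big_seq; apply: ler_sum. Qed.

Section chain.
Context (R : realType) (T : choiceType) (ap : seq T -> T -> R) (supp : seq T -> seq T).

(* Trajectories are listed with the latest step first. *)
Fixpoint paths (n : nat) : seq (seq T) :=
  if n is n'.+1 then [seq s :: r | r <- paths n', s <- supp r] else [:: [::]].

Fixpoint path_prob (r : seq T) : R :=
  if r is s :: r' then path_prob r' * ap r' s else 1.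

Definition reachable (r : seq T) : bool := r \in paths (size r).

Lemma size_paths n r : r \in paths n -> size r = n.
Proof.
elim: n r => [|n IH] r; first by rewrite inE => /eqP->.
by case/allpairsPdep => r' [s [/IH <- _ ->]].
Qed.

Lemma mem_paths n r : r \in paths n -> reachable r.
Proof. by move=> rn; rewrite /reachable (size_paths rn). Qed.

Lemma reachable_cons s r : reachable (s :: r) = reachable r && (s \in supp r).
Proof.
rewrite /reachable /=; apply/allpairsPdep/andP => [[r' [s' [r's s's [-> ->]]]]|[rs ss]].
  by rewrite (size_paths r's).
by exists r, s.
Qed.

Hypothesis supp_uniq : forall r, uniq (supp r).
Hypothesis ap_ge0 : forall r s, 0 <= ap r s.
Hypothesis ap_sum : forall r, reachable r -> \sum_(s <- supp r) ap r s = 1.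

Lemma paths_uniq n : uniq (paths n).
Proof.
elim: n => //= n IH; apply: allpairs_uniq_dep => // [[r s] [r' s'] _ _ /= [-> ->]] //.
Qed.

Lemma path_prob_ge0 r : 0 <= path_prob r.
Proof. by elim: r => //= s r IH; rewrite mulr_ge0. Qed.

(** As [supp] lists finitely many possible steps, expectations at time [n] are finite sums, and
    conditioning on the past is the nested sum of [pexpS]. *)
Definition pexp (n : nat) (g : seq T -> R) : R := \sum_(r <- paths n) path_prob r * g r.

Lemma pexpS n g : pexp n.+1 g = pexp n (fun r => \sum_(s <- supp r) ap r s * g (s :: r)).
Proof.
rewrite /pexp /= big_allpairs_dep; apply: eq_bigr => r _ /=.
by rewrite mulr_sumr; apply: eq_bigr => s _; rewrite mulrA.
Qed.

Lemma le_pexp n g h : (forall r, r \in paths n -> g r <= h r) -> pexp n g <= pexp n h.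
Proof.
by move=> gh; apply: ler_sum_seq => r rn; rewrite ler_wpM2l ?path_prob_ge0// gh.
Qed.

Lemma eq_pexp n g h : (forall r, r \in paths n -> g r = h r) -> pexp n g = pexp n h.
Proof. by move=> gh; apply: eq_big_seq => r /gh ->. Qed.

Lemma pexp_cst n x : pexp n (fun=> x) = x.
Proof.
elim: n => [|n IH]; first by rewrite /pexp big_seq1 mul1r.
by rewrite pexpS -[RHS]IH; apply: eq_pexp => r /mem_paths/ap_sum E; rewrite -mulr_suml E mul1r.
Qed.

Lemma pexpD n g h : pexp n (fun r => g r + h r) = pexp n g + pexp n h.
Proof. by rewrite -big_split; apply: eq_bigr => r _; rewrite mulrDr. Qed.

Section martingale.
Variable (V : seq T -> R) (C : R).
Hypothesis VC : forall r s, reachable r -> s \in supp r -> `|V (s :: r) - V r| <= C.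

Definition drift (r : seq T) : R := \sum_(s <- supp r) ap r s * (V (s :: r) - V r).

(** Martingale part of [V] in its Doob decomposition along a trajectory. *)
Fixpoint mart (r : seq T) : R :=
  if r is s :: r' then mart r' + (V (s :: r') - V r' - drift r') else 0.

Lemma drift_bound r : reachable r -> `|drift r| <= C.
Proof.
move=> rr; apply: (le_trans (ler_norm_sum _ _ _)).
rewrite -[C]mul1r -(ap_sum rr) mulr_suml; apply: ler_sum_seq => s sr.
by rewrite normrM ger0_norm// ler_wpM2l// VC.
Qed.

Lemma mart_step r s : reachable r -> s \in supp r -> `|mart (s :: r) - mart r| <= 2 * C.
Proof.
move=> rr sr; rewrite /= addrC addKr; apply: (le_trans (ler_normB _ _)).
by rewrite mulrDl mul1r lerD ?VC ?drift_bound.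
Qed.

(** Increments are centred given the past, so cross terms vanish and second moments add up. *)
Lemma mart_second_moment n : pexp n (fun r => mart r ^+ 2) <= n%:R * (2 * C) ^+ 2.
Proof.
elim: n => [|n IH]; first by rewrite /pexp big_seq1 /= expr0n mulr0 mul0r.
rewrite pexpS -natr1 mulrDl mul1r; apply: le_trans (lerD IH (lexx _)).
rewrite -(pexp_cst n ((2 * C) ^+ 2)) -pexpD; apply: le_pexp => r /mem_paths rr.
pose x s := V (s :: r) - V r - drift r.
have -> : \sum_(s <- supp r) ap r s * mart (s :: r) ^+ 2 =
    mart r ^+ 2 + \sum_(s <- supp r) ap r s * x s ^+ 2.
  have x0 : \sum_(s <- supp r) ap r s * x s = 0.
    under eq_bigr do rewrite mulrBr.
    by rewrite sumrB -mulr_suml ap_sum// mul1r subrr.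
  transitivity (\sum_(s <- supp r) (ap r s * mart r ^+ 2 + (2 * mart r * (ap r s * x s) + ap r s * x s ^+ 2))).
    by apply: eq_bigr => s _; rewrite /= -/(x s); ring.
  by rewrite !big_split /= -mulr_suml ap_sum// mul1r -mulr_sumr x0 mulr0 add0r.
rewrite lerD2l.
have <- : (\sum_(s <- supp r) ap r s) * (2 * C) ^+ 2 = (2 * C) ^+ 2 by rewrite ap_sum// mul1r.
rewrite mulr_suml; apply: ler_sum_seq => s sr.
apply: ler_wpM2l => //; have := mart_step rr sr; rewrite /= addrC addKr -/(x s) => xC.
rewrite -[x s ^+ 2]real_normK ?num_real//; apply: lerXn2r; rewrite ?nnegrE//.
by apply: (le_trans _ xC).
Qed.

Context (d : measure_display) (Omega : measurableType d) (P : probability Omega R).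
Variable X : nat -> Omega -> T.

Fixpoint rpast (n : nat) (w : Omega) : seq T :=
  if n is n'.+1 then X n' w :: rpast n' w else [::].

Hypothesis mX : forall n s, measurable [set w | X n w = s].
Hypothesis PX : forall n r s, P [set w | rpast n w = r /\ X n w = s] =
  (P [set w | rpast n w = r] * (ap r s)%:E)%E.

Lemma measurable_rpast n r : measurable [set w | rpast n w = r].
Proof.
elim: n r => [|n IH] r.
  case: r => [|s r].
    by have -> : [set w | rpast 0 w = [::]] = setT by apply/seteqP; split.
  by have -> : [set w | rpast 0 w = s :: r] = set0 by apply/seteqP; split.
case: r => [|s r].
  by have -> : [set w | rpast n.+1 w = [::]] = set0 by apply/seteqP; split.
have -> : [set w | rpast n.+1 w = s :: r] = [set w | X n w = s] `&` [set w | rpast n w = r].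
  by apply/seteqP; split => w /= [-> ->].
exact: measurableI.
Qed.

Lemma rpast_prob n r : size r = n -> P [set w | rpast n w = r] = (path_prob r)%:E.
Proof.
elim: n r => [|n IH] [|s r]//= => [_|[sr]].
  have -> : [set w : Omega | [::] = [::] :> seq T] = setT by apply/seteqP; split.
  exact: probability_setT.
rewrite EFinM -IH// -PX; congr (P _); apply/seteqP; split => w /=.
  by case=> -> ->.
by case=> -> ->.
Qed.

Lemma rpast_mem_prob n (p : pred (seq T)) :
  measurable [set w | rpast n w \in [seq r <- paths n | p r]] /\
  P [set w | rpast n w \in [seq r <- paths n | p r]] =
  (\sum_(r <- paths n | p r) path_prob r)%:E.
Proof.
have [m1 E1] := measure_preimage_seq P (measurable_rpast n) (filter_uniq p (paths_uniq n)).
split => //; rewrite E1 big_filter -sumEFin.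
rewrite big_seq_cond [RHS]big_seq_cond; apply: eq_bigr => r /andP[rn _].
by apply: rpast_prob; exact: size_paths rn.
Qed.

Lemma ae_rpast_paths : {ae P, forall w, forall n, rpast n w \in paths n}.
Proof.
apply: ae_foralln => n.
have [m1 E1] := rpast_mem_prob n predT.
rewrite filter_predT in m1 E1.
exists (~` [set w | rpast n w \in paths n]); split; [exact: measurableC| |by []].
transitivity (1 - P [set w | rpast n w \in paths n])%E; [exact: probability_setC|rewrite E1].
have -> : \sum_(r <- paths n) path_prob r = pexp n (fun=> 1).
  by apply: eq_bigr => r _; rewrite mulr1.
by rewrite pexp_cst subee.
Qed.

Lemma mart_tail n (e : R) : 0 < e ->
  measurable [set w | rpast n w \in [seq r <- paths n | e <= `|mart r|]] /\
  (P [set w | rpast n w \in [seq r <- paths n | (e <= `|mart r|)%R]] <=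
  (n%:R * (2 * C) ^+ 2 / e ^+ 2)%:E)%E.
Proof.
move=> e0; have [m1 E1] := rpast_mem_prob n (fun r => e <= `|mart r|).
split => //; rewrite E1 lee_fin ler_pdivlMr ?exprn_gt0//.
apply: le_trans (mart_second_moment n).
rewrite /pexp mulr_suml (bigID (fun r => e <= `|mart r|) predT) /=.
rewrite -[leLHS]addr0; apply: lerD; last first.
  by apply: sumr_ge0 => r _; rewrite mulr_ge0 ?path_prob_ge0 ?sqr_ge0.
apply: ler_sum => r er; rewrite ler_wpM2l ?path_prob_ge0//.
rewrite -[leRHS]real_normK ?num_real//; apply: lerXn2r; rewrite ?nnegrE//.
exact: ltW.
Qed.

Lemma inv_square_sum_le n : \sum_(0 <= j < n) (j.+1%:R ^+ 2)^-1 <= 2 :> R.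
Proof.
have [->|n0] := posnP n; first by rewrite big_geq.
(* Strengthened for the induction, which rests on 1 / (n + 1)^2 <= 1 / n - 1 / (n + 1). *)
suff : \sum_(0 <= j < n) (j.+1%:R ^+ 2)^-1 <= 2 - n%:R^-1 :> R.
  by move=> /le_trans; apply; rewrite gerBl.
elim: n n0 => // -[_ _|n IH _]; first by rewrite big_nat1 expr1n !invr1; lra.
rewrite big_nat_recr//=; apply: le_trans (lerD (IH isT) (lexx _)) _.
have n1 : 0 < n.+1%:R :> R by rewrite ltr0n.
rewrite -[n.+2%:R]natr1; move: n1; set x := n.+1%:R => x0.
rewrite -addrA lerD2l -subr_ge0.
have -> : - (x + 1)^-1 - (- x^-1 + ((x + 1) ^+ 2)^-1) = (x * (x + 1) ^+ 2)^-1.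
  by field; rewrite !gt_eqF// addr_gt0.
by rewrite invr_ge0 mulr_ge0 ?sqr_ge0// ltW.
Qed.

(** Chebyshev's bound at time n is of order 1 / n, which is not summable; along the squares it is,
    and Borel-Cantelli applies. *)
Lemma mart_square_subsequence (e : R) : 0 < e ->
  {ae P, forall w, exists J, forall j, (J <= j)%N ->
    rpast (j.+1 ^ 2) w \in paths (j.+1 ^ 2) ->
    `|mart (rpast (j.+1 ^ 2) w)| < e * j.+1%:R ^+ 2}.
Proof.
move=> e0.
pose F j := [set w | rpast (j.+1 ^ 2) w \in
  [seq r <- paths (j.+1 ^ 2) | e * j.+1%:R ^+ 2 <= `|mart r|]].
have ej0 j : 0 < e * j.+1%:R ^+ 2 by rewrite mulr_gt0 ?exprn_gt0.
have mF j : measurable (F j) by have [] := mart_tail (j.+1 ^ 2) (ej0 j).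
pose Kc := (2 * C) ^+ 2 / e ^+ 2.
have PF j : (P (F j) <= (Kc * (j.+1%:R ^+ 2)^-1)%:E)%E.
  have [_ /le_trans] := mart_tail (j.+1 ^ 2) (ej0 j); apply.
  rewrite lee_fin natrX le_eqVlt; apply/orP; left; apply/eqP; rewrite /Kc.
  have : j.+1%:R != 0 :> R by rewrite pnatr_eq0.
  by move: (j.+1%:R : R) => x x0; field; rewrite x0 gt_eqF.
have K0 : 0 <= Kc by rewrite divr_ge0 ?sqr_ge0.
have sumF : (\sum_(j <oo) P (F j) < +oo)%E.
  apply: (@le_lt_trans _ _ (Kc * 2)%:E); last by rewrite ltry.
  apply: lime_le; first by apply: is_cvg_nneseries => j _ _; exact: measure_ge0.
  apply: nearW => n; apply: (@le_trans _ _ (\sum_(0 <= j < n) (Kc * (j.+1%:R ^+ 2)^-1)%:E)%E).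
    by apply: lee_sum => j _; exact: PF.
  by rewrite sumEFin lee_fin -mulr_sumr ler_wpM2l// inv_square_sum_le.
exists (lim_sup_set F); split.
- by apply: bigcap_measurable => // k _; exact: bigcup_measurable.
- exact: lim_sup_set_cvg0.
move=> w /= nH n _; apply: contrapT => nF; apply: nH; exists n => j nj rj.
rewrite ltNge; apply/negP => le; apply: nF; exists j => //.
by rewrite /F /mkset mem_filter le.
Qed.

(** Between consecutive squares there are O(j) bounded steps, negligible against j^2, so the control
    along squares extends to all times. *)
Lemma mart_slln : {ae P, forall w, (fun n => mart (rpast n w) / n%:R) @ \oo --> 0}.
Proof.
(* Tolerances are taken from a sequence tending to 0, so that only countably many null sets are
   discarded. *)
have H k := mart_square_subsequence (harmonic_gt0 k : 0 < (harmonic k : R)).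
have := ae_foralln H; have := ae_rpast_paths; apply: filterS2 => w reach {}H.
have C0 : 0 <= C.
  have := ap_sum (mem_paths (reach 0%N)); case: (supp (rpast 0 w)) (@VC (rpast 0 w)) => [|s l] VC0.
    by rewrite big_nil => /esym/eqP; rewrite oner_eq0.
  by move=> _; apply: le_trans (VC0 s _ _) => //; rewrite inE eqxx.
have stepn n k : `|mart (rpast (n + k) w) - mart (rpast n w)| <= k%:R * (2 * C).
  elim: k => [|k IH]; first by rewrite addn0 subrr normr0 mul0r.
  have := reach (n + k).+1; rewrite addnS => rk.
  have : reachable (rpast (n + k).+1 w) by exact: mem_paths rk.
  rewrite [rpast _ _]/= reachable_cons => /andP[r1 r2].
  rewrite -natr1 mulrDl mul1r -(subrKA (mart (rpast (n + k) w))) addrC.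
  by apply: (le_trans (ler_normD _ _)); rewrite lerD// mart_step.
apply/cvgr0Pnorm_le => e e0.
have [k ke] : exists k, harmonic k < e / 2 :> R.
  have e2 : 0 < e / 2 by rewrite divr_gt0.
  have [N _ HN] := @cvgr0_norm_lt _ _ _ _ _ _ (@cvg_harmonic R) _ e2.
  by exists N; have := HN N (leqnn N); rewrite ger0_norm// harmonic_ge0.
have [J HJ] := H k.
(* Beyond [N], a gap of at most [2 * j.+1] steps, each of size at most [2 * C], costs at most half
   of [e * j.+1 ^ 2]. *)
have [N HN] : exists N : nat, 4 * C / (e / 2) < N%:R.
  by exists (Num.truncn (4 * C / (e / 2))).+1; exact: truncnS_gt.
pose J1 := maxn J N.
exists (J1.+1 ^ 2)%N => // n /= nJ.
have [j [j1 j2 j3]] : exists j, [/\ (J1 <= j)%N, (j.+1 ^ 2 <= n)%N & (n <= j.+1 ^ 2 + 2 * j.+1)%N].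
  have ex : exists j, (j.+1 ^ 2 <= n)%N by exists J1.
  have bd j : (j.+1 ^ 2 <= n -> j <= n)%N.
    by apply: leq_trans; rewrite -mulnn mulnS (leq_trans (leqnSn j))// leq_addr.
  case: (ex_maxnP ex bd) => j jn jmax; exists j; split => //; first exact: jmax.
  have : ~~ (j.+2 ^ 2 <= n)%N by apply/negP => /jmax; rewrite ltnn.
  by rewrite -ltnNge; rewrite -!mulnn; lia.
have n0 : 0 < n%:R :> R by rewrite ltr0n (leq_trans _ j2).
have nV : 0 <= n%:R^-1 :> R by [].
rewrite normrM (ger0_norm nV) ler_pdivrMr//.
have Hj := HJ j (leq_trans (leq_maxl _ _) j1) (reach _).
have Hs := stepn (j.+1 ^ 2)%N (n - j.+1 ^ 2)%N; rewrite subnKC// in Hs.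
have -> : mart (rpast n w) = (mart (rpast n w) - mart (rpast (j.+1 ^ 2) w)) + mart (rpast (j.+1 ^ 2) w).
  by rewrite subrK.
apply: (le_trans (ler_normD _ _)).
have jn : j.+1%:R ^+ 2 <= n%:R :> R by rewrite -natrX ler_nat.
have h1 : harmonic k * j.+1%:R ^+ 2 <= e / 2 * n%:R by apply: ler_pM; rewrite ?sqr_ge0 ?harmonic_ge0// ltW.
have h2 : (n - j.+1 ^ 2)%:R * (2 * C) <= e / 2 * n%:R.
  apply: (@le_trans _ _ ((2 * j.+1)%:R * (2 * C))).
    by apply: ler_wpM2r; [rewrite mulr_ge0|rewrite ler_nat leq_subLR].
  apply: (@le_trans _ _ (e / 2 * j.+1%:R ^+ 2)); last by rewrite ler_pM2l// divr_gt0.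
  have Nj : N%:R <= j.+1%:R :> R by rewrite ler_nat (leq_trans (leq_trans (leq_maxr J N) j1))//.
  move: (lt_le_trans HN Nj); rewrite ltr_pdivrMr ?divr_gt0// natrM expr2 => h.
  have j0 : 0 <= j.+1%:R :> R by [].
  by move: h j0; set x := j.+1%:R => h j0; rewrite mulrA; nra.
have := lerD (le_trans Hs h2) (le_trans (ltW Hj) h1).
by move=> /le_trans; apply; rewrite -mulrDl -splitr.
Qed.

End martingale.
End chain.

(** * Sums over lists of independently drawn endpoints *)

Fixpoint words (N k : nat) : seq (seq nat) :=
  if k is k'.+1 then [seq w :: t | w <- iota 0 N, t <- words N k'] else [:: [::]].

Lemma mem_words N k t : t \in words N k -> size t = k /\ all (fun w => (w < N)%N) t.
Proof.
elim: k t => [|k IH] t /=; first by rewrite inE => /eqP->.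
case/allpairsPdep => w [t' [wN /IH[<- aN] ->]]; split => //=.
by rewrite aN andbT; rewrite mem_iota in wN.
Qed.

Lemma words_uniq N k : uniq (words N k).
Proof.
elim: k => //= k IH; apply: allpairs_uniq_dep; first exact: iota_uniq.
  by [].
by move=> [w t] [w' t'] _ _ /= [-> ->].
Qed.

Section word_sums.
Context (R : realType) (N : nat) (q : nat -> R).

(** For weights of sum 1, the expectation over [k] independent draws; [t] will be the list of
    endpoints of one newcomer. *)
Definition wsum (k : nat) (g : seq nat -> R) : R :=
  \sum_(t <- words N k) (\prod_(w <- t) q w) * g t.

Lemma wsum0 g : wsum 0 g = g [::].
Proof. by rewrite /wsum big_seq1 big_nil mul1r. Qed.

Lemma wsumS k g :
  wsum k.+1 g = \sum_(w <- iota 0 N) q w * wsum k (fun t => g (w :: t)).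
Proof.
rewrite /wsum /= big_allpairs_dep; apply: eq_bigr => w _ /=.
by rewrite mulr_sumr; apply: eq_bigr => t _; rewrite big_cons mulrA.
Qed.

Lemma eq_wsum k g h : g =1 h -> wsum k g = wsum k h.
Proof. by move=> gh; apply: eq_bigr => t _; rewrite gh. Qed.

Lemma wsum_zero k : wsum k (fun=> 0) = 0.
Proof. by rewrite /wsum big1// => t _; rewrite mulr0. Qed.

Lemma wsum_avoid k (S : pred nat) :
  wsum k (fun t => (count S t == 0%N)%:R) = (\sum_(w <- iota 0 N | ~~ S w) q w) ^+ k.
Proof.
elim: k => [|k IH]; first by rewrite wsum0 expr0.
rewrite wsumS exprS mulr_suml [RHS]big_mkcond; apply: eq_bigr => w _.
case: ifP => Sw.
  by rewrite -IH; congr (_ * _); apply: eq_wsum => t /=; rewrite (negbTE Sw).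
rewrite (@eq_wsum _ _ (fun=> 0)) ?wsum_zero ?mulr0// => t /=.
by rewrite (negbFE Sw).
Qed.

Lemma wsum_total k : wsum k (fun=> 1) = (\sum_(w <- iota 0 N) q w) ^+ k.
Proof.
rewrite (eq_bigl (fun w => ~~ pred0 w))// -wsum_avoid; apply: eq_wsum => t.
by rewrite count_pred0.
Qed.

(** One of the [k] draws hits [x] and the others avoid [S]; at [k = 0] the factor [k%:R] hides the
    truncated exponent. *)
Lemma wsum_hit_once k (S : pred nat) x : S x -> (x < N)%N ->
  wsum k (fun t => ((count S t == 1%N) && (x \in t))%:R) =
  k%:R * q x * (\sum_(w <- iota 0 N | ~~ S w) q w) ^+ k.-1.
Proof.
move=> Sx xN; set p0 := \sum_(w <- _ | _) _.
elim: k => [|k IH]; first by rewrite wsum0 !mul0r.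
rewrite wsumS.
have E w : wsum k (fun t => ((count S (w :: t) == 1%N) && (x \in w :: t))%:R) =
    (if ~~ S w then k%:R * q x * p0 ^+ k.-1 else if w == x then p0 ^+ k else 0).
  case: ifP => Sw.
    rewrite -IH; apply: eq_wsum => t /=; rewrite (negbTE Sw) add0n inE.
    by case: (x =P w) => // xw; rewrite -xw Sx in Sw.
  move/negbFE: Sw => Sw; case: ifP => [/eqP->|wx].
    by rewrite -wsum_avoid; apply: eq_wsum => t; rewrite /= Sx inE eqxx andbT.
  rewrite (@eq_wsum _ _ (fun=> 0)) ?wsum_zero// => t /=.
  rewrite Sw add1n eqSS inE (eq_sym x w) wx /=; case: eqP => //= /eqP.
  rewrite -leqn0 leqNgt -has_count => /hasPn H; case: (boolP (x \in t)) => // /H.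
  by rewrite Sx.
under eq_bigr do rewrite E.
rewrite (bigID (fun w => ~~ S w)) /=.
rewrite (eq_bigr (fun w => q w * (k%:R * q x * p0 ^+ k.-1))) => [|w ->//].
rewrite -mulr_suml -/p0.
have -> : \sum_(i <- iota 0 N | ~~ ~~ S i)
    q i * (if ~~ S i then k%:R * q x * p0 ^+ k.-1 else if i == x then p0 ^+ k else 0) =
    q x * p0 ^+ k.
  rewrite big_mkcond (bigD1_seq x) ?iota_uniq ?mem_iota//=.
  rewrite Sx eqxx /= big1 ?addr0// => w /negPf wx.
  by case: ifP => // /negbNE Sw; rewrite Sw wx /= mulr0.
case: k {IH E} => [|k] /=; first by rewrite !mul0r mulr0 add0r mul1r.
by rewrite exprS -[k.+2%:R]natr1; ring.
Qed.

Lemma wsum_count k (S : pred nat) : \sum_(w <- iota 0 N) q w = 1 ->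
  wsum k (fun t => (count S t)%:R) = k%:R * \sum_(w <- iota 0 N | S w) q w.
Proof.
move=> q1; elim: k => [|k IH]; first by rewrite wsum0 mul0r.
rewrite wsumS.
have E w : wsum k (fun t => (count S (w :: t))%:R) =
    (S w)%:R + k%:R * \sum_(w <- iota 0 N | S w) q w.
  transitivity ((S w)%:R * wsum k (fun=> 1) + wsum k (fun t => (count S t)%:R)).
    rewrite /wsum mulr_sumr -big_split.
    by apply: eq_bigr => t _; rewrite /= natrD; ring.
  by rewrite wsum_total q1 expr1n mulr1 IH.
under eq_bigr do rewrite E mulrDr.
rewrite big_split /= -mulr_suml q1 mul1r -natr1 mulrDl mul1r addrC; congr (_ + _).
rewrite [RHS]big_mkcond; apply: eq_bigr => w _.
by case: ifP; rewrite ?mulr1 ?mulr0.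
Qed.

End word_sums.

(** * Histories and discrete graphs *)

(* The births of a family tree are listed with the latest one first: [(p, b)] is
   the birth of a type-[b] child of the [p]-th individual, the root being the
   [0]-th one and the individual born at [e :: l] the [(size l).+1]-st one. *)
Section histories.
Context (K : nat) (m : 'I_K -> nat).
Implicit Types (a b : 'I_K) (l : seq (nat * 'I_K)) (i j p : nat).

Fixpoint htype a l i : 'I_K :=
  if l is e :: l' then if i == (size l').+1 then e.2 else htype a l' i else a.

Fixpoint hparent l i : nat :=
  if l is e :: l' then if i == (size l').+1 then e.1 else hparent l' i else 0.

Definition nkids l i : nat := count (fun e => e.1 == i) l.

(** Both the total degree of the vertex in the graph and the factor [N + m] of the birth rates: this
    coincidence links the two models. *)
Definition hdegree a l i : nat := (nkids l i + m (htype a l i))%N.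

Fixpoint hvalid l : bool :=
  if l is e :: l' then (e.1 <= size l')%N && hvalid l' else true.

Lemma nkids_out l i : hvalid l -> (size l <= i)%N -> nkids l i = 0%N.
Proof.
elim: l => //= e l IH /andP[el vl] li; rewrite /nkids /= -/(nkids l i) IH// 1?ltnW//.
by rewrite addn0; case: eqP => // ei; rewrite ei leqNgt li in el.
Qed.

Lemma hparent_lt l i : hvalid l -> (0 < i)%N -> (hparent l i < i)%N.
Proof.
elim: l => //= e l IH /andP[el vl] i0; case: eqP => [->|_]; last exact: IH.
by rewrite ltnS.
Qed.

Definition hgraph a l : fmgraph K :=
  @FGraph K (size l).+1 (fun i : 'I_(size l).+1 => htype a l i)
    (fun i j : 'I_(size l).+1 => nat_of_bool ((0 < i)%N && (hparent l i == j))).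

End histories.

Section discrete.
Context (R : realType) (K : nat) (hK : (0 < K)%N).
Variables (pi : 'I_K -> R) (kappa : 'I_K -> 'I_K -> R) (m : 'I_K -> nat).
Variable (G0 : fmgraph K).

Local Notation n0 := (size_fg G0).
Local Notation arr := (arrival K).
Implicit Types (r : seq arr) (s : arr) (u v w : nat).

Definition rgrow r : fmgraph K := foldr (fun s G => attach G s) G0 r.

Lemma grow_rev r : grow G0 (rev r) = rgrow r.
Proof. by rewrite /grow foldl_rev. Qed.

Definition vcount r : nat := (n0 + size r)%N.

Lemma vcountS s r : vcount (s :: r) = (vcount r).+1.
Proof. by rewrite /vcount /= addnS. Qed.

Lemma size_rgrow r : size_fg (rgrow r) = vcount r.
Proof. by elim: r => [|s r IH]; rewrite ?vcountS /= ?IH// /vcount addn0. Qed.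

Let a0 : 'I_K := Ordinal hK.

(** Types, multiplicities and degrees are recomputed on plain numbers, since ordinals bounded by the
    size of a growing graph would need casts at every step. *)
Fixpoint vtype r v : 'I_K :=
  if r is s :: r' then if v == vcount r' then s.1 else vtype r' v
  else if insub v is Some i then @fmark K G0 i else a0.

Fixpoint vmult r u v : nat :=
  if r is s :: r' then
    if v == vcount r' then 0 else if u == vcount r' then count_mem v s.2 else vmult r' u v
  else match insub u, insub v with
       | Some i, Some j => @fmult K G0 i j | _, _ => 0 end.

Lemma rgrow_mark r (v : 'I_(size_fg (rgrow r))) : fmark v = vtype r v.
Proof.
elim: r v => [|s r IH] v /=; first by rewrite valK.
case: (unliftP ord_max v) => [v' ->|->].
  by rewrite lift_max /= IH -size_rgrow ltn_eqF.
by rewrite /= size_rgrow eqxx.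
Qed.

Lemma rgrow_mult r (u v : 'I_(size_fg (rgrow r))) : fmult u v = vmult r u v.
Proof.
elim: r u v => [|s r IH] u v /=; first by rewrite !valK.
have max_eq : (@ord_max (size_fg (rgrow r)) == vcount r :> nat) = true.
  by apply/eqP; exact: size_rgrow.
have lift_eq (x : 'I_(size_fg (rgrow r))) : (lift ord_max x == vcount r :> nat) = false.
  by rewrite lift_max -size_rgrow ltn_eqF.
case: (unliftP ord_max v) => [v' ->|->]; last by rewrite max_eq; case: unlift.
rewrite lift_eq; case: (unliftP ord_max u) => [u' ->|->].
  by rewrite lift_eq !lift_max IH.
by rewrite max_eq lift_max.
Qed.

Definition vdeg0 v : nat :=
  if insub v is Some i then @degree K G0 G0 i else 0.

Fixpoint vdeg r v : nat :=
  if r is s :: r' then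
    if v == vcount r' then size s.2 else (vdeg r' v + count_mem v s.2)%N
  else vdeg0 v.

Definition targets_old r s := all (fun w => w < vcount r)%N s.2.

Fixpoint wf r : bool :=
  if r is s :: r' then [&& wf r', targets_old r' s & size s.2 == m s.1] else true.

Lemma big_rgrow (T : Type) (idx : T) (op : Monoid.com_law idx) r (F : nat -> T) :
  \big[op/idx]_(v < size_fg (rgrow r)) F v = \big[op/idx]_(0 <= v < vcount r) F v.
Proof. by rewrite size_rgrow big_mkord. Qed.

Lemma sum_count_mem N (t : seq nat) : all (fun w => w < N)%N t ->
  \sum_(0 <= v < N) count_mem v t = size t.
Proof.
move=> tN; transitivity (\sum_(0 <= v < N) \sum_(w <- t) (w == v))%N.
  by apply: eq_bigr => v _; rewrite -sum1_count big_mkcond.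
rewrite exchange_big /= -sum1_size big_seq [RHS]big_seq; apply: eq_bigr => w wt.
have wN : (w < N)%N by exact: (allP tN).
rewrite (bigD1_seq w) ?iota_uniq ?mem_index_iota//= eqxx big1// => v /negPf.
by rewrite eq_sym => ->.
Qed.

Lemma vdegE r v : wf r -> (v < vcount r)%N ->
  (\sum_(0 <= u < vcount r) vmult r u v + \sum_(0 <= u < vcount r) vmult r v u +
    ((n0 == 1) && (v == 0)))%N = vdeg r v.
Proof.
move=> wr; elim: r wr v => [_|s r IH /= /and3P[wr tr _]] v vN /=.
  rewrite /vcount addn0 in vN *.
  rewrite /vdeg0 insubT /degree !big_mkord; congr (_ + _ + _)%N;
    by apply: eq_bigr => u _; rewrite !valK ?insubT//=; congr fmult; apply: val_inj.
rewrite vcountS in vN *; rewrite !big_nat_recr//= eqxx addn0.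
case: (v =P vcount r) vN => [-> _|/eqP vr vN].
  rewrite big1 ?add0n; last by [].
  have -> : (\sum_(0 <= i < vcount r) (if i == vcount r then 0 else count_mem i s.2) = size s.2)%N.
    rewrite -(sum_count_mem tr); rewrite big_nat [RHS]big_nat; apply: eq_bigr => i /andP[_ ir].
    by rewrite ltn_eqF.
  (* The extra unit of a one-vertex seed belongs to vertex 0, whereas the newcomer has a positive
     number. *)
  by case: (n0 =P 1%N) => [n01|_]; rewrite ?addn0// /vcount n01 /= addn0.
have {}vN : (v < vcount r)%N by rewrite ltn_neqAle vr -ltnS.
rewrite -(IH wr v vN).
have E1 : (\sum_(0 <= i < vcount r) (if i == vcount r then count_mem v s.2 else vmult r i v) =
   \sum_(0 <= i < vcount r) vmult r i v)%N.
  rewrite big_nat [RHS]big_nat; apply: eq_bigr => i /andP[_ ir]; by rewrite ltn_eqF.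
have E2 : (\sum_(0 <= i < vcount r) (if i == vcount r then 0 else vmult r v i) =
   \sum_(0 <= i < vcount r) vmult r v i)%N.
  rewrite big_nat [RHS]big_nat; apply: eq_bigr => i /andP[_ ir]; by rewrite ltn_eqF.
by rewrite E1 E2; lia.
Qed.

Lemma rgrow_degree r (v : 'I_(size_fg (rgrow r))) : wf r ->
  degree G0 v = vdeg r v.
Proof.
move=> wr; have vN : (v < vcount r)%N by rewrite -size_rgrow.
rewrite -vdegE// /degree -!big_rgrow; congr (_ + _ + _)%N;
  by apply: eq_bigr => u _; rewrite rgrow_mult.
Qed.

Definition total_weight r b : R :=
  \sum_(v <- iota 0 (vcount r)) kappa (vtype r v) b * (vdeg r v)%:R.

Definition attach_prob r b w : R :=
  kappa (vtype r w) b * (vdeg r w)%:R / total_weight r b.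

Lemma choice_probE r b w : wf r -> (w < vcount r)%N ->
  choice_prob kappa G0 (rgrow r) b w = attach_prob r b w.
Proof.
move=> wr wN; rewrite /choice_prob /attach_prob.
have wN' : (w < size_fg (rgrow r))%N by rewrite size_rgrow.
rewrite insubT /weight rgrow_mark rgrow_degree//=; congr (_ / _).
have iotaE : iota 0 (vcount r) = index_iota 0 (vcount r) by rewrite /index_iota subn0.
rewrite /total_weight iotaE -(big_rgrow _ r (fun v => kappa (vtype r v) b * (vdeg r v)%:R)).
by apply: eq_bigr => v _; rewrite rgrow_mark rgrow_degree.
Qed.

End discrete.

Lemma iota_index N : iota 0 N = index_iota 0 N.
Proof. by rewrite /index_iota subn0. Qed.

(** * One-step law of the attachment graph *)

Section arrivals.
Context (R : realType) (K : nat) (hK : (0 < K)%N).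
Variables (pi : 'I_K -> R) (kappa : 'I_K -> 'I_K -> R) (m : 'I_K -> nat).
Hypothesis (pi_gt0 : forall a, 0 < pi a) (pi_sum : \sum_a pi a = 1).
Hypothesis (kappa_gt0 : forall a b, 0 < kappa a b) (m_ge1 : forall a, (1 <= m a)%N).
Variable (G0 : fmgraph K).
Hypothesis hG0 : seed_graph G0.

Local Notation n0 := (size_fg G0).
Local Notation arr := (arrival K).
Implicit Types (r : seq arr) (s : arr) (u v w : nat).

Local Notation vcount := (vcount G0).
Local Notation vtype := (vtype hK G0).
Local Notation vdeg := (vdeg G0).
Local Notation wf := (wf m G0).
Local Notation total_weight := (total_weight hK kappa G0).
Local Notation attach_prob := (attach_prob hK kappa G0).

Definition arrivals (r : seq arr) : seq arr :=
  [seq (b, t) | b <- enum 'I_K, t <- words (vcount r) (m b)].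

Definition step_prob r s : R := arrival_prob pi kappa m G0 (rgrow G0 r) s.

Lemma arrivals_uniq r : uniq (arrivals r).
Proof.
apply: allpairs_uniq_dep; first exact: enum_uniq.
  by move=> b _; exact: words_uniq.
by move=> [b t] [b' t'] _ _ /= [-> ->].
Qed.

Lemma mem_arrivals r s : s \in arrivals r -> size s.2 = m s.1 /\ targets_old G0 r s.
Proof. by case/allpairsPdep => b [t [_ /mem_words[sz al] ->]]; split. Qed.

Lemma reachable_wf r : reachable arrivals r -> wf r.
Proof.
elim: r => //= s r IH; rewrite reachable_cons => /andP[/IH -> /mem_arrivals[-> ->]].
by rewrite eqxx.
Qed.

(** The latest newcomer has at least one outgoing edge; in the seed, either the single vertex has
    the extra unit or connectedness provides an edge. Hence the attachment probabilities have a
    positive denominator. *)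
Lemma vdeg_pos r : wf r -> exists2 v, (v < vcount r)%N & (0 < vdeg r v)%N.
Proof.
case: r => [_|s r /= /and3P[_ _ /eqP sz]]; last first.
  by exists (vcount r); rewrite ?vcountS// eqxx sz.
case: hG0 => n0gt0 _ conn.
exists 0%N; rewrite /vcount ?addn0//=.
have -> : vdeg0 G0 0 = degree G0 (Ordinal n0gt0).
  by rewrite /vdeg0 -[X in insub X]/(val (Ordinal n0gt0)) valK.
rewrite /degree.
have [n01|n01] := leqP n0 1%N.
  have -> : n0 == 1%N by rewrite eqn_leq n01.
  by rewrite /= addn1.
have /connectP[[|y p] /= pth lst] := conn (Ordinal n0gt0) (Ordinal n01).
  by have := congr1 val lst.
case/andP: pth => + _.
rewrite (bigD1 y)//= [X in (0 < _ + X + _)%N](bigD1 y)//=.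
by lia.
Qed.

Lemma total_weight_gt0 r b : wf r -> 0 < total_weight r b.
Proof.
move=> /vdeg_pos[v vN v0]; rewrite /total_weight (bigD1_seq v) ?iota_uniq ?mem_iota//=.
rewrite ltr_wpDr ?mulr_gt0 ?ltr0n//.
by apply: sumr_ge0 => w _; rewrite mulr_ge0// ltW.
Qed.

Lemma attach_prob_sum r b : wf r -> \sum_(w <- iota 0 (vcount r)) attach_prob r b w = 1.
Proof.
by move=> wr; rewrite -mulr_suml divff// gt_eqF// total_weight_gt0.
Qed.

Lemma step_prob_ge0 r s : 0 <= step_prob r s.
Proof.
rewrite /step_prob /arrival_prob; case: ifP => // _.
apply: mulr_ge0; first exact: ltW.
apply: prodr_ge0 => w _.
have weight_ge0 G (b : 'I_K) (v : 'I_(size_fg G)) : 0 <= @weight R K kappa G0 G b v by rewrite mulr_ge0// ltW.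
by rewrite /choice_prob; case: insub => // v; rewrite divr_ge0// sumr_ge0.
Qed.

Lemma step_expectE r (g : arr -> R) : wf r ->
  \sum_(s <- arrivals r) step_prob r s * g s =
  \sum_b pi b * wsum (vcount r) (attach_prob r b) (m b) (fun t => g (b, t)).
Proof.
move=> wr; rewrite /arrivals big_allpairs_dep /= big_enum /=; apply: eq_bigr => b _.
rewrite /wsum mulr_sumr big_seq [RHS]big_seq; apply: eq_bigr => t /mem_words[sz al].
rewrite /step_prob /arrival_prob /= sz eqxx mulrA; congr (_ * _ * _).
rewrite big_seq [RHS]big_seq; apply: eq_bigr => w wt.
by apply: (choice_probE _ _ _ wr); exact: (allP al w wt).
Qed.

Lemma step_prob_sum r : reachable arrivals r -> \sum_(s <- arrivals r) step_prob r s = 1.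
Proof.
move=> /reachable_wf wr; under eq_bigr do rewrite -[step_prob _ _]mulr1.
rewrite step_expectE// -[RHS]pi_sum; apply: eq_bigr => b _.
by rewrite wsum_total attach_prob_sum// expr1n mulr1.
Qed.

Definition type_degree r a : R :=
  \sum_(v <- iota 0 (vcount r) | vtype r v == a) (vdeg r v)%:R.

Lemma type_degree_ge0 r a : 0 <= type_degree r a.
Proof. by rewrite sumr_ge0. Qed.

(** The normalization depends on the graph only through the degree totals per type, which therefore
    form a closed system. *)
Lemma total_weight_type r b : total_weight r b = col_mass kappa (type_degree r) b.
Proof.
rewrite /total_weight (partition_big (vtype r) predT)//=; apply: eq_bigr => a _.
by rewrite /type_degree mulr_sumr; apply: eq_bigr => v /eqP ->.
Qed.

Lemma sum_type_degree_gt0 r : wf r -> 0 < \sum_a type_degree r a.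
Proof.
move=> /vdeg_pos[v vN v0].
have -> : \sum_a type_degree r a = \sum_(v <- iota 0 (vcount r)) (vdeg r v)%:R.
  by rewrite [RHS](partition_big (vtype r) predT).
rewrite (bigD1_seq v) ?iota_uniq ?mem_iota//= ltr_wpDr ?ltr0n// sumr_ge0//.
Qed.

Lemma sum_count_cond N (S : pred nat) (t : seq nat) : all (fun w => w < N)%N t ->
  (\sum_(v <- iota 0 N | S v) count_mem v t)%N = count S t.
Proof.
elim: t => [|w t IH] /=; first by rewrite big1.
case/andP=> wN /IH <-; rewrite big_split /=; congr addn.
rewrite big_mkcond (bigD1_seq w) ?iota_uniq ?mem_iota//= eqxx big1 ?addn0; first by case: (S w).
by move=> v /negPf vw; rewrite eq_sym vw; case: ifP.
Qed.

Lemma type_degreeS r s a : targets_old G0 r s ->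
  type_degree (s :: r) a = type_degree r a +
    (count (fun w => vtype r w == a) s.2)%:R + (if s.1 == a then (size s.2)%:R else 0).
Proof.
move=> ts; rewrite /type_degree vcountS -[in iota _ (vcount r).+1]addn1 iotaD big_cat/= add0n.
rewrite big_cons big_nil eqxx; congr (_ + _); last by case: ifP; rewrite ?addr0.
rewrite -(sum_count_cond (fun w => vtype r w == a) ts) natr_sum -big_split /=.
rewrite big_seq_cond [RHS]big_seq_cond.
have E v : (v \in iota 0 (vcount r)) -> (v == vcount r) = false.
  by rewrite mem_iota /= add0n => vr; rewrite ltn_eqF.
rewrite (eq_bigl (fun v => (v \in iota 0 (vcount r)) && (vtype r v == a))); last first.
  by move=> v; case: (boolP (v \in _)) => //= /E ->.
by apply: eq_bigr => v /andP[/E -> _]; rewrite natrD.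
Qed.

(** Degrees are frozen while the edges of a newcomer are drawn, and counting is linear, so the drift
    is exact, with no error term. *)
Lemma type_degree_drift r a : reachable arrivals r ->
  drift step_prob arrivals (type_degree ^~ a) r = mean_drift pi kappa m (type_degree r) a.
Proof.
move=> rr; have wr := reachable_wf rr; rewrite /drift.
pose g s : R := (count (fun w => vtype r w == a) s.2)%:R + (if s.1 == a then (m s.1)%:R else 0).
transitivity (\sum_(s <- arrivals r) step_prob r s * g s).
  rewrite big_seq [RHS]big_seq; apply: eq_bigr => s /mem_arrivals[sz ts].
  by rewrite type_degreeS// sz /g -[in X in X - _]addrA [type_degree r a + _]addrC addrK.
rewrite step_expectE// /mean_drift.
have E b : pi b * wsum (vcount r) (attach_prob r b) (m b) (fun t => g (b, t)) =
   type_degree r a * (edge_mass pi m b * kappa a b / col_mass kappa (type_degree r) b) +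
   (if b == a then edge_mass pi m a else 0).
  have -> : wsum (vcount r) (attach_prob r b) (m b) (fun t => g (b, t)) =
    (m b)%:R * (\sum_(w <- iota 0 (vcount r) | vtype r w == a) attach_prob r b w) +
    (if b == a then (m b)%:R else 0).
    rewrite -wsum_count ?attach_prob_sum//.
    transitivity (wsum (vcount r) (attach_prob r b) (m b) (fun t => (count (fun w => vtype r w == a) t)%:R) +
      (if b == a then (m b)%:R else 0) * wsum (vcount r) (attach_prob r b) (m b) (fun=> 1)).
      rewrite /wsum mulr_sumr -big_split.
      by apply: eq_bigr => t _; rewrite /g /=; ring.
    by rewrite wsum_total attach_prob_sum// expr1n mulr1.
  have -> : \sum_(w <- iota 0 (vcount r) | vtype r w == a) attach_prob r b w =
     kappa a b * type_degree r a / col_mass kappa (type_degree r) b.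
    rewrite -total_weight_type /attach_prob -mulr_suml; congr (_ / _).
    by rewrite /type_degree mulr_sumr; apply: eq_bigr => w /eqP ->.
  by rewrite mulrDr; congr (_ + _); [rewrite /edge_mass; ring|
    case: eqP => [->|_]; rewrite ?mulr0// /edge_mass mulrC].
rewrite (eq_bigr _ (fun b _ => E b)) big_split /= -mulr_sumr addrC; congr (_ + _).
by rewrite -big_mkcond big_pred1_eq.
Qed.

Definition max_out : nat := (\sum_b m b)%N.

Lemma le_max_out b : (m b <= max_out)%N.
Proof. by rewrite /max_out (bigD1 b)//= leq_addr. Qed.

Lemma type_degree_step r s a : reachable arrivals r -> s \in arrivals r ->
  `|type_degree (s :: r) a - type_degree r a| <= (2 * max_out)%N%:R.
Proof.
move=> rr /mem_arrivals[sz ts]; rewrite type_degreeS// -[in X in X - _]addrA [type_degree r a + _]addrC addrK.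
rewrite ger0_norm; last by rewrite addr_ge0//; case: ifP.
rewrite mul2n -addnn natrD; apply: lerD.
  by rewrite ler_nat (leq_trans (count_size _ _))// sz le_max_out.
by case: ifP => // _; rewrite ler_nat sz le_max_out.
Qed.

End arrivals.

(** * Descendants in the attachment graph *)

Section descendants.
Context (K : nat) (hK : (0 < K)%N) (m : 'I_K -> nat) (G0 : fmgraph K).

Local Notation n0 := (size_fg G0).
Local Notation arr := (arrival K).
Local Notation births := (seq (nat * 'I_K)).
Implicit Types (r : seq arr) (s : arr) (u v w : nat) (D : seq nat) (l : births).

Local Notation vcount := (vcount G0).
Local Notation vtype := (vtype hK G0).
Local Notation vdeg := (vdeg G0).
Local Notation vmult := (vmult G0).
Local Notation wf := (wf m G0).

(** Filtering keeps repetitions, so a double edge to a single descendant also yields [None]. *)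
Definition desc_step (N : nat) s (o : option (seq nat * births)) : option (seq nat * births) :=
  if o is Some (D, l) then
    match [seq w <- s.2 | w \in D] with
    | [::] => o
    | [:: x] => Some (rcons D N, (index x D, s.1) :: l)
    | _ => None
    end
  else None.

(* The descendants of [v] and their history; [None] for the seed vertices, and
   once a newcomer is attached twice to the descendants of [v]. *)
Fixpoint desc r v : option (seq nat * births) :=
  if r is s :: r' then
    if v == vcount r' then Some ([:: v], [::]) else desc_step (vcount r') s (desc r' v)
  else None.

(** The order of [D] matches the order of births. As [desc_mult] covers every [u], it also says that
    no edge enters the descendants from outside and that none is double. *)
Record desc_spec r v D l : Prop := DescSpec {
  desc_uniq : uniq D;
  desc_lt : all (fun w => w < vcount r)%N D;
  desc_size : size D = (size l).+1;
  desc_root : nth 0%N D 0 = v;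
  desc_valid : hvalid l;
  desc_type : forall i, (i < size D)%N -> vtype r (nth 0%N D i) = htype (vtype r v) l i;
  desc_deg : forall i, (i < size D)%N -> vdeg r (nth 0%N D i) = hdegree m (vtype r v) l i;
  desc_mult : forall u i, (i < size D)%N -> vmult r u (nth 0%N D i) =
    [&& u \in D, (0 < index u D)%N & hparent l (index u D) == i] }.

Lemma count_mem_filter (D t : seq nat) x : x \in D ->
  count_mem x t = count_mem x [seq w <- t | w \in D].
Proof.
move=> xD; rewrite count_filter; apply: eq_count => w /=.
by case: eqP => // ->; rewrite xD.
Qed.

Lemma desc_specP r v D l : wf r -> (v < vcount r)%N -> desc r v = Some (D, l) ->
  desc_spec r v D l.
Proof.
elim: r v D l => // s r IH v D l /= /and3P[wr tr /eqP sz]; rewrite vcountS => vN.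
case: eqP => [-> [<- <-]|/eqP vr].
  have m0 u : vmult (s :: r) u (vcount r) = 0%N by rewrite /= eqxx.
  split => //=; first by rewrite vcountS ltnSn.
  - by case.
  - by case=> // _; rewrite !eqxx /hdegree /nkids /= sz.
  - by move=> u [|//] _ /=; rewrite eqxx inE (eq_sym (vcount r)); case: eqP.
have {}vN : (v < vcount r)%N by rewrite ltn_neqAle vr -ltnS.
case E : (desc r v) => [[D0 l0]|//] /=.
have [U L S Rt V Ty De Mu] := IH _ _ _ wr vN E.
have nthlt i : (i < size D0)%N -> (nth 0%N D0 i < vcount r)%N.
  by move=> iD; apply: (allP L); exact: mem_nth.
have nthne i : (i < size D0)%N -> (nth 0%N D0 i == vcount r) = false.
  by move=> iD; rewrite ltn_eqF// nthlt.
have ND : vcount r \notin D0 by apply/negP => /(allP L); rewrite ltnn.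
case F : [seq w <- s.2 | w \in D0] => [|x [|]] // [<- <-].
  have c0 i : (i < size D0)%N -> count_mem (nth 0%N D0 i) s.2 = 0%N.
    by move=> iD; rewrite (count_mem_filter _ (mem_nth 0%N iD)) F.
  split => //.
  - by apply: sub_all L => w wr'; rewrite vcountS ltnW.
  - by move=> i iD; rewrite /= nthne// (negbTE vr) Ty.
  - by move=> i iD; rewrite /= nthne// (negbTE vr) c0// addn0 De.
  - move=> u i iD; rewrite /= nthne// c0//; case: eqP => [->|_]; last exact: Mu.
    by rewrite (negbTE ND).
have xf : x \in [seq w <- s.2 | w \in D0] by rewrite F inE.
have xD : x \in D0 by move: xf; rewrite mem_filter => /andP[].
have xs : x \in s.2 by move: xf; rewrite mem_filter => /andP[].
have pS : (index x D0 < size D0)%N by rewrite index_mem.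
have cx i : (i < size D0)%N -> count_mem (nth 0%N D0 i) s.2 = (index x D0 == i).
  move=> iD; rewrite (count_mem_filter _ (mem_nth 0%N iD)) F /= addn0.
  by rewrite -{1}(nth_index 0%N xD) nth_uniq.
(* Individuals already recorded have their parents in [D0], so none of them is a child of the
   newcomer. *)
have hp j : (0 < j <= size l0)%N -> (hparent l0 j < size D0)%N.
  by case/andP=> j0 jl; rewrite S ltnW// ltnS (leq_trans (hparent_lt V j0)).
split => //.
- by rewrite rcons_uniq ND.
- by rewrite all_rcons vcountS ltnSn; apply: sub_all L => w wr'; rewrite ltnW.
- by rewrite size_rcons S.
- by rewrite nth_rcons S /=.
- by rewrite /= V andbT -ltnS -S.
- move=> i; rewrite size_rcons ltnS nth_rcons => iD.
  case: ltngtP iD => // [iD _|-> _]; rewrite /= ?nthne// (negbTE vr).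
    by rewrite -S ltn_eqF// Ty.
  by rewrite eqxx S eqxx.
- move=> i; rewrite size_rcons ltnS nth_rcons => iD.
  case: ltngtP iD => // [iD _|-> _]; rewrite /= /hdegree /nkids /= (negbTE vr).
    by rewrite nthne// cx// De// /hdegree -S (ltn_eqF iD) addnC addnA.
  rewrite eqxx S eqxx sz -S (ltn_eqF pS) -/(nkids l0 _) nkids_out// ?S//.
- move=> u i; rewrite size_rcons ltnS nth_rcons mem_rcons inE => iD.
  (* Former descendants keep their positions and the newcomer gets [size D0]; the last value stands
     for absent vertices. *)
  have idx : index u (rcons D0 (vcount r)) = if u \in D0 then index u D0 else
      if u == vcount r then size D0 else (size D0).+1.
    by rewrite -cats1 index_cat /= eq_sym; case: ifP => // _; case: eqP; rewrite ?addn0 ?addn1.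
  rewrite idx; case: (boolP (u \in D0)) => uD.
    have uN : (u == vcount r) = false by apply: contraNF ND => /eqP <-.
    have iu : (index u D0 < size D0)%N by rewrite index_mem.
    rewrite orbT /= -S (ltn_eqF iu).
    case: ltngtP iD => // [iD _|-> _] /=; first by rewrite nthne// uN Mu// uD.
    rewrite eqxx; case: posnP => //= u0; rewrite ltn_eqF// hp// u0 /=.
    by rewrite -ltnS -S.
  rewrite orbF; case: (u =P vcount r) => [->|/eqP uN].
    have Hs : (0 < size D0)%N by rewrite S.
    rewrite /= -S !eqxx Hs /=; case: ltngtP iD => // [iD _|-> _]; first by rewrite nthne// cx.
    by rewrite eqxx (ltn_eqF pS).
  case: ltngtP iD => // [iD _|-> _] /=; last by rewrite eqxx.
  by rewrite nthne// (negbTE uN) Mu// (negbTE uD).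
Qed.

(** A superset of the out-neighbours, of bounded length: for a seed vertex, the whole seed. *)
Fixpoint out_nbrs r u : seq nat :=
  if r is s :: r' then if u == vcount r' then s.2 else out_nbrs r' u else iota 0 n0.

Lemma vmult_out_nbrs r u v : (0 < vmult r u v)%N -> v \in out_nbrs r u.
Proof.
elim: r => [|s r IH] /=.
  by case: insub => // i; case: insubP => // j; rewrite mem_iota.
case: eqP => // _; case: eqP => // _.
by rewrite -has_count has_pred1.
Qed.

Definition out_bound : nat := (n0 + max_out m)%N.

Lemma size_out_nbrs r u : wf r -> (size (out_nbrs r u) <= out_bound)%N.
Proof.
elim: r => [|s r IH] /=; first by rewrite size_iota leq_addr.
case/and3P=> wr _ /eqP sz; case: eqP => _; last exact: IH.
by rewrite sz (leq_trans (le_max_out m _))// leq_addl.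
Qed.

Definition at_pos r l i w v : bool :=
  if desc r v is Some (D, l') then (l' == l) && (nth 0%N D i == w) else false.

(* A vertex has boundedly many out-neighbours, so it is a bounded-depth
   descendant of boundedly many vertices. *)
Lemma count_at_pos r l i w : (0 < out_bound)%N -> wf r -> (i <= size l)%N ->
  (count (at_pos r l i w) (iota 0 (vcount r)) <= out_bound ^ i)%N.
Proof.
move=> B0 wr; elim/ltn_ind: i w => i IH w il.
have [i0|i0] := posnP i.
  rewrite i0 expn0; apply: (@leq_trans (count_mem w (iota 0 (vcount r)))).
    rewrite -!size_filter.
    have sub : {subset [seq v <- iota 0 (vcount r) | at_pos r l 0 w v] <= [seq v <- iota 0 (vcount r) | v == w]}.
      move=> v; rewrite !mem_filter /at_pos; case E : desc => [[D l']|//].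
      case/andP=> /andP[_ /eqP <-] vN; rewrite vN andbT.
      rewrite mem_iota add0n in vN.
      by rewrite (desc_root (desc_specP wr vN E)).
    by apply: uniq_leq_size sub; rewrite filter_uniq ?iota_uniq.
  by rewrite count_uniq_mem ?iota_uniq// leq_b1.
(* If [w] is the [i]-th descendant of [v], one of its out-neighbours is the [p]-th one. As [p < i],
   strong induction applies, at the cost of one factor [out_bound]. *)
set p := hparent l i.
apply: (@leq_trans (\sum_(x <- out_nbrs r w) count (at_pos r l p x) (iota 0 (vcount r)))).
  have -> : (\sum_(x <- out_nbrs r w) count (at_pos r l p x) (iota 0 (vcount r)) =
    \sum_(v <- iota 0 (vcount r)) count (fun x => at_pos r l p x v) (out_nbrs r w))%N.
    under eq_bigr do rewrite -sum1_count big_mkcond.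
    by rewrite exchange_big /=; apply: eq_bigr => v _; rewrite -sum1_count [RHS]big_mkcond.
  rewrite -sum1_count big_mkcond big_seq [leqRHS]big_seq; apply: leq_sum => v vN.
  case: ifP => // av; rewrite -has_count.
  move: av; rewrite /at_pos; case E : desc => [[D l']|//] /andP[/eqP ll /eqP nw].
  rewrite mem_iota add0n in vN; have Sp := desc_specP wr vN E.
  rewrite ll in Sp *.
  have iD : (i < size D)%N by rewrite (desc_size Sp) ltnS.
  have pi' : (p < i)%N by exact: hparent_lt (desc_valid Sp) i0.
  have pD : (p < size D)%N by exact: ltn_trans iD.
  apply/hasP; exists (nth 0%N D p); last by rewrite !eqxx.
  apply: vmult_out_nbrs; rewrite (desc_mult Sp)// -nw mem_nth//= index_uniq ?(desc_uniq Sp)//.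
  by rewrite i0 eqxx.
have [lv|lv] := boolP (hvalid l); last first.
  rewrite big1 // => x _; apply/eqP; rewrite -leqn0 leqNgt -has_count; apply/hasPn => v.
  rewrite mem_iota add0n => vN; rewrite /at_pos; case E : desc => [[D l']|//].
  by apply/negP => /andP[/eqP ll _]; move: lv; rewrite -ll (desc_valid (desc_specP wr vN E)).
have pi' : (p < i)%N by exact: hparent_lt lv i0.
apply: (@leq_trans (\sum_(x <- out_nbrs r w) out_bound ^ p)).
  by apply: leq_sum => x _; apply: IH => //; rewrite (leq_trans (ltnW pi')).
rewrite big_const_seq count_predT iter_addn_0 mulnC.
apply: (@leq_trans (out_bound * out_bound ^ p)); first by rewrite leq_mul2r size_out_nbrs ?orbT.
by rewrite -expnS leq_pexp2l.
Qed.

End descendants.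

(** * The law of the history *)

Section history_law.
Context (R : realType) (K : nat).
Variables (pi : 'I_K -> R) (phi : 'I_K -> 'I_K -> R) (m : 'I_K -> nat).
Hypothesis (pi_gt0 : forall a, 0 < pi a) (pi_sum : \sum_a pi a = 1).
Hypothesis (phi_gt0 : forall a b, 0 < phi a b).

Local Notation births := (seq (nat * 'I_K)).
Implicit Types (l : births) (a b : 'I_K).

Definition hrate a l i b : R := phi (htype a l i) b * (hdegree m a l i)%:R.

Definition total_rate a l : R := \sum_(i <- iota 0 (size l).+1) \sum_b hrate a l i b.

(* Clocks ring at the rates [hrate], and the observation time at rate 2; both are
   halved, as in the recursion satisfied by the counts in the graph. *)
Fixpoint hist_law a l : R :=
  (if l is e :: l' then
     if (e.1 <= size l')%N then hrate a l' e.1 e.2 / 2 * hist_law a l' else 0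
   else pi a) / (1 + total_rate a l / 2).

Lemma hrate_ge0 a l i b : 0 <= hrate a l i b.
Proof. by rewrite mulr_ge0// ltW. Qed.

Lemma total_rate_ge0 a l : 0 <= total_rate a l.
Proof. by apply: sumr_ge0 => i _; apply: sumr_ge0 => b _; exact: hrate_ge0. Qed.

Let den_gt0 a l : 0 < 1 + total_rate a l / 2.
Proof. by rewrite ltr_wpDr// divr_ge0// total_rate_ge0. Qed.

(** Balance at a history: what flows in is either observed there or moves on to a further birth. *)
Lemma hist_lawM a l : hist_law a l + hist_law a l * (total_rate a l / 2) =
  if l is e :: l' then
    if (e.1 <= size l')%N then hrate a l' e.1 e.2 / 2 * hist_law a l' else 0
  else pi a.
Proof.
rewrite -[X in X + _]mulr1 -mulrDr.
by case: l => [|e l]; apply: divfK; rewrite gt_eqF.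
Qed.

Lemma hist_law_ge0 a l : 0 <= hist_law a l.
Proof.
elim: l => [|e l IH] /=; rewrite divr_ge0 ?(ltW (den_gt0 _ _))//; first exact: ltW.
by case: ifP => // _; rewrite mulr_ge0// divr_ge0 ?hrate_ge0.
Qed.

Definition next_births N : births := [seq (p, b) | p <- iota 0 N.+1, b <- enum 'I_K].

Fixpoint histories N : seq births :=
  if N is N'.+1 then [seq e :: l | l <- histories N', e <- next_births N'] else [:: [::]].

Lemma mem_histories N l : l \in histories N -> size l = N /\ hvalid l.
Proof.
elim: N l => [|N IH] l /=; first by rewrite inE => /eqP->.
case/allpairsPdep => l' [e [/IH[sl vl] /allpairsPdep[p [b [pN _ ->]]] ->]].
by rewrite /= sl vl andbT; rewrite mem_iota in pN.
Qed.

Lemma histories_uniq N : uniq (histories N).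
Proof.
elim: N => //= N IH; apply: allpairs_uniq_dep => //.
  move=> l _; apply: allpairs_uniq_dep; first exact: iota_uniq.
    by move=> p _; exact: enum_uniq.
  by move=> [p b] [p' b'] _ _ /= [-> ->].
by move=> [l e] [l' e'] _ _ /= [-> ->].
Qed.

(** [level_mass N] is to be read as the probability of exactly [N] births before the observation,
    and [level_flow N] as that of more than [N]. *)
Definition level_mass N : R := \sum_a \sum_(l <- histories N) hist_law a l.
Definition level_flow N : R := \sum_a \sum_(l <- histories N) hist_law a l * (total_rate a l / 2).

Lemma level0 : level_mass 0 + level_flow 0 = 1.
Proof.
rewrite -big_split -[RHS]pi_sum; apply: eq_bigr => a _.
by rewrite -[RHS](hist_lawM a [::]); congr (_ + _); exact: big_seq1.
Qed.

Lemma levelS N : level_mass N.+1 + level_flow N.+1 = level_flow N.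
Proof.
rewrite -big_split /=; apply: eq_bigr => a _.
rewrite -big_split /= big_allpairs_dep; rewrite big_seq [RHS]big_seq.
apply: eq_bigr => l /mem_histories[sl _].
have -> : hist_law a l * (total_rate a l / 2) =
    \sum_(p <- iota 0 N.+1) \sum_b hrate a l p b / 2 * hist_law a l.
  rewrite /total_rate sl mulrC !mulr_suml; apply: eq_bigr => p _.
  by rewrite !mulr_suml.
rewrite big_allpairs_dep; apply: eq_big_seq => p; rewrite mem_iota add0n => /andP[_ pN].
by rewrite big_enum; apply: eq_bigr => b _; rewrite -[LHS]/(hist_law a (_ :: l) + hist_law a (_ :: l) * _) hist_lawM sl -ltnS pN.
Qed.

Lemma level_flow_ge0 N : 0 <= level_flow N.
Proof.
by apply: sumr_ge0 => a _; apply: sumr_ge0 => l _; rewrite mulr_ge0 ?hist_law_ge0// divr_ge0// total_rate_ge0.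
Qed.

Lemma sum_level_mass N : \sum_(0 <= k < N.+1) level_mass k = 1 - level_flow N.
Proof.
elim: N => [|N IH]; first by rewrite big_nat1 -level0 addrK.
by rewrite big_nat_recr//= IH -levelS opprD addrA addrAC subrK.
Qed.

(* Total rates grow linearly with the population, so the process does not explode. *)
Lemma level_flow_bound : exists2 C : R, 0 < C & forall N, level_flow N <= C * N.+1%:R * level_mass N.
Proof.
pose ph := \sum_a \sum_b phi a b; pose M := (\sum_a m a)%N.
have phb a b : phi a b <= ph.
  rewrite /ph (bigD1 a)//= (bigD1 b)//= -addrA lerDl addr_ge0//.
    by apply: sumr_ge0 => i _; exact: ltW.
  by apply: sumr_ge0 => i _; apply: sumr_ge0 => j _; exact: ltW.
have ph0 : 0 <= ph by apply: sumr_ge0 => i _; apply: sumr_ge0 => j _; exact: ltW.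
exists (ph * K%:R * (M.+1)%:R / 2 + 1); first by rewrite ltr_wpDl// divr_ge0// mulr_ge0// mulr_ge0.
move=> N; rewrite /level_flow /level_mass mulr_sumr; apply: ler_sum => a _.
rewrite mulr_sumr; apply: ler_sum_seq => l /mem_histories[sl vl].
rewrite mulrC; apply: ler_wpM2r; first exact: hist_law_ge0.
apply: (@le_trans _ _ (ph * K%:R * M.+1%:R / 2 * N.+1%:R)); last first.
  by apply: ler_wpM2r => //; rewrite lerDl.
(* Each birth has a single parent. *)
have kidsum : (\sum_(i <- iota 0 N.+1) nkids l i <= N)%N.
  rewrite -[leqRHS]sl; elim: (l) => [|e l' IH]; first by rewrite big1.
  rewrite /nkids /= big_split /= -/(nkids l') -[leqRHS]add1n; apply: leq_add => //.
  rewrite (@leq_trans (count_mem e.1 (iota 0 N.+1)))//; last first.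
    by rewrite count_uniq_mem ?iota_uniq// leq_b1.
  by rewrite -sum1_count [leqRHS]big_mkcond; apply: leq_sum => i _; rewrite /= (eq_sym e.1); case: (i == e.1).
apply: (@le_trans _ _ (\sum_(i <- iota 0 N.+1) ph * K%:R * (nkids l i + M)%:R / 2)).
  rewrite /total_rate sl mulr_suml; apply: ler_sum => i _.
  apply: ler_wpM2r => //.
  apply: (@le_trans _ _ (\sum_(b < K) ph * (nkids l i + M)%:R)).
    apply: ler_sum => b _; apply: ler_pM => //; first exact: ltW.
    by rewrite ler_nat leq_add2l /M (bigD1 (htype a l i))//= leq_addr.
  by rewrite sumr_const card_ord -[_ *+ K]mulr_natr mulrAC.
rewrite -mulr_suml -mulr_sumr -natr_sum -[leRHS]mulrA [2^-1 * _]mulrC [leRHS]mulrA.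
apply: ler_wpM2r => //; rewrite -[leRHS]mulrA; apply: ler_wpM2l; first by rewrite mulr_ge0.
have constM : (\sum_(i <- iota 0 N.+1) M = N.+1 * M)%N.
  by rewrite big_const_seq count_predT size_iota iter_addn_0 mulnC.
by rewrite -natrM ler_nat big_split /= [X in (_ + X)%N]constM [leqRHS]mulSn [(M * _)%N]mulnC leq_add2r ltnW.
Qed.

(** If the flow never fell below [e], each [level_mass k] would be at least a constant over [k.+1],
    and by divergence of the harmonic series the total mass would exceed 1. *)
Lemma hist_law_exhausts (e : R) : 0 < e ->
  exists N, 1 - e < \sum_(0 <= k < N.+1) level_mass k.
Proof.
move=> e0; have [C C0 HC] := level_flow_bound.
suff [N HN] : exists N, level_flow N < e by exists N; rewrite sum_level_mass ltrD2l ltrN2.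
apply: contrapT => /forallNP H.
have Fe N : e <= level_flow N by have /negP := H N; rewrite -leNgt.
have [n Hn] := harmonic_tail_unbounded 0 (C / e).
have : \sum_(0 <= k < n.+1) level_mass k <= 1.
  by rewrite sum_level_mass gerBl level_flow_ge0.
rewrite leNgt => /negP; apply; apply: (@lt_le_trans _ _ (e / C * \sum_(0 <= k < n) (k.+1%:R)^-1)).
  by rewrite mulrC -ltr_pdivrMr ?divr_gt0// mul1r invf_div.
have mass_ge k : e / C * (k.+1%:R)^-1 <= level_mass k.
  rewrite -mulrA -invfM ler_pdivrMr ?mulr_gt0//.
  by rewrite mulrC; apply: le_trans (HC k); exact: Fe.
rewrite mulr_sumr big_nat_recr//= -[leLHS]addr0; apply: lerD; first exact: ler_sum.
by apply: le_trans (mass_ge n); rewrite mulr_ge0// divr_ge0// ltW.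
Qed.

End history_law.

(** * Vertices with a given history *)

Section history_counts.
Context (R : realType) (K : nat) (hK : (0 < K)%N).
Variables (pi : 'I_K -> R) (kappa : 'I_K -> 'I_K -> R) (m : 'I_K -> nat).
Hypothesis (pi_gt0 : forall a, 0 < pi a) (pi_sum : \sum_a pi a = 1).
Hypothesis (kappa_gt0 : forall a b, 0 < kappa a b) (m_ge1 : forall a, (1 <= m a)%N).
Variable (G0 : fmgraph K).
Hypothesis hG0 : seed_graph G0.

Local Notation n0 := (size_fg G0).
Local Notation arr := (arrival K).
Local Notation births := (seq (nat * 'I_K)).
Implicit Types (r : seq arr) (s : arr) (u v w : nat) (l : births) (a b : 'I_K).

Local Notation vcount := (vcount G0).
Local Notation vtype := (vtype hK G0).
Local Notation vdeg := (vdeg G0).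
Local Notation wf := (wf m G0).
Local Notation total_weight := (total_weight hK kappa G0).
Local Notation attach_prob := (attach_prob hK kappa G0).
Local Notation arrivals := (arrivals m G0).
Local Notation step_prob := (step_prob pi kappa m G0).
Local Notation desc := (desc G0).

Definition has_hist r a l v : bool :=
  (vtype r v == a) && (if desc r v is Some (_, l') then l' == l else false).

Definition hist_count a l r : R := (count (has_hist r a l) (iota 0 (vcount r)))%:R.

Definition hist_weight a l b : R :=
  \sum_(i <- iota 0 (size l).+1) kappa (htype a l i) b * (hdegree m a l i)%:R.

(** Conditional probability that the next newcomer hits the descendants of a type-[a] vertex with
    history [l]. For [gain] it has type [b] and hits exactly once, at position [p]. *)
Definition loss a l r : R :=
  1 - \sum_b pi b * (1 - hist_weight a l b / total_weight r b) ^+ m b.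

Definition gain a l p b r : R :=
  pi b * ((m b)%:R * (kappa (htype a l p) b * (hdegree m a l p)%:R / total_weight r b) *
    (1 - hist_weight a l b / total_weight r b) ^+ (m b).-1).

(** The history dictates the types and degrees of the descendants, so the chance of hitting them
    depends on the graph only through [total_weight]. This closes the recursion for the counts. *)
Lemma attach_prob_desc r v D l b : wf r -> desc_spec hK m G0 r v D l ->
  \sum_(w <- iota 0 (vcount r) | w \notin D) attach_prob r b w =
  1 - hist_weight (vtype r v) l b / total_weight r b.
Proof.
move=> wr Sp; rewrite -(attach_prob_sum hK kappa_gt0 m_ge1 hG0 b wr).
rewrite [in RHS](bigID (fun w => w \notin D)) /= -addrA.
have -> : \sum_(w <- iota 0 (vcount r) | ~~ (w \notin D)) attach_prob r b w =
   hist_weight (vtype r v) l b / total_weight r b; last by rewrite subrr addr0.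
have -> : \sum_(w <- iota 0 (vcount r) | ~~ (w \notin D)) attach_prob r b w =
    \sum_(w <- D) attach_prob r b w.
  rewrite -big_filter; apply: perm_big; apply: uniq_perm.
  - by rewrite filter_uniq ?iota_uniq.
  - exact: desc_uniq Sp.
  - move=> w; rewrite mem_filter negbK mem_iota add0n /=; case: (boolP (w \in D)) => //=.
    by move=> wD; exact: (allP (desc_lt Sp)).
rewrite /hist_weight mulr_suml (big_nth 0%N) -(desc_size Sp) iota_index big_nat [RHS]big_nat.
apply: eq_bigr => i /andP[_ iD].
by rewrite /attach_prob (desc_type Sp)// (desc_deg Sp).
Qed.

(** By the number of edges into [D]: none keeps the history, one adds a birth at the position hit,
    more give [None]. Uniqueness of [D] identifies a vertex with its position. *)
Lemma desc_stepE (N : nat) s D l0 l : uniq D ->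
  (if desc_step N s (Some (D, l0)) is Some (_, l') then l' == l else false) =
  if l0 == l then count (fun w => w \in D) s.2 == 0%N
  else if l is e :: l' then
    [&& l0 == l', e.2 == s.1, (e.1 < size D)%N, count (fun w => w \in D) s.2 == 1%N
      & nth 0%N D e.1 \in s.2]
  else false.
Proof.
move=> uD; rewrite /= -size_filter.
have Fin w : w \in [seq w <- s.2 | w \in D] -> (w \in D) /\ (w \in s.2).
  by rewrite mem_filter => /andP.
have Fin' w : w \in D -> w \in s.2 -> w \in [seq w <- s.2 | w \in D].
  by move=> h1 h2; rewrite mem_filter h1 h2.
case: [seq w <- s.2 | w \in D] Fin Fin' => [|x [|y F]] Fin Fin' /=.
- case: eqP => // _; case: l => // e l'; apply/esym/negbTE.
  by rewrite !negb_and /= !orbT.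
- have [xD xs] := Fin x (mem_head _ _).
  case: (l0 =P l) => [<-|_].
    by apply/negP => /eqP /(congr1 size) /= /eqP; rewrite eqn_leq ltnn.
  case: l => [//|[p b] l'] /=; rewrite eqseq_cons xpair_eqE /= andbC.
  case: (l0 == l') => //=; rewrite andbC (eq_sym s.1); case: (b == s.1) => //=.
  apply/eqP/andP => [<-|[pD /(Fin' _ (mem_nth _ pD))]].
    by rewrite index_mem nth_index.
  by rewrite inE => /eqP <-; rewrite index_uniq.
- by case: (l0 == l) => //; case: l => // e l'; rewrite /= !andbF.
Qed.

Lemma sum_step_stay r v D l : wf r -> desc_spec hK m G0 r v D l ->
  \sum_(s <- arrivals r) step_prob r s * (count (fun w => w \in D) s.2 == 0%N)%:R =
  1 - loss (vtype r v) l r.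
Proof.
move=> wr Sp; rewrite step_expectE// /loss opprB addrC subrK; apply: eq_bigr => b _.
by rewrite wsum_avoid (attach_prob_desc b wr Sp).
Qed.

Lemma sum_step_hit r v D l p b : wf r -> desc_spec hK m G0 r v D l -> (p <= size l)%N ->
  \sum_(s <- arrivals r) step_prob r s * [&& b == s.1,
     count (fun w => w \in D) s.2 == 1%N & nth 0%N D p \in s.2]%:R =
  gain (vtype r v) l p b r.
Proof.
move=> wr Sp pl; have pD : (p < size D)%N by rewrite (desc_size Sp).
rewrite (step_expectE hK pi kappa (fun s => [&& b == s.1,
     count (fun w => w \in D) s.2 == 1%N & nth 0%N D p \in s.2]%:R))// (bigD1 b)//= eqxx /=.
rewrite [X in _ + X]big1 ?addr0 => [|b' /negPf bb]; last first.
  rewrite (@eq_wsum _ _ _ _ _ (fun=> 0)) ?wsum_zero ?mulr0// => t.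
  by rewrite eq_sym bb.
rewrite wsum_hit_once ?mem_nth//; last by apply: (allP (desc_lt Sp)); exact: mem_nth.
by rewrite (attach_prob_desc b wr Sp) /gain /attach_prob (desc_type Sp)// (desc_deg Sp).
Qed.

Lemma hist_countS r s a l : wf r ->
  hist_count a l (s :: r) = \sum_(v <- iota 0 (vcount r)) (has_hist (s :: r) a l v)%:R +
    ((s.1 == a) && (l == [::]))%:R.
Proof.
move=> wr; rewrite /hist_count vcountS -[in iota _ _]addn1 iotaD count_cat natrD; congr (_ + _).
  by rewrite -sum1_count natr_sum big_mkcond; apply: eq_bigr => v _; case: has_hist.
by rewrite /= addn0 /has_hist /= eqxx (eq_sym [::]); case: l.
Qed.

Lemma sum_step_has_hist r a l v : reachable arrivals r -> (v < vcount r)%N ->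
  \sum_(s <- arrivals r) step_prob r s * (has_hist (s :: r) a l v)%:R =
  (1 - loss a l r) * (has_hist r a l v)%:R +
  (if l is e :: l' then
     if (e.1 <= size l')%N then gain a l' e.1 e.2 r * (has_hist r a l' v)%:R else 0
   else 0).
Proof.
move=> rr vN; have wr := reachable_wf rr.
have vne : (v == vcount r) = false by rewrite ltn_eqF.
have hS s : has_hist (s :: r) a l v = (vtype r v == a) &&
    (if desc_step (vcount r) s (desc r v) is Some (_, l') then l' == l else false).
  by rewrite /has_hist /= vne.
under eq_bigr do rewrite hS.
rewrite /has_hist; case: (vtype r v =P a) => [va|_] /=; last first.
  by rewrite big1 => [|s _]; rewrite mulr0// add0r; case: l {hS} => // e l'; rewrite mulr0 if_same.
case E : (desc r v) => [[D l0]|]; last first.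
  by rewrite big1 => [|s _]; rewrite mulr0// add0r; case: l {hS} => // e l'; rewrite mulr0 if_same.
have Sp := desc_specP hK wr vN E.
under eq_bigr do rewrite desc_stepE ?(desc_uniq Sp)//.
case: (l0 =P l) => [l0l|l0l].
  rewrite l0l in Sp; rewrite (sum_step_stay wr Sp) va mulr1.
  case: l {hS Sp} l0l => [|e l'] l0l; rewrite ?addr0//.
  rewrite (_ : (l0 == l') = false); first by rewrite mulr0 if_same addr0.
  by apply/negbTE/eqP => l0l'; move: l0l; rewrite l0l' => /(congr1 size)/= /eqP; rewrite ltn_eqF.
rewrite mulr0 add0r; case: l {hS} l0l => [|[p b] l'] _ /=.
  by rewrite big1// => s _; rewrite mulr0.
case: (l0 =P l') => [l0l'|_] /=; last first.
  by rewrite mulr0 if_same big1// => s _; rewrite mulr0.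
rewrite mulr1 (desc_size Sp) ltnS l0l'; rewrite l0l' in Sp; case: ifP => pl; last first.
  by rewrite big1// => s _; rewrite andbF mulr0.
by rewrite -va -(sum_step_hit b wr Sp pl).
Qed.

Lemma hist_count_drift r a l : reachable arrivals r ->
  drift step_prob arrivals (hist_count a l) r =
  (if l is e :: l' then
     if (e.1 <= size l')%N then gain a l' e.1 e.2 r * hist_count a l' r else 0
   else pi a) - loss a l r * hist_count a l r.
Proof.
move=> rr; have wr := reachable_wf rr; rewrite /drift.
under eq_bigr do rewrite mulrBr.
rewrite sumrB -mulr_suml step_prob_sum// mul1r.
under eq_bigr do rewrite hist_countS// mulrDr.
rewrite big_split /=.
have countE l1 : hist_count a l1 r = \sum_(v <- iota 0 (vcount r)) (has_hist r a l1 v)%:R.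
  by rewrite /hist_count -sum1_count natr_sum big_mkcond; apply: eq_bigr => v _; case: has_hist.
have -> : \sum_(s <- arrivals r) step_prob r s * \sum_(v <- iota 0 (vcount r)) (has_hist (s :: r) a l v)%:R =
   (1 - loss a l r) * hist_count a l r + (if l is e :: l' then
     if (e.1 <= size l')%N then gain a l' e.1 e.2 r * hist_count a l' r else 0 else 0).
  under eq_bigr do rewrite mulr_sumr.
  rewrite exchange_big /=; transitivity (\sum_(v <- iota 0 (vcount r))
    ((1 - loss a l r) * (has_hist r a l v)%:R +
    (if l is e :: l' then
     if (e.1 <= size l')%N then gain a l' e.1 e.2 r * (has_hist r a l' v)%:R else 0
     else 0))).
    apply: eq_big_seq => v; rewrite mem_iota add0n => /andP[_ vN].
    exact: sum_step_has_hist.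
  rewrite big_split /= -mulr_sumr -countE; congr (_ + _).
  case: l => [|e l']; first by rewrite big1.
  by case: ifP => _; [rewrite -mulr_sumr -countE|rewrite big1].
have -> : \sum_(s <- arrivals r) step_prob r s * ((s.1 == a) && (l == [::]))%:R =
    if l is e :: l' then 0 else pi a.
  case: l => [|e l']; last by rewrite big1// => s _; rewrite andbF mulr0.
  rewrite (step_expectE hK pi kappa (fun s => ((s.1 == a) && true)%:R))// (bigD1 a)//= eqxx.
  rewrite wsum_total (attach_prob_sum hK kappa_gt0 m_ge1 hG0 _ wr) expr1n mulr1 big1 ?addr0// => b /negPf ba.
  by rewrite ba wsum_zero mulr0.
by case: l => [|e l]; [|set x := (if (_ <= _)%N then _ else _)]; ring.
Qed.

(** Overcounts the edges of [s] that hit a descendant of [v] while its history is [l], which is then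
    lost, or [behead l], from which [l] may arise. *)
Definition changed s r l v : nat :=
  (\sum_(l0 <- [:: l; behead l]) \sum_(i <- iota 0 (size l0).+1) \sum_(w <- s.2)
     at_pos G0 r l0 i w v)%N.

Lemma has_hist_changed s r a l v : wf r -> (v < vcount r)%N ->
  (has_hist (s :: r) a l v <= has_hist r a l v + changed s r l v)%N /\
  (has_hist r a l v <= has_hist (s :: r) a l v + changed s r l v)%N.
Proof.
move=> wr vN; have vne : (v == vcount r) = false by rewrite ltn_eqF.
have pos l0 D w : l0 \in [:: l; behead l] -> desc r v = Some (D, l0) -> w \in s.2 -> w \in D ->
    (0 < changed s r l v)%N.
  move=> l0l E ws wD; have Sp := desc_specP hK wr vN E.
  rewrite /changed (big_rem l0)//; apply: ltn_addr.
  rewrite (big_rem (index w D)); last by rewrite mem_iota add0n -(desc_size Sp) index_mem.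
  apply: ltn_addr; rewrite (big_rem w)//; apply: ltn_addr.
  by rewrite /at_pos E eqxx nth_index ?eqxx.
rewrite /has_hist /= vne; case: (vtype r v == a) => //=.
case E : (desc r v) => [[D l0]|//].
have Sp := desc_specP hK wr vN E.
rewrite [if desc_step _ _ _ is Some _ then _ else _](desc_stepE (vcount r) s l0 l (desc_uniq Sp)).
case: (l0 =P l) => [l0l|l0l].
  split; first by rewrite leq_add2l in_nil || case: (count _ _ == _).
  case: eqP => //= /eqP; rewrite -lt0n -has_count => /hasP[w ws wD].
  by apply: (pos l D w) => //; rewrite ?mem_head// E l0l.
split => //; case: l pos l0l => // e l' pos _.
case: eqP => //= l0l'; case: eqP => //= _; case: (_ < _)%N => //=; case: eqP => //= c1.
have : has (fun w => w \in D) s.2 by rewrite has_count c1.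
case/hasP=> w ws wD; case: (_ \in _) => //.
by apply: (pos l0 D w) => //; rewrite l0l' !inE eqxx orbT.
Qed.

Lemma hist_count_step a l : exists C : R, forall r s,
  reachable arrivals r -> s \in arrivals r ->
  `|hist_count a l (s :: r) - hist_count a l r| <= C.
Proof.
pose Bd := out_bound m G0.
have Bd0 : (0 < Bd)%N.
  rewrite /Bd /out_bound; apply: leq_trans (leq_addl _ _).
  exact: leq_trans (m_ge1 (Ordinal hK)) (le_max_out m _).
(* At most [max_out m] edges are sent, and each endpoint is the [i]-th descendant of at most
   [Bd ^ i] vertices with the given history; the successor below accounts for the newcomer
   itself. *)
pose Ch := (\sum_(l0 <- [:: l; behead l]) \sum_(i <- iota 0 (size l0).+1) (max_out m * Bd ^ i))%N.
exists Ch.+1%:R => r s rr sr; have wr := reachable_wf rr.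
have [sz ts] := mem_arrivals sr.
have chb : (\sum_(v <- iota 0 (vcount r)) changed s r l v <= Ch)%N.
  rewrite /changed exchange_big; apply: leq_sum => l0 _.
  rewrite exchange_big; apply: (@leq_trans (\sum_(i <- iota 0 (size l0).+1 | (i <= size l0)%N) (max_out m * Bd ^ i))); last first.
    by rewrite big_mkcond; apply: leq_sum => i _; case: ifP.
  rewrite big_seq [leqRHS]big_seq_cond.
  rewrite [leqRHS](eq_bigl (fun i => i \in iota 0 (size l0).+1)); last first.
    by move=> i; rewrite mem_iota add0n ltnS /= andbb.
  apply: leq_sum => i; rewrite mem_iota add0n ltnS => /andP[_ il].
  rewrite exchange_big; apply: (@leq_trans (\sum_(w <- s.2) Bd ^ i)).
    apply: leq_sum => w _; rewrite (leq_trans _ (count_at_pos hK w Bd0 wr il))//.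
    by rewrite -sum1_count [leqRHS]big_mkcond; apply: leq_sum => v _; case: at_pos.
  by rewrite big_const_seq count_predT iter_addn_0 mulnC leq_mul2r sz le_max_out orbT.
have countE l1 : count (has_hist r a l1) (iota 0 (vcount r)) = (\sum_(v <- iota 0 (vcount r)) has_hist r a l1 v)%N.
  by rewrite -sum1_count big_mkcond; apply: eq_bigr => v _; case: has_hist.
rewrite hist_countS// /hist_count countE -natr_sum -natrD.
set A' := (\sum_(v <- _) has_hist (s :: r) a l v)%N; set A := (\sum_(v <- _) has_hist r a l v)%N.
have h1 : (A' <= A + Ch)%N.
  apply: leq_trans (leq_add (leqnn _) chb); rewrite -big_split /= /A' big_seq [leqRHS]big_seq.
  apply: leq_sum => v; rewrite mem_iota add0n => /andP[_ vN].
  by have [] := has_hist_changed s a l wr vN.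
have h2 : (A <= A' + Ch)%N.
  apply: leq_trans (leq_add (leqnn _) chb); rewrite -big_split /= /A big_seq [leqRHS]big_seq.
  apply: leq_sum => v; rewrite mem_iota add0n => /andP[_ vN].
  by have [] := has_hist_changed s a l wr vN.
have h3 : (((s.1 == a) && (l == [::])) <= 1)%N by case: (_ && _).
move: h1 h2 h3; move: (nat_of_bool _) => e h1 h2 h3.
rewrite ler_norml; apply/andP; split.
  by rewrite lerNl opprB lerBlDr -natrD ler_nat; lia.
by rewrite lerBlDr -natrD ler_nat; lia.
Qed.

End history_counts.

(** The difference [1 - (1 - q) ^ k] is [q] times a geometric sum whose [k] terms all tend to 1. *)
Lemma cvg_scaled_avoidance (R : realType) (q : nat -> R) (c : R) (k : nat) :
  (fun n => n%:R * q n) @ \oo --> c -> q @ \oo --> 0 ->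
  (fun n => n%:R * (1 - (1 - q n) ^+ k)) @ \oo --> k%:R * c.
Proof.
move=> nq q0.
have -> : (fun n => n%:R * (1 - (1 - q n) ^+ k)) =
    (fun n => (n%:R * q n) * \sum_(i < k) (1 - q n) ^+ i).
  apply/funext => n; rewrite -[X in X - _](expr1n _ k) subrXX opprB addrC subrK mulrA; congr (_ * _).
  by apply: eq_bigr => i _; rewrite expr1n mul1r.
have pc i : (fun n => (1 - q n) ^+ i) @ \oo --> (1 : R).
  elim: i => [|i IH]; first by under eq_fun do rewrite expr0; exact: cvg_cst.
  have H : (fun n => (1 - q n) * (1 - q n) ^+ i) @ \oo --> ((1 - 0) * 1 : R).
    by apply: cvgM => //; apply: cvgB => //; exact: cvg_cst.
  by rewrite subr0 mulr1 in H; under eq_fun do rewrite exprS.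
rewrite [X in _ --> X]mulrC; apply: cvgM => //.
have -> : k%:R = \sum_(i < k) 1 :> R by rewrite sumr_const card_ord.
exact: cvg_finsum.
Qed.

Lemma cvg_natV_scaled (R : realType) (q : nat -> R) (c : R) :
  (fun n => n%:R * q n) @ \oo --> c -> q @ \oo --> 0.
Proof.
move=> nq; have H : (fun n => n%:R^-1 * (n%:R * q n)) @ \oo --> 0 * c.
  apply: cvgM => //; rewrite -(cvg_shiftS (fun n => (n%:R : R)^-1)); exact: cvg_harmonic.
rewrite mul0r in H; apply: cvg_trans H; apply: near_eq_cvg; near=> n.
have n0 : n%:R != 0 :> R by rewrite pnatr_eq0 -lt0n; near: n; exists 1%N.
by rewrite mulrA mulVf// mul1r.
Unshelve. all: by end_near. Qed.

(** * Limits along one fixed trajectory *)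

Section limits.
Context (R : realType) (K : nat) (hK : (0 < K)%N).
Variables (pi : 'I_K -> R) (kappa : 'I_K -> 'I_K -> R) (m : 'I_K -> nat).
Hypothesis (pi_gt0 : forall a, 0 < pi a) (pi_sum : \sum_a pi a = 1).
Hypothesis (kappa_gt0 : forall a b, 0 < kappa a b) (m_ge1 : forall a, (1 <= m a)%N).
Variable (G0 : fmgraph K).
Hypothesis hG0 : seed_graph G0.

Local Notation arr := (arrival K).
Local Notation arrivals := (arrivals m G0).
Local Notation step_prob := (step_prob pi kappa m G0).
Local Notation eta := (Defs.eta pi kappa m).
Local Notation ph := (Defs.phi pi kappa m).
Local Notation mart := (mart step_prob arrivals).

Lemma phi_gt0 a b : 0 < ph a b.
Proof.
apply: mulr_gt0; first by rewrite mulr_gt0// ltr0n.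
apply: divr_gt0 => //.
by apply: (col_mass_gt0 hK kappa_gt0) => i; exact: eta_gt0.
Qed.

Variable (r_ : nat -> seq arr).
Hypothesis r0 : r_ 0%N = [::].
Hypothesis rS : forall n, exists s, r_ n.+1 = s :: r_ n.
Hypothesis rr : forall n, reachable arrivals (r_ n).
Hypothesis deg_mart : forall a,
  (fun n => mart (type_degree R hK G0 ^~ a) (r_ n) / n%:R) @ \oo --> 0.
Hypothesis hist_mart : forall a l,
  (fun n => mart (hist_count R hK G0 a l) (r_ n) / n%:R) @ \oo --> 0.

Lemma mart_rec (V : seq arr -> R) n :
  V (r_ n.+1) - mart V (r_ n.+1) = V (r_ n) - mart V (r_ n) + drift step_prob arrivals V (r_ n).
Proof. by have [s ->] := rS n; rewrite /=; ring. Qed.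

Lemma cvg_type_degree a : (fun n => type_degree R hK G0 (r_ n) a / n%:R) @ \oo --> 2 * eta a.
Proof.
apply: (@cvg_degree_proportion R K hK pi kappa m pi_gt0 kappa_gt0 m_ge1
  (fun n => type_degree R hK G0 (r_ n))
  (fun n a => mart (type_degree R hK G0 ^~ a) (r_ n)) (fun a => 2 * eta a)) => //.
- by move=> b; rewrite mulr_gt0// eta_gt0.
- by move=> b; rewrite mean_driftZ// -eta_critical.
- by move=> n b; exact: type_degree_ge0.
- by move=> n; apply: (sum_type_degree_gt0 R hK m_ge1 hG0); exact: reachable_wf (rr n).
- by move=> b; rewrite r0.
- by move=> n b; rewrite mart_rec type_degree_drift.
Qed.

Lemma cvg_total_weight b :
  (fun n => n%:R / total_weight hK kappa G0 (r_ n) b) @ \oo --> (2 * col_mass kappa eta b)^-1.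
Proof.
have H : (fun n => total_weight hK kappa G0 (r_ n) b / n%:R) @ \oo --> 2 * col_mass kappa eta b.
  have -> : 2 * col_mass kappa eta b = \sum_l kappa l b * (2 * eta l).
    by rewrite mulr_sumr; apply: eq_bigr => l _; rewrite mulrCA.
  under eq_fun do rewrite total_weight_type /col_mass mulr_suml.
  apply: cvg_finsum => l; under eq_fun do rewrite -mulrA.
  by apply: cvgM; [exact: cvg_cst|exact: cvg_type_degree].
under eq_fun do rewrite -[_ / _]invf_div.
apply: cvgV => //; rewrite mulf_neq0// gt_eqF//.
by apply: (col_mass_gt0 hK kappa_gt0) => i; exact: eta_gt0.
Qed.

(** Each edge hits the descendants with probability about [hist_weight / (2 n col_mass)]; this 2,
    from the limit [2 * eta] of the type degrees, halves the rates. *)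
Lemma cvg_loss a l : (fun n => n%:R * loss hK pi kappa m G0 a l (r_ n)) @ \oo --> total_rate ph m a l / 2.
Proof.
have E n : n%:R * loss hK pi kappa m G0 a l (r_ n) =
  \sum_b pi b * (n%:R * (1 - (1 - hist_weight kappa m a l b / total_weight hK kappa G0 (r_ n) b) ^+ m b)).
  rewrite [RHS](eq_bigr (fun b => n%:R * (pi b * 1 - pi b * (1 - hist_weight kappa m a l b / total_weight hK kappa G0 (r_ n) b) ^+ m b))).
    by rewrite -mulr_sumr sumrB -mulr_suml pi_sum mulr1.
  by move=> b _; ring.
under eq_fun do rewrite E.
have -> : total_rate ph m a l / 2 =
   \sum_b pi b * ((m b)%:R * (hist_weight kappa m a l b * (2 * col_mass kappa eta b)^-1)).
  rewrite /total_rate exchange_big /= mulr_suml; apply: eq_bigr => b _.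
  rewrite /hist_weight; move SbE : (col_mass kappa eta b) => Sb.
  rewrite !mulr_suml !mulr_sumr; apply: eq_bigr => i _.
  by rewrite /hrate /phi /nu -/(col_mass kappa eta b) SbE invfM; ring.
apply: cvg_finsum => b; apply: cvgM; first exact: cvg_cst.
have H : (fun n => n%:R * (hist_weight kappa m a l b / total_weight hK kappa G0 (r_ n) b)) @ \oo -->
   hist_weight kappa m a l b * (2 * col_mass kappa eta b)^-1.
  under eq_fun do rewrite mulrCA.
  by apply: cvgM; [exact: cvg_cst|exact: cvg_total_weight].
by apply: cvg_scaled_avoidance => //; exact: cvg_natV_scaled H.
Qed.

Lemma cvg_gain a l p b : (fun n => n%:R * gain hK pi kappa m G0 a l p b (r_ n)) @ \oo --> hrate ph m a l p b / 2.
Proof.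
pose hw := hist_weight kappa m a l b.
pose W n := total_weight hK kappa G0 (r_ n) b.
have W0 : (fun n => hw / W n) @ \oo --> 0.
  apply: (@cvg_natV_scaled _ _ (hw * (2 * col_mass kappa eta b)^-1)).
  under eq_fun do rewrite mulrCA.
  by apply: cvgM; [exact: cvg_cst|exact: cvg_total_weight].
pose hd : R := kappa (htype a l p) b * (hdegree m a l p)%:R.
have E n : n%:R * gain hK pi kappa m G0 a l p b (r_ n) =
    pi b * (m b)%:R * hd * (n%:R / W n) * (1 - hw / W n) ^+ (m b).-1.
  by rewrite /gain -/(W n) -/hw -/hd; ring.
under eq_fun do rewrite E.
have -> : hrate ph m a l p b / 2 = pi b * (m b)%:R * hd * (2 * col_mass kappa eta b)^-1 * 1.
  by rewrite /hrate /phi /nu -/(col_mass kappa eta b) invfM /hd; ring.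
apply: cvgM; first by apply: cvgM; [exact: cvg_cst|exact: cvg_total_weight].
elim: (m b).-1 => [|i IH]; first by under eq_fun do rewrite expr0; exact: cvg_cst.
have H : (fun n => (1 - hw / W n) * (1 - hw / W n) ^+ i) @ \oo --> ((1 - 0) * 1 : R).
  by apply: cvgM => //; apply: cvgB => //; exact: cvg_cst.
by rewrite subr0 mulr1 in H; under eq_fun do rewrite exprS.
Qed.

(** Only eventually: for a history not realised in the graph, the nominal [hist_weight] may exceed
    [total_weight] at early times. *)
Lemma near_loss01 a l : \forall n \near \oo, 0 <= loss hK pi kappa m G0 a l (r_ n) <= 1.
Proof.
pose q b n := hist_weight kappa m a l b / total_weight hK kappa G0 (r_ n) b.
have q1 : \forall n \near \oo, forall b, q b n <= 1.
  apply: (@filter_forall _ _ _ (nbhs \oo)) => b.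
  have H : q b @ \oo --> 0.
    apply: (@cvg_natV_scaled _ _ (hist_weight kappa m a l b * (2 * col_mass kappa eta b)^-1)).
    under eq_fun do rewrite mulrCA.
    by apply: cvgM; [exact: cvg_cst|exact: cvg_total_weight].
  near=> n; apply: ltW; near: n; exact: (@cvgr_lt _ _ _ _ _ _ H 1).
near=> n; have q1n : forall b, q b n <= 1 by near: n.
have q0 b : 0 <= q b n.
  apply: divr_ge0; last exact/ltW/(total_weight_gt0 hK kappa_gt0 m_ge1 hG0)/(reachable_wf (rr n)).
  by apply: sumr_ge0 => i _; rewrite mulr_ge0// ltW.
have p01 b : 0 <= (1 - q b n) ^+ m b <= 1.
  by rewrite exprn_ge0 ?subr_ge0//= exprn_ile1 ?subr_ge0// gerBl.
rewrite /loss subr_ge0 lerBlDr lerDl; apply/andP; split.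
  rewrite -[leRHS]pi_sum; apply: ler_sum => b _; have /andP[_ p1] := p01 b.
  by rewrite -[leRHS]mulr1 ler_pM2l.
by apply: sumr_ge0 => b _; have /andP[p0 _] := p01 b; rewrite mulr_ge0// ltW.
Unshelve. all: by end_near. Qed.

(** By induction on the history, whose count solves a linear recursion fed by the count of its
    predecessor; the limit [a0 / (1 + lam)] is the recursive clause of [hist_law]. *)
Lemma cvg_hist_count a l :
  (fun n => hist_count R hK G0 a l (r_ n) / n%:R) @ \oo --> hist_law pi ph m a l.
Proof.
elim: l => [|e l IH].
  apply: (@cvg_linear_growth _ _ (fun n => mart (hist_count R hK G0 a [::]) (r_ n)) (fun=> pi a)
    (fun n => loss hK pi kappa m G0 a [::] (r_ n))) => //.
  - by rewrite divr_ge0// total_rate_ge0// => ? ?; exact: phi_gt0.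
  - by move=> n; rewrite mart_rec hist_count_drift// addrA.
  - exact: near_loss01.
  - exact: cvg_cst.
  - exact: cvg_loss.
apply: (@cvg_linear_growth _ _ (fun n => mart (hist_count R hK G0 a (e :: l)) (r_ n))
    (fun n => if (e.1 <= size l)%N then gain hK pi kappa m G0 a l e.1 e.2 (r_ n) * hist_count R hK G0 a l (r_ n) else 0)
    (fun n => loss hK pi kappa m G0 a (e :: l) (r_ n))) => //.
- by rewrite divr_ge0// total_rate_ge0// => ? ?; exact: phi_gt0.
- by move=> n; rewrite mart_rec hist_count_drift// addrA.
- exact: near_loss01.
- case: ifP => _; last exact: cvg_cst.
  have H : (fun n => (n%:R * gain hK pi kappa m G0 a l e.1 e.2 (r_ n)) * (hist_count R hK G0 a l (r_ n) / n%:R)) @ \oo -->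
    hrate ph m a l e.1 e.2 / 2 * hist_law pi ph m a l.
    by apply: cvgM => //; exact: cvg_gain.
  apply: cvg_trans H; apply: near_eq_cvg; near=> n.
  have n0 : n%:R != 0 :> R by rewrite pnatr_eq0 -lt0n; near: n; exists 1%N.
  by field.
- exact: cvg_loss.
Unshelve. all: by end_near. Qed.

End limits.

(** * Local weak averages *)

(** Exploration follows incoming edges only, so an embedding whose image is closed under them
    captures every ball around the root, whatever else [g] contains. *)
Lemma iso_U_of_closed_embedding (K : nat) (h g : Defs.rgraph K) (f : h -> g) (k : nat) :
  injective f -> f groot = groot -> (forall v, mark (f v) = mark v) ->
  (forall u v, mult (f u) (f v) = mult u v) ->
  (forall x v, (0 < mult x (f v))%N -> exists u, x = f u) ->
  iso (U k h) (U k g).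
Proof.
move=> finj froot fmark fmult fclosed.
have wimg j x : Defs.within j x -> exists u, x = f u.
  elim: j x => [x ->|j IH x /= [/IH//|[w /IH[u ->] xw]]]; first by exists groot.
  exact: fclosed xw.
have wE j v : Defs.within j (f v) <-> Defs.within j v.
  elim: j v => [|j IH] v /=.
    by rewrite -froot; split => [/finj|->].
  split=> [[/IH vw|[w ww vw]]|[/IH vw|[w ww vw]]]; [by left| |by left|].
    right; have [u uw] := wimg _ _ ww; exists u; first by apply/IH; rewrite -uw.
    by rewrite -fmult -uw.
  by right; exists (f w); [exact/IH|rewrite fmult].
pose F (v : U k h) : U k g := exist _ (f (sval v)) ((wE k (sval v)).2 (svalP v)).
have Fsurj (y : U k g) : exists x, F x = y.
  case: y => y wy; have [u uy] := wimg _ _ wy.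
  have wu : Defs.within k u by apply/wE; rewrite -uy.
  by exists (exist _ u wu); apply: eq_exist; rewrite /= uy.
have Finj : injective F.
  by move=> [u wu] [v wv] /(congr1 sval) /= /finj uv; apply: eq_exist.
have [F' F'K] := choice Fsurj.
exists F; split.
- by exists F' => // x; apply: Finj.
- exact: eq_exist.
- by move=> v; exact: fmark.
- move=> u v /=.
  have -> : `[< exists2 j, (j < k)%N & Defs.within j (f (sval v)) >] =
      `[< exists2 j, (j < k)%N & Defs.within j (sval v) >].
    by apply: asbool_equiv_eq; split => -[j jk /wE jv]; exists j.
  by case: ifP => // _; exact: fmult.
Qed.

Lemma to_Gstar_eq (R : realType) (K : nat) (g h : lfgraph K) :
  (forall k, iso (U k g) (U k h)) -> to_Gstar R g = to_Gstar R h.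
Proof.
move=> gh; apply/(@eqmodP _ (@dloc0_equiv_rel R K)).
rewrite /= /dloc0 /dloc; case: pselect => // e; exfalso.
by case: e => k /andP[_ /asboolP]; apply.
Qed.

Section desc_graph.
Context (R : realType) (K : nat) (hK : (0 < K)%N) (m : 'I_K -> nat) (G0 : fmgraph K).

Definition hist_graph (a : 'I_K) (l : seq (nat * 'I_K)) : lfgraph K :=
  @rooted_at K (hgraph a l) ord0.

(** Positions in the history embed as the descendants of [v], and by [desc_mult] no edge enters them
    from outside. *)
Lemma rooted_desc (r : seq (arrival K)) (v : 'I_(size_fg (rgrow G0 r))) a l :
  wf m G0 r -> has_hist hK G0 r a l v ->
  to_Gstar R (rooted_at v) = to_Gstar R (hist_graph a l).
Proof.
move=> wr; rewrite /has_hist => /andP[/eqP va].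
case E : (desc G0 r v) => [[D l']|//] /eqP ll; rewrite {}ll in E.
have vN : (v < vcount G0 r)%N by rewrite -size_rgrow.
have Sp := desc_specP hK wr vN E.
apply/esym/to_Gstar_eq => k.
have Dlt (i : {i : nat | (i < (size l).+1)%N}) : (nth 0%N D (sval i) < size_fg (rgrow G0 r))%N.
  rewrite size_rgrow; apply: (allP (desc_lt Sp)); apply: mem_nth.
  by rewrite (desc_size Sp); exact: svalP i.
pose f (i : rooted_rgraph (ord0 : 'I_(size_fg (hgraph a l)))) : rooted_rgraph v := exist (fun j => is_true (j < size_fg (rgrow G0 r))%N) (nth 0%N D (sval i)) (Dlt i).
have iD (i : {i : nat | (i < (size l).+1)%N}) : (sval i < size D)%N.
  by rewrite (desc_size Sp); exact: svalP i.
apply: (@iso_U_of_closed_embedding K _ _ f k).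
- move=> i j /(congr1 sval) /= /eqP; rewrite nth_uniq ?iD ?(desc_uniq Sp)// => /eqP ij.
  by case: i j ij => [i hi] [j hj] /= ij; apply: eq_exist.
- by apply: eq_exist; rewrite /= (desc_root Sp).
- by move=> i /=; rewrite rgrow_mark /= (desc_type Sp)// ?iD// va.
- move=> i j /=; rewrite rgrow_mult /= (desc_mult Sp) ?iD//.
  by rewrite mem_nth ?iD//= index_uniq ?iD// (desc_uniq Sp).
- move=> x j /=; rewrite rgrow_mult /= (desc_mult Sp) ?iD//.
  case: (boolP (sval x \in D)) => [xD _|//].
  have ix : (index (sval x) D < (size l).+1)%N by rewrite -(desc_size Sp) index_mem.
  exists (exist (fun j => is_true (j < (size l).+1)%N) _ ix); case: x xD ix => x hx /= xD ix.
  by apply: eq_exist; rewrite /= nth_index.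
Qed.

End desc_graph.

Section averages.
Context (R : realType) (K : nat) (hK : (0 < K)%N) (m : 'I_K -> nat) (G0 : fmgraph K).

Definition hist_upto N : seq (seq (nat * 'I_K)) := flatten [seq histories K k | k <- iota 0 N.+1].

Lemma mem_hist_upto N l : l \in hist_upto N -> (size l <= N)%N.
Proof.
by case/flattenP => s /mapP[k]; rewrite mem_iota add0n ltnS => /andP[_ kN] -> /mem_histories[-> _].
Qed.

Lemma hist_uptoS N : hist_upto N.+1 = hist_upto N ++ histories K N.+1.
Proof.
by rewrite /hist_upto -[in iota 0 N.+2]addn1 iotaD map_cat flatten_cat [flatten [seq _ | _ <- iota (0 + _) 1]]/= cats0.
Qed.

Lemma hist_upto_uniq N : uniq (hist_upto N).
Proof.
elim: N => [|N IH]; first by rewrite /hist_upto /=.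
rewrite hist_uptoS cat_uniq IH histories_uniq andbT /=.
apply/hasPn => l lh; have [sl _] := @mem_histories K N.+1 l lh.
by apply/negP => /mem_hist_upto; rewrite sl ltnn.
Qed.

Lemma big_hist_upto N (F : seq (nat * 'I_K) -> R) :
  \sum_(l <- hist_upto N) F l = \sum_(0 <= k < N.+1) \sum_(l <- histories K k) F l.
Proof. by rewrite /hist_upto big_flatten big_map -iota_index. Qed.

Definition graph_average (f : Gstar R K -> R) (G : fmgraph K) : R :=
  (size_fg G)%:R^-1 * \sum_(v < size_fg G) f (to_Gstar R (rooted_at v)).

(** A vertex with a listed history contributes exactly its term and any other at most [M], so the
    error is [M] times the uncovered fraction. *)
Lemma graph_average_approx (f : Gstar R K -> R) (M : R) r N : (forall x, `|f x| <= M) -> wf m G0 r ->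
  `|graph_average f (rgrow G0 r) -
    (vcount G0 r)%:R^-1 * \sum_a \sum_(l <- hist_upto N) hist_count R hK G0 a l r * f (to_Gstar R (hist_graph a l))|
  <= M * (1 - (vcount G0 r)%:R^-1 * \sum_a \sum_(l <- hist_upto N) hist_count R hK G0 a l r).
Proof.
move=> fM wr.
have M0 : 0 <= M by exact: le_trans (normr_ge0 _) (fM (to_Gstar R (hist_graph (Ordinal hK) [::]))).
pose hh a l v : R := (has_hist hK G0 r a l v)%:R.
have cE a l : hist_count R hK G0 a l r = \sum_(v < size_fg (rgrow G0 r)) hh a l v.
  rewrite (big_rgrow _ _ r (hh a l)) -iota_index /hist_count -sum1_count natr_sum big_mkcond.
  by apply: eq_bigr => v _; rewrite /hh; case: has_hist.
have sumE (g : 'I_K -> seq (nat * 'I_K) -> R) :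
  \sum_a \sum_(l <- hist_upto N) hist_count R hK G0 a l r * g a l =
  \sum_(v < size_fg (rgrow G0 r)) \sum_a \sum_(l <- hist_upto N) hh a l v * g a l.
  rewrite [RHS]exchange_big; apply: eq_bigr => a _; rewrite [RHS]exchange_big; apply: eq_bigr => l _.
  by rewrite cE mulr_suml.
have gE : graph_average f (rgrow G0 r) = (vcount G0 r)%:R^-1 *
    \sum_(v < size_fg (rgrow G0 r)) f (to_Gstar R (rooted_at v)).
  by congr (_%:R^-1 * _); exact: size_rgrow.
rewrite gE; have [s0|s0] := posnP (vcount G0 r).
  by rewrite s0 invr0 !mul0r subrr normr0 subr0 mulr1.
have sV : 0 < (vcount G0 r)%:R^-1 :> R by rewrite invr_gt0 ltr0n.
rewrite -mulrBr normrM gtr0_norm//.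
have -> : M * (1 - (vcount G0 r)%:R^-1 * \sum_a \sum_(l <- hist_upto N) hist_count R hK G0 a l r) =
   (vcount G0 r)%:R^-1 * \sum_(v < size_fg (rgrow G0 r)) M * (1 - \sum_a \sum_(l <- hist_upto N) hh a l v).
  under [in LHS]eq_bigr do under eq_bigr do rewrite -[hist_count _ _ _ _ _ _]mulr1.
  rewrite (sumE (fun _ _ => 1)) -mulr_sumr sumrB sumr_const card_ord size_rgrow.
  under [in LHS]eq_bigr do under eq_bigr do under eq_bigr do rewrite mulr1.
  rewrite mulrCA; congr (_ * _); rewrite mulrBr -[1 *+ _]/(_%:R) mulVf// pnatr_eq0 -lt0n//.
rewrite ler_pM2l// sumE -sumrB; apply: le_trans (ler_norm_sum _ _ _) _; apply: ler_sum => v _.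
have wv a l : has_hist hK G0 r a l v -> to_Gstar R (rooted_at v) = to_Gstar R (hist_graph a l).
  by move=> hv; exact: (rooted_desc R wr hv).
have [[a [l [lN hv]]]|no] := pselect (exists a l, l \in hist_upto N /\ has_hist hK G0 r a l v).
  have uniq_hist a' l' : has_hist hK G0 r a' l' v -> a' = a /\ l' = l.
    move: hv; rewrite /has_hist; case: desc => [[D l0]|]; last by rewrite !andbF.
    by move=> /andP[/eqP <- /eqP <-] /andP[/eqP <- /eqP <-].
  have sumhh (g : 'I_K -> seq (nat * 'I_K) -> R) :
      \sum_a \sum_(l <- hist_upto N) hh a l v * g a l = g a l.
    rewrite (bigD1 a)//= (bigD1_seq l) ?hist_upto_uniq//= /hh hv mul1r.
    rewrite [X in _ + X + _]big1 => [|l' /negPf ll]; last first.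
      by case E : has_hist; rewrite ?mul0r//; have [_ l'l] := uniq_hist _ _ E; rewrite l'l eqxx in ll.
    rewrite big1 ?addr0// => a' /negPf aa; rewrite big1// => l' _.
    by case E : has_hist; rewrite ?mul0r//; have [a'a _] := uniq_hist _ _ E; rewrite a'a eqxx in aa.
  rewrite sumhh (wv a l hv) subrr normr0 mulr_ge0// subr_ge0.
  under eq_bigr do under eq_bigr do rewrite -[hh _ _ _]mulr1.
  by rewrite (sumhh (fun _ _ => 1)).
have hh0 a l : l \in hist_upto N -> hh a l v = 0.
  by move=> lN; rewrite /hh; case E : has_hist => //; exfalso; apply: no; exists a, l.
rewrite [X in `|_ - X|]big1 => [|a _]; last first.
  by rewrite big_seq big1// => l lN; rewrite hh0// mul0r.
rewrite [X in 1 - X]big1 => [|a _]; last by rewrite big_seq big1// => l lN; rewrite hh0.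
by rewrite !subr0 mulr1.
Qed.

End averages.

(** * Histories in the branching process *)

Section ancestries.
Context (K : nat).
Local Notation births := (seq (nat * 'I_K)).
Implicit Types (l : births) (i j p : nat).

(** Translates the order of birth into the labels by ancestry of the branching process: a newborn is
    numbered by the children its parent already has. *)
Fixpoint ancestry l i : seq nat :=
  if l is e :: l' then
    if i == (size l').+1 then nkids l' e.1 :: ancestry l' e.1 else ancestry l' i
  else [::].

Record ancestry_spec l : Prop := AncestrySpec {
  as_root : ancestry l 0 = [::];
  as_parent : forall i, (i <= size l)%N -> (0 < i)%N ->
    exists2 k, ancestry l i = k :: ancestry l (hparent l i) & (k < nkids l (hparent l i))%N;
  as_child : forall i k, (i <= size l)%N -> (k < nkids l i)%N ->
    exists2 j, (j <= size l)%N & ancestry l j = k :: ancestry l i;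
  as_inj : forall i j, (i <= size l)%N -> (j <= size l)%N ->
    ancestry l i = ancestry l j -> i = j }.

Lemma ancestry_specP l : hvalid l -> ancestry_spec l.
Proof.
elim: l => [_|[p b] l IH /= /andP[pl vl]].
  split => //=.
  - by move=> [].
  - by move=> [|i] [].
have [Rt Pa Ch Inj] := IH vl.
have ne i : (i <= size l)%N -> (i == (size l).+1) = false.
  by move=> il; rewrite ltn_eqF.
have pne : (p == (size l).+1) = false by rewrite ltn_eqF// ltnS.
split => /=.
- exact: Rt.
- move=> i; rewrite leq_eqVlt ltnS; case: eqP => [-> _ _|_ /= il i0].
    exists (nkids l p); first by rewrite ne.
    by rewrite /nkids /= eqxx add1n ltnS.
  have [k E1 E2] := Pa i il i0; exists k.
    by rewrite E1 ne// ltnW// (leq_trans (hparent_lt vl i0)).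
  by rewrite /nkids /= -/(nkids l _) (leq_trans E2)// leq_addl.
- move=> i k; rewrite leq_eqVlt ltnS /nkids /= -/(nkids l i); case: eqP => [-> _|_ /= il].
    by rewrite nkids_out// pne.
  move=> ki; have [ki'|ki'] := ltnP k (nkids l i).
    have [j jl Ej] := Ch i k il ki'; exists j; first exact: ltnW.
    by rewrite ne.
  move: ki; case: eqP => [pi1|_]; last by rewrite ltnNge ki'.
  rewrite add1n ltnS => ki; exists (size l).+1 => //; rewrite eqxx pi1; congr cons.
  by apply/eqP; rewrite eqn_leq ki ki'.
(* The newborn's number exceeds those of its elder siblings, so its label is new. *)
- have new j : (j <= size l)%N -> nkids l p :: ancestry l p <> ancestry l j.
    move=> jl; have [->|j0] := posnP j; first by rewrite Rt.
    have [k -> kp] := Pa j jl j0; case=> kE lE.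
    have hp : (hparent l j <= size l)%N by rewrite (leq_trans _ jl)// ltnW// hparent_lt.
    by rewrite -(Inj _ _ pl hp lE) -kE ltnn in kp.
  move=> i j; rewrite (leq_eqVlt i) (leq_eqVlt j) !ltnS.
  case: (i =P (size l).+1) => [-> _|_ /= il]; case: (j =P (size l).+1) => [-> _|_ /= jl] //.
  + by move/(new _ jl).
  + by move/esym/(new _ il).
  + exact: Inj.
Qed.

End ancestries.

Section tree_history.
Context (R : realType) (K : nat) (hK : (0 < K)%N).
Variables (phi : 'I_K -> 'I_K -> R) (m : 'I_K -> nat).
Hypothesis (phi_gt0 : forall a b, 0 < phi a b) (m_ge1 : forall a, (1 <= m a)%N).
Variables (a : 'I_K) (E : seq nat -> nat -> 'I_K -> R).

Local Notation births := (seq (nat * 'I_K)).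
Implicit Types (l : births) (b : 'I_K) (i j p : nat).
Local Notation itype := (itype phi m a E).
Local Notation birth := (birth phi m a E).
Local Notation wait := (wait phi m a E).
Local Notation alive := (alive phi m a E).

Definition hclock l i b : R := E (ancestry l i) (nkids l i) b / hrate phi m a l i b.

(* Time of the last event that restarted the clocks of the [i]-th individual. *)
Fixpoint restart l i : R :=
  if l is e :: l' then
    if (i == e.1) || (i == (size l').+1)
    then restart l' e.1 + hclock l' e.1 e.2 else restart l' i
  else 0.

Definition ring_time l i b : R := restart l i + hclock l i b.

Definition last_birth l : R := if l is e :: l' then ring_time l' e.1 e.2 else 0.

(** At a birth only clocks of the same parent are compared. Those of the others keep running, and
    their own later ring or the survival condition of [history_at] shows that they had not rung. *)
Fixpoint born_in_order l : Prop :=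
  if l is e :: l' then
    [/\ born_in_order l', last_birth l' < ring_time l' e.1 e.2 &
        forall b, b != e.2 -> ring_time l' e.1 e.2 < ring_time l' e.1 b]
  else True.

Definition history_at (t : R) l : Prop :=
  [/\ born_in_order l, last_birth l < t &
      forall i b, (i <= size l)%N -> t < ring_time l i b].

Lemma hrate_gt0 l i b : 0 < hrate phi m a l i b.
Proof. by rewrite mulr_gt0// ltr0n /hdegree ltn_addl. Qed.

Lemma restart_le l i : born_in_order l -> restart l i <= last_birth l.
Proof.
elim: l i => //= e l IH i [ol lt _]; case: ifP => // _.
by apply: le_trans (IH i ol) _; exact: ltW.
Qed.

Lemma last_birth_ge0 l : born_in_order l -> 0 <= last_birth l.
Proof.
by elim: l => //= e l IH [/IH l0 lt _]; apply: le_trans l0 _; exact: ltW.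
Qed.

Record tree_spec l : Prop := TreeSpec {
  ts_type : forall i, (i <= size l)%N -> itype (ancestry l i) = htype a l i;
  ts_restart : forall i, (i <= size l)%N ->
    birth (ancestry l i) + \sum_(j < nkids l i) wait (ancestry l i) j = restart l i;
  ts_birth : forall i, (i <= size l)%N -> birth (ancestry l i) <= last_birth l }.

Lemma clock_hclock l i b : itype (ancestry l i) = htype a l i ->
  clock phi m E (ancestry l i) (nkids l i) (itype (ancestry l i)) b = hclock l i b.
Proof. by move=> ->. Qed.

Lemma tree_specP l : hvalid l -> born_in_order l -> tree_spec l.
Proof.
elim: l => [_ _|[p b] l IH /= /andP[pl vl] [ol lt win]].
  split => //=.
  - by move=> [] // _; rewrite big_ord0 addr0.
have [Ty Re Bi] := IH vl ol.
have ty : itype (nkids l p :: ancestry l p) = b.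
  rewrite /=; case: arg_minP => //= b' _ min; apply/eqP; apply: contraT => bb'.
  have := win b' bb'; rewrite /ring_time ltrD2l -!(clock_hclock _ (Ty p pl)).
  by rewrite ltNge min.
have wt : wait (ancestry l p) (nkids l p) = hclock l p b.
  by rewrite /wait ty clock_hclock// Ty.
have bt : birth (nkids l p :: ancestry l p) = ring_time l p b.
  by rewrite /= big_ord_recr /= addrA Re// wt.
have pne : (p == (size l).+1) = false by rewrite ltn_eqF// ltnS.
split => /=.
- move=> i; rewrite leq_eqVlt ltnS; case: eqP => [-> _|_ /= il]; first by rewrite ty.
  exact: Ty.
- move=> i; rewrite leq_eqVlt ltnS /nkids /= -/(nkids l i); case: eqP => [-> _|_ /= il].
    rewrite bt nkids_out// pne big_ord0 addr0 orbT.
    by rewrite /ring_time.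
  rewrite orbF eq_sym; case: eqP => [ip|_]; last exact: Re.
  by rewrite ip add1n big_ord_recr /= addrA Re// wt.
- move=> i; rewrite leq_eqVlt ltnS; case: eqP => [-> _|_ /= il]; first by rewrite bt.
  by apply: le_trans (Bi _ il) _; exact: ltW.
Qed.

Hypothesis E_ge0 : forall u k b, 0 <= E u k b.

Lemma wait_ge0 u k : 0 <= wait u k.
Proof. by rewrite /wait /clock divr_ge0// mulr_ge0// ltW. Qed.

Lemma alive_history t l u : hvalid l -> history_at t l ->
  alive t u <-> exists2 i, (i <= size l)%N & u = ancestry l i.
Proof.
move=> vl [ol lt surv]; have [Ty Re Bi] := tree_specP vl ol.
have [Rt Pa Ch Inj] := ancestry_specP vl.
split=> [|[i il ->]]; last first.
  by rewrite /alive (le_trans (Bi i il) (ltW lt)) orbT.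
elim: u => [_|k v IH]; first by exists 0%N.
rewrite /alive /= => bt.
have [i il vi] : exists2 i, (i <= size l)%N & v = ancestry l i.
  apply: IH; rewrite /alive; apply/orP; right; apply: le_trans bt.
  by rewrite lerDl sumr_ge0// => j _; exact: wait_ge0.
have [ki|ki] := ltnP k (nkids l i).
  by have [j jl Ej] := Ch i k il ki; exists j => //; rewrite Ej vi.
(* A child beyond the recorded ones is born no earlier than the next ring of its parent's clocks,
   which falls after [t]. *)
exfalso; pose b0 := itype (nkids l i :: ancestry l i).
have wE : wait (ancestry l i) (nkids l i) = hclock l i b0 by rewrite /wait clock_hclock ?Ty.
have := surv i b0 il; apply/negP; rewrite -leNgt.
apply: le_trans bt; rewrite /ring_time -Re// -wE vi -addrA lerD2l.
rewrite -(big_mkord xpredT (fun j => wait (ancestry l i) j)).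
rewrite -(big_mkord xpredT (fun j => wait (ancestry l i) j)).
rewrite (big_cat_nat _ (n := (nkids l i).+1) (p := k.+1))//= big_nat_recr//=.
by rewrite lerDl sumr_ge0// => j _; exact: wait_ge0.
Qed.

(** The labels put the living individuals in bijection with the positions of the history; the tree
    is finite, so [family_tree] takes its locally finite branch. *)
Lemma family_tree_history t l : hvalid l -> history_at t l ->
  to_Gstar R (family_tree phi m a E t) = to_Gstar R (hist_graph a l).
Proof.
move=> vl ht; have [ol lt surv] := ht.
have [Ty Re Bi] := tree_specP vl ol.
have [Rt Pa Ch Inj] := ancestry_specP vl.
have al (i : {i : nat | (i < (size l).+1)%N}) : alive t (ancestry l (sval i)).
  by apply/(alive_history _ vl ht); exists (sval i) => //; rewrite -ltnS; exact: svalP i.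
pose f (i : rooted_rgraph (ord0 : 'I_(size_fg (hgraph a l)))) : tree_rgraph phi m a E t :=
  exist (fun u => is_true (alive t u)) _ (al i).
have fsurj x : exists z, x = f z.
  case: x => u hu; have /(alive_history _ vl ht)[i il ui] := hu.
  exists (exist (fun j => is_true (j < (size l).+1)%N) i il).
  exact: eq_exist.
have lf : locally_finite (tree_rgraph phi m a E t).
  have fin (S : set (tree_rgraph phi m a E t)) : finite_set S.
    pose g (i : 'I_(size l).+1) := f (exist (fun j => is_true (j < (size l).+1)%N) (val i) (ltn_ord i)).
    apply: (@sub_finite_set _ _ (g @` setT)); last exact/finite_image/finite_finset.
    move=> x _; have [[i il] ->] := fsurj x; exists (Ordinal il) => //.
    by rewrite /g; congr f; apply: eq_exist.
  by move=> v; split; exact: fin.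
have -> : family_tree phi m a E t = LFGraph lf.
  rewrite /family_tree; case: pselect => [lf'|//].
  by rewrite (Prop_irrelevance lf' lf).
apply/esym/to_Gstar_eq => k; apply: (@iso_U_of_closed_embedding K _ _ f k).
- move=> [i il] [j jl] /(congr1 sval) /= /Inj ij.
  by apply: eq_exist; apply: ij.
- by apply: eq_exist; rewrite /= Rt.
- by move=> [i il] /=; rewrite Ty.
- move=> [i il] [j jl] /=.
  case: (posnP i) => [->|i0]; first by rewrite Rt.
  have [k' -> _] := Pa i il i0.
  have pl : (hparent l i <= size l)%N by rewrite (leq_trans _ (il : (i <= size l)%N))// ltnW// hparent_lt.
  congr nat_of_bool; apply/eqP/eqP => [/Inj|->//].
  by apply.
- by move=> x i _; exact: fsurj.
Qed.

(** Seen from the prefix [l1], the next birth is the strict minimum over all running clocks: clocks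
    of individuals other than the parent are not restarted by it, so their inequality for [e :: l1]
    transfers back. *)
Lemma history_next t l2 l1 : hvalid (l2 ++ l1) -> history_at t (l2 ++ l1) ->
  [/\ born_in_order l1, last_birth l1 < t,
      forall i b, (i <= size l1)%N -> last_birth l1 < ring_time l1 i b &
      forall e l3, l2 = rcons l3 e -> [/\ (e.1 <= size l1)%N, ring_time l1 e.1 e.2 < t &
        forall i b, (i <= size l1)%N -> (i, b) != e -> ring_time l1 e.1 e.2 < ring_time l1 i b]].
Proof.
elim/last_ind: l2 l1 => [|l3 e IH] l1.
  rewrite cat0s => vl [ol lt surv]; split => // [i b il|e [|x l3] //].
  exact: lt_trans lt (surv _ _ il).
rewrite cat_rcons => vl ht; have [[ol lt win] tl pend _] := IH _ vl ht.
have /andP[el vl1] : hvalid (e :: l1).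
  by elim: (l3) vl => //= e' l' IHl /andP[_ /IHl].
have next i b : (i <= size l1)%N -> (i, b) != e -> ring_time l1 e.1 e.2 < ring_time l1 i b.
  move=> il; case: (i =P e.1) => [-> ne|/eqP ie _].
    by apply: win; apply: contra ne => /eqP ->; rewrite -surjective_pairing.
  have ine : (i == (size l1).+1) = false by rewrite ltn_eqF.
  have := pend i b (leqW il); rewrite /ring_time /= (negbTE ie) ine.
  rewrite /hclock /= ine /hrate /hdegree /= ine.
  by rewrite /nkids /= eq_sym (negbTE ie).
split => // [|i b il|e' l' /rcons_inj[_ <-]]; last by split.
  exact: lt_trans lt tl.
have [/eqP|ne] := boolP ((i, b) == e); last exact: lt_trans lt (next _ _ il ne).
by case: e lt {win tl pend next IH ht vl el vl1 ol} => p b' /= lt [-> ->].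
Qed.

(** Read from the oldest birth on, the birth that follows a common prefix is the strict minimizer of
    the ring times, hence the same in both. This makes the history events disjoint. *)
Lemma history_unique t l l' : hvalid l -> hvalid l' ->
  history_at t l -> history_at t l' -> l = l'.
Proof.
suff H l2 l2' l1 : hvalid (l2 ++ l1) -> hvalid (l2' ++ l1) ->
    history_at t (l2 ++ l1) -> history_at t (l2' ++ l1) -> l2 = l2'.
  by move=> vl vl' hl hl'; apply: (H l l' [::]); rewrite cats0.
elim/last_ind: l2 l2' l1 => [|l3 e IH]; elim/last_ind => [|l3' e' _] l1 vl vl' hl hl' //.
- have [_ _ _ /(_ _ _ erefl)[el et _]] := history_next vl' hl'.
  have [_ _ /(_ e'.1 e'.2 el)] := hl.
  by rewrite ltNge (ltW et).
- have [_ _ _ /(_ _ _ erefl)[el et _]] := history_next vl hl.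
  have [_ _ /(_ e.1 e.2 el)] := hl'.
  by rewrite ltNge (ltW et).
- have [_ _ _ /(_ _ _ erefl)[el et en]] := history_next vl hl.
  have [_ _ _ /(_ _ _ erefl)[el' et' en']] := history_next vl' hl'.
  have ee : e = e'.
    apply/eqP; apply: contraT => ne.
    have := en e'.1 e'.2 el'; rewrite -surjective_pairing eq_sym => /(_ ne) h1.
    have := en' e.1 e.2 el; rewrite -surjective_pairing => /(_ ne) h2.
    by have := lt_trans h1 h2; rewrite ltxx.
  subst e'; congr rcons; apply: (IH l3' (e :: l1)); by rewrite -?cat_rcons.
Qed.

End tree_history.

(** * Integrals of independent exponential variables *)

Section independent_integral.
Context (d d1 d2 : measure_display) (Omega : measurableType d) (T1 : measurableType d1)
  (T2 : measurableType d2) (R : realType).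
Variables (mu : {finite_measure set Omega -> \bar R}) (m1 : probability T1 R).
Variables (X : Omega -> T1) (Y : Omega -> T2).
Hypotheses (mX : measurable_fun setT X) (mY : measurable_fun setT Y).
Hypothesis ind : forall D H, measurable D -> measurable H ->
  mu (X @^-1` D `&` Y @^-1` H) = (m1 D * mu (Y @^-1` H))%E.

Let m2 : {measure set T2 -> \bar R} := measure_function_pushforward__canonical__measure_function_Measure mu mY.

Let m2_fin : fin_num_fun m2.
Proof.
move=> U mU; apply: (fin_num_measure mu).
by rewrite -[X in measurable X]setTI; exact: mY.
Qed.

(** A named copy of the image measure of [Y], to carry the finiteness used for the product
    measure. *)
Definition image_measure := (m2 : set T2 -> \bar R).

HB.instance Definition _ := Measure.on image_measure.
HB.instance Definition _ := @Measure_isFinite.Build _ _ _ image_measure m2_fin.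

(** Agreement on rectangles identifies the law of the pair with a product measure, and Tonelli's
    theorem integrates [X] out first. *)
Lemma integral_independent (g : (T1 * T2)%type -> \bar R) :
  measurable_fun [set: (T1 * T2)%type] g -> (forall z, 0 <= g z)%E ->
  (\int[mu]_w g (X w, Y w) = \int[mu]_w \int[m1]_x g (x, Y w))%E.
Proof.
move=> mg g0.
have mXY : measurable_fun setT (fun w => (X w, Y w)) by exact/measurable_fun_pair.
pose m' : {measure set (T1 * T2) -> \bar R} :=
  measure_function_pushforward__canonical__measure_function_Measure mu mXY.
have E1 : (\int[m']_z g z = \int[mu]_w g (X w, Y w))%E.
  by rewrite ge0_integral_pushforward//.
have E2 : (\int[m']_z g z = \int[m1 \x image_measure]_z g z)%E.
  apply: eq_measure_integral => D mD _; apply/esym.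
  by apply: (@product_measure_unique _ _ _ _ R m1 image_measure m').
rewrite -E1 E2 fubini_tonelli2//.
have mG : measurable_fun setT (fubini_G m1 g) by exact: measurable_fun_fubini_tonelli_G.
have G0 y : (0 <= fubini_G m1 g y)%E by exact: integral_ge0.
have := @ge0_integral_pushforward _ _ _ _ R Y mY mu setT (fubini_G m1 g) measurableT mG.
rewrite preimage_setT; apply; by move=> y _.
Qed.
End independent_integral.

Section density.
Context (d : measure_display) (T : measurableType d) (R : realType).
Variables (mu nu : {measure set T -> \bar R}) (p : T -> \bar R).
Hypotheses (mp : measurable_fun setT p) (p0 : forall x, (0 <= p x)%E) (p_fin : forall x, p x \is a fin_num).
Hypothesis nuE : forall A, measurable A -> (nu A = \int[mu]_(x in A) p x)%E.

Import HBNNSimple.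
Local Open Scope ereal_scope.

Let integral_density_nnsfun (g : {nnsfun T >-> R}) :
  \int[nu]_x (g x)%:E = \int[mu]_x ((g x)%:E * p x).
Proof.
under [LHS]eq_integral do rewrite fimfunE -fsumEFin//.
rewrite [LHS]ge0_integral_fsum//; last 2 first.
  - by move=> r; exact/measurable_EFinP/measurableT_comp.
  - by move=> n x _; rewrite EFinM nnfun_muleindic_ge0.
under [RHS]eq_integral.
  move=> x xD; rewrite fimfunE -fsumEFin// ge0_mule_fsuml; last first.
    by move=> r; rewrite EFinM nnfun_muleindic_ge0.
  over.
rewrite [RHS]ge0_integral_fsum//; last 2 first.
  - move=> r; apply: emeasurable_funM => //.
    by apply/measurable_EFinP; do 2 apply/measurableT_comp => //.
  - by move=> n x _; rewrite mule_ge0// EFinM nnfun_muleindic_ge0.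
apply: eq_fsbigr => r _.
have [r0|r0] := ltP r 0%R.
  rewrite (_ : g @^-1` [set r] = set0); last first.
    by apply/seteqP; split => x //= gr; move: r0; rewrite -gr ltNge fun_ge0.
  by rewrite !integral0_eq// => x _; rewrite indic0 mulr0 ?mul0e.
have mgr : measurable (g @^-1` [set r]) by [].
under eq_integral do rewrite EFinM.
rewrite ge0_integralZl//; last exact/measurable_EFinP/measurable_indic.
under [RHS]eq_integral do rewrite EFinM -muleA.
rewrite ge0_integralZl//; last 2 first.
- by apply: emeasurable_funM => //; exact/measurable_EFinP/measurable_indic.
- by move=> x _; rewrite mule_ge0// lee_fin.
congr (_ * _); rewrite integral_indic// setIT nuE// integral_mkcond.
apply: eq_integral => x _; rewrite patchE indicE.
by case: ifP => _; rewrite ?mul1e ?mul0e.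
Qed.

Lemma ge0_integral_density (f : T -> \bar R) : measurable_fun setT f ->
  (forall x, 0 <= f x) -> \int[nu]_x f x = \int[mu]_x (f x * p x).
Proof.
move=> mf f0.
pose f_ := nnsfun_approx measurableT mf.
transitivity (lim (\int[nu]_x (f_ n x)%:E @[n --> \oo])).
  rewrite -monotone_convergence//=.
  - apply: eq_integral => ? /[!inE] xD; apply/esym/cvg_lim => //=.
    exact: cvg_nnsfun_approx.
  - by move=> n; exact/measurable_EFinP/measurable_funTS.
  - by move=> n ? _; rewrite lee_fin.
  - by move=> ? _ ? ? mn; rewrite lee_fin; exact/lefP/nd_nnsfun_approx.
transitivity (lim (\int[mu]_x ((f_ n x)%:E * p x) @[n --> \oo])).
  by apply: congr_lim; apply/funext => n; exact: integral_density_nnsfun.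
rewrite -monotone_convergence//=.
- apply: eq_integral => x /[!inE] xD; apply/cvg_lim => //=.
  by apply: cvgeZr => //; exact: cvg_nnsfun_approx.
- by move=> n; apply: emeasurable_funM => //; exact/measurable_EFinP.
- by move=> n x _; rewrite mule_ge0// lee_fin.
- by move=> x _ i j ij; rewrite lee_wpmul2r// lee_fin; exact/lefP/nd_nnsfun_approx.
Qed.

End density.

Section exponential_integrals.
Context (R : realType).
Local Notation mu := (@lebesgue_measure R).

Definition exponential_measure (r : R) (r0 : 0 < r) :
  probability (g_sigma_algebraType R.-ocitv.-measurable) R.
Proof.
unshelve refine (exponential_prob r : probability (g_sigma_algebraType R.-ocitv.-measurable) R).
exact: r0.
Defined.

Lemma exponential_measureE (r : R) (r0 : 0 < r) D : exponential_measure r0 D = exponential_prob r D.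
Proof. by []. Qed.

Lemma exponential_tail (r y : R) : 0 < r -> 0 <= y ->
  exponential_prob r `]y, +oo[%classic = (expR (- (r * y)))%:E.
Proof.
move=> r0 y0; rewrite -(exponential_measureE r0).
have pos_part (B : set R) : measurable B ->
    exponential_measure r0 B = exponential_measure r0 (B `&` `[0, +oo[).
  move=> mB; rewrite !exponential_measureE /exponential_prob integral_mkcondr.
  apply: eq_integral => x _; rewrite patchE; case: ifPn => // x0.
  by rewrite /exponential_pdf patchE (negbTE x0).
rewrite pos_part//.
have -> : `]y, +oo[%classic `&` `[0, +oo[%classic = ~` `[0, y]%classic `&` `[0, +oo[%classic :> set R.
  apply/seteqP; split => x /=; rewrite !in_itv/= !andbT => -[h1 x0]; split => //.
    by rewrite x0 /= leNgt h1.
  by move/negP: h1; rewrite x0 /= -ltNge.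
rewrite -pos_part; last exact: measurableC.
rewrite probability_setC// exponential_measureE.
move: y0; rewrite le_eqVlt => /predU1P[<-|y0].
  rewrite set_itv1 /exponential_prob integral_set1 mulr0 oppr0 expR0.
  by rewrite sube0.
by rewrite exponential_prob_itv0c// -!EFinB mulNr opprB addrC subrK.
Qed.

(** The density times [expR (- (b * x))] is [r / (r + b)] times the exponential density of rate
    [r + b]. The factor in [b] will carry the weight left by the other clocks. *)
Lemma integral_exponential_tail (r b y : R) (r0 : 0 < r) : 0 <= b -> 0 <= y ->
  (\int[exponential_measure r0]_x (if y < x then expR (- (b * x)) else 0)%:E =
   (r / (r + b) * expR (- ((r + b) * y)))%:E)%E.
Proof.
move=> b0 y0; have rb0 : 0 < r + b by rewrite ltr_wpDr.
pose p x := (exponential_pdf r x)%:E.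
have mp : measurable_fun setT p by apply/measurable_EFinP; exact: measurable_exponential_pdf.
have p0 x : (0 <= p x)%E by rewrite lee_fin exponential_pdf_ge0// ltW.
rewrite (@ge0_integral_density _ _ R mu (exponential_measure r0) p)//; last first.
- by move=> x; rewrite lee_fin; case: ifP => // _; exact: expR_ge0.
- apply/measurable_EFinP; apply: measurable_fun_ifT => //.
    exact: measurable_fun_ltr.
  by apply: measurableT_comp => //; apply: measurableT_comp => //; exact: measurable_funM.
transitivity (\int[mu]_x ((r / (r + b))%:E *
    ((\1_(`]y, +oo[%classic) x)%:E * (exponential_pdf (r + b) x)%:E)))%E.
  apply: eq_integral => x _; rewrite /p -!EFinM; congr EFin; rewrite indicE mem_setE in_itv/= andbT.
  case: ifP => _; last by rewrite !mul0r !mulr0.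
  rewrite /exponential_pdf !patchE; case: ifP => _; last by rewrite !mulr0.
  have -> : expR (- (r + b) * x) = expR (- r * x) * expR (- (b * x)).
    by rewrite -expRD; congr expR; ring.
  by rewrite /= mul1r; field; rewrite gt_eqF.
rewrite ge0_integralZl//; last 3 first.
- apply: emeasurable_funM; first exact/measurable_EFinP/measurable_indic.
  by apply/measurable_EFinP; exact: measurable_exponential_pdf.
- by move=> x _; rewrite mule_ge0// lee_fin// exponential_pdf_ge0// ltW.
- by rewrite lee_fin divr_ge0// ltW.
rewrite [RHS]EFinM -exponential_tail//; congr (_ * _)%E.
rewrite /exponential_prob [RHS]integral_mkcond; apply: eq_integral => x _.
rewrite patchE indicE; by case: ifP => _; rewrite ?mul1e ?mul0e.
Qed.

End exponential_integrals.

(** * Independence of one input from the others *)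

Section clocks.
Context (R : realType) (K : nat) (pi : 'I_K -> R).
Hypothesis pi_gt0 : forall a, 0 < pi a.
Context (d : measure_display) (Omega : measurableType d) (Q : probability Omega R).
Variables (A : Omega -> 'I_K) (tau : Omega -> R) (E : seq nat -> nat -> 'I_K -> Omega -> R).
Hypothesis hE : branching_inputs pi Q A tau E.

Local Notation index := (option (seq nat * nat * 'I_K)).
Implicit Types (i j : index) (s : seq index).

Definition input j (w : Omega) : R :=
  if j is Some i then E i.1.1 i.1.2 i.2 w else tau w.
Definition input_rate j : R := if j is Some _ then 1 else 2.

Lemma input_rate_gt0 j : 0 < input_rate j.
Proof. by case: j. Qed.

Lemma measurable_input j : measurable_fun setT (input j).
Proof. by case: hE => _ mt mE _; case: j => [[[u k] b]|]; [exact: mE|exact: mt]. Qed.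

Lemma measurable_type a : measurable [set w | A w = a].
Proof. by case: hE. Qed.

Lemma seq_of_Some s : None \notin s -> s = map Some (pmap id s).
Proof.
elim: s => //= -[i|] s IH; rewrite inE //= => /IH sE.
by rewrite {1}sE.
Qed.

Lemma inputs_joint a s (C : index -> set R) : uniq s -> (forall j, measurable (C j)) ->
  Q [set w | A w = a /\ forall j, j \in s -> C j (input j w)] =
  ((pi a)%:E * \prod_(j <- s) exponential_prob (input_rate j) (C j))%E.
Proof.
move=> us mC; case: hE => _ _ _ joint.
have expo1 : exponential_prob 2 setT = 1%E :> \bar R.
  by rewrite /exponential_prob integral_exponential_pdf.
have key (B : set R) (t : seq (seq nat * nat * 'I_K)) : measurable B -> uniq t ->
   Q [set w | [/\ A w = a, B (tau w) & forall x, x \in t -> C (Some x) (E x.1.1 x.1.2 x.2 w)]] =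
   ((pi a)%:E * exponential_prob 2 B * \prod_(x <- t) exponential_prob 1 (C (Some x)))%E.
  move=> mB ut; exact: (joint a B t (fun x => C (Some x))).
have uniq_pmap (t : seq index) : uniq t -> uniq (pmap id t).
  by move=> ut; apply: (@pmap_uniq _ _ id Some) => //; case.
have mem_pm (t : seq index) (i : seq nat * nat * 'I_K) : (i \in pmap id t) = (Some i \in t).
  elim: t => //= -[k|] t IH; rewrite /= !inE IH//.
case: (boolP (None \in s)) => Ns.
  have ps : perm_eq s (None :: map Some (pmap id (rem None s))).
    apply: (perm_trans (perm_to_rem Ns)); rewrite -seq_of_Some//.
    by rewrite mem_rem_uniq// inE eqxx.
  have ur : uniq (pmap id (rem None s)) by apply: uniq_pmap; exact: rem_uniq.
  rewrite (perm_big _ ps) big_cons big_map /= muleA -key//.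
  congr (Q _); apply/seteqP; split => w /=.
    case=> Aw H; split => // [|i it].
      exact: (H None).
    by apply: (H (Some i)); rewrite (perm_mem ps) inE /= mem_map// => ? ? [].
  case=> Aw Bw H; split => // j; rewrite (perm_mem ps) inE => /orP[/eqP->//|].
  by case/mapP => i it ->; exact: H.
have sE := seq_of_Some Ns.
have -> : (\prod_(j <- s) exponential_prob (input_rate j) (C j) =
    \prod_(x <- pmap id s) exponential_prob 1 (C (Some x)))%E by rewrite {1}sE big_map.
have -> : ((pi a)%:E * \prod_(x <- pmap id s) exponential_prob 1 (C (Some x)) =
  (pi a)%:E * exponential_prob 2 setT * \prod_(x <- pmap id s) exponential_prob 1 (C (Some x)))%E.
  by rewrite expo1 mule1.
rewrite -key//; last exact: uniq_pmap.
congr (Q _); apply/seteqP; split => w /=.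
  by case=> Aw H; split => // i; rewrite mem_pm => it; exact: (H (Some i)).
case=> Aw _ H; split => // j; rewrite {1}sE => /mapP[i it ->]; exact: H.
Qed.

Definition cylinders s : set (set Omega) :=
  [set H | exists C : index -> set R, (forall j, measurable (C j)) /\
     H = [set w | forall j, j \in s -> C j (input j w)]].

Lemma cylinder_measurable s H : cylinders s H -> measurable H.
Proof.
case=> C [mC ->]; elim: s => [|j s IH].
  by rewrite (_ : [set w | _] = setT)//; apply/seteqP; split.
have -> : [set w | forall k, k \in j :: s -> C k (input k w)] =
    (input j @^-1` C j) `&` [set w | forall k, k \in s -> C k (input k w)].
  apply/seteqP; split => w /=.
    by move=> H0; split; [apply: H0; rewrite mem_head|move=> k ks; apply: H0; rewrite inE ks orbT].
  by case=> H0 H1 k; rewrite inE => /orP[/eqP->//|]; exact: H1.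
apply: measurableI => //; rewrite -[X in measurable X]setTI; exact: measurable_input.
Qed.

Lemma cylinders_setI s : setI_closed (cylinders s).
Proof.
move=> _ _ [C [mC ->]] [D [mD ->]]; exists (fun j => C j `&` D j); split.
  by move=> j; exact: measurableI.
apply/seteqP; split => w /=; first by case=> h1 h2 j js; split; [exact: h1|exact: h2].
by move=> H; split => j js; have [] := H j js.
Qed.

Lemma cylinders_setT s : cylinders s setT.
Proof. by exists (fun=> setT); split => //; apply/seteqP; split. Qed.

Variable a : 'I_K.

Let Qa_fin : (Q [set w | A w = a] < +oo)%E.
Proof. by rewrite ltey_eq fin_num_measure//; exact: measurable_type. Qed.

(** Restriction to the type of the root replaces conditioning: the total mass is [pi a], and the
    inputs keep their product law up to that factor. *)
Definition type_restr : {finite_measure set Omega -> \bar R} :=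
  mfrestr (measurable_type a) Qa_fin.

Lemma type_restrE H : type_restr H = Q (H `&` [set w | A w = a]).
Proof. by []. Qed.

(** Both sides are finite measures in [H] that agree on the cylinders, which are stable under
    intersection and include the whole space. *)
Lemma input_independent s i (D : set R) (H : set Omega) : uniq s -> i \notin s -> measurable D ->
  <<s cylinders s >> H ->
  type_restr ((input i @^-1` D) `&` H) = (exponential_prob (input_rate i) D * type_restr H)%E.
Proof.
move=> us si mD.
have mXD : measurable (input i @^-1` D).
  by rewrite -[X in measurable X]setTI; exact: measurable_input.
have eD : exponential_prob (input_rate i) D =
    exponential_measure (input_rate_gt0 i) D by [].
have finD : exponential_prob (input_rate i) D \is a fin_num.
  by rewrite eD fin_num_measure.
pose k : {nonneg R} := NngNum (fine_ge0 (measure_ge0 (exponential_measure (input_rate_gt0 i)) D)).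
pose mu1 := mrestr type_restr mXD.
pose mu2 := mscale k type_restr.
have mG : cylinders s `<=` measurable by exact: cylinder_measurable.
have mu12 B : cylinders s B -> mu1 B = mu2 B.
  case=> C [mC ->]; rewrite /mu1 /mrestr /mu2 /mscale /= fineK// !type_restrE.
  pose C' j := if j == i then D else C j.
  have mC' j : measurable (C' j) by rewrite /C'; case: ifP.
  have E1 : [set w | forall j, j \in s -> C j (input j w)] `&` (input i @^-1` D) `&` [set w | A w = a] =
      [set w | A w = a /\ forall j, j \in i :: s -> C' j (input j w)].
    apply/seteqP; split => w /=.
      move=> [[h1 h2] h3]; split => // j; rewrite inE /C' => /orP[/eqP->|js]; first by rewrite eqxx.
      by case: ifP => [/eqP->//|_]; exact: h1.
    move=> [h1 h2]; split => //; split => [j js|].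
      have := h2 j; rewrite inE js orbT /C' => /(_ isT); case: ifP => // /eqP ji.
      by rewrite -ji js in si.
    by have := h2 i (mem_head _ _); rewrite /C' eqxx.
  have E2 : [set w | forall j, j \in s -> C j (input j w)] `&` [set w | A w = a] =
      [set w | A w = a /\ forall j, j \in s -> C j (input j w)].
    by apply/seteqP; split => w /= [].
  rewrite E1 E2 !inputs_joint//=; last by rewrite si.
  rewrite big_cons muleCA /C' eqxx; congr (_ * (_ * _))%E.
  rewrite big_seq [RHS]big_seq; apply: eq_bigr => j js.
  by case: ifP => // /eqP ji; rewrite -ji js in si.
move=> sH; rewrite setIC.
have cov : \bigcup_(k in setT) (fun=> setT : set Omega) (k : nat) = setT by rewrite bigcup_const.
have fin1 (n : nat) : (mu1 setT < +oo)%E.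
  apply: (@le_lt_trans _ _ (type_restr setT)).
    by apply: le_measure; rewrite ?inE//; exact: measurableI.
  by rewrite ltey_eq fin_num_measure.
suff : mu1 H = mu2 H by rewrite /mu1 /mrestr /mu2 /mscale /= fineK.
exact: (@g_sigma_algebra_measure_unique _ R _ (cylinders s) mG (fun=> setT)
  (fun=> cylinders_setT s) cov mu1 mu2 (@cylinders_setI s) mu12 fin1 H sH).
Qed.

End clocks.

Section peeling.
Context (R : realType) (K : nat) (pi : 'I_K -> R).
Context (d : measure_display) (Omega : measurableType d) (Q : probability Omega R).
Variables (A : Omega -> 'I_K) (tau : Omega -> R) (E : seq nat -> nat -> 'I_K -> Omega -> R).
Hypothesis hE : branching_inputs pi Q A tau E.
Variable a : 'I_K.

Local Notation index := (option (seq nat * nat * 'I_K)).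
Implicit Types (i j : index) (s : seq index).
Local Notation input := (input tau E).
Local Notation type_restr := (type_restr hE a).
Local Notation inputs_space s := (g_sigma_algebraType (cylinders tau E s)).

(** Measurability for the sigma-algebra generated by the inputs in [s], for which
    [input_independent] gives independence of any further input. *)
Definition depends_on s (f : Omega -> R) : Prop :=
  measurable_fun (setT : set (inputs_space s)) (f : inputs_space s -> R).

Lemma depends_on_measurable s f : depends_on s f -> measurable_fun (setT : set Omega) f.
Proof.
move=> mf _ B mB; rewrite setTI; have := mf measurableT B mB; rewrite setTI => H.
apply: (@smallest_sub _ _ _ (measurable : set (set Omega)) _ _ _ H).
- exact: sigma_algebra_measurable.
- exact: cylinder_measurable hE _.
Qed.

Lemma sub_depends_on s s' f : {subset s <= s'} -> depends_on s f -> depends_on s' f.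
Proof.
move=> ss mf _ B mB; have := mf measurableT B mB.
apply: sub_smallest2r; first exact: smallest_sigma_algebra.
move=> _ [C [mC ->]].
exists (fun j => if j \in s then C j else setT); split; first by move=> j; case: ifP.
apply/seteqP; split => w /= H j.
  by move=> _; case: ifP => // js; exact: H.
by move=> js; have := H j (ss j js); rewrite js.
Qed.

Lemma depends_on_input s j : j \in s -> depends_on s (input j).
Proof.
move=> js _ B mB; rewrite setTI; apply: sub_sigma_algebra.
exists (fun k => if k == j then B else setT); split; first by move=> k; case: ifP.
apply/seteqP; split => w /=.
  by move=> Bw k ks; case: ifP => // /eqP ->.
by move=> /(_ j js); rewrite eqxx.
Qed.

Lemma depends_on_cst s (x : R) : depends_on s (fun=> x).
Proof. exact: measurable_cst. Qed.

Lemma depends_onD s f g : depends_on s f -> depends_on s g -> depends_on s (fun w => f w + g w).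
Proof. exact: measurable_funD. Qed.

Lemma depends_onB s f g : depends_on s f -> depends_on s g -> depends_on s (fun w => f w - g w).
Proof. exact: measurable_funB. Qed.

Lemma depends_onN s f : depends_on s f -> depends_on s (fun w => - f w).
Proof. exact: measurable_funN. Qed.

Lemma depends_onM s f g : depends_on s f -> depends_on s g -> depends_on s (fun w => f w * g w).
Proof. exact: measurable_funM. Qed.

Lemma depends_on_exp s f : depends_on s f -> depends_on s (fun w => expR (f w)).
Proof. by move=> mf; apply: measurableT_comp. Qed.

Lemma depends_on_ltr s f g : depends_on s f -> depends_on s g ->
  depends_on s (fun w => if f w < g w then 1 else 0).
Proof.
by move=> mf mg; apply: measurable_fun_ifT => //; exact: measurable_fun_ltr.
Qed.

Lemma depends_on_prod (I : Type) (r : seq I) s (f : I -> Omega -> R) :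
  (forall x, depends_on s (f x)) -> depends_on s (fun w => \prod_(x <- r) f x w).
Proof.
move=> mf; elim: r => [|x r IH].
  by under [X in depends_on _ X]eq_fun do rewrite big_nil; exact: depends_on_cst.
under [X in depends_on _ X]eq_fun do rewrite big_cons.
exact: depends_onM.
Qed.

Lemma depends_on_sum (I : Type) (r : seq I) s (f : I -> Omega -> R) :
  (forall x, depends_on s (f x)) -> depends_on s (fun w => \sum_(x <- r) f x w).
Proof.
move=> mf; elim: r => [|x r IH].
  by under [X in depends_on _ X]eq_fun do rewrite big_nil; exact: depends_on_cst.
under [X in depends_on _ X]eq_fun do rewrite big_cons.
exact: depends_onD.
Qed.

(** One fresh input is integrated out while [Z] and [Y] are held fixed. Nonnegativity of [Y] is
    asked only where [Z] does not vanish, since restart times precede the last birth only when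
    births are in order. *)
Lemma integral_input_tail s i (Z Y : Omega -> R) (b : R) :
  uniq s -> i \notin s -> 0 <= b -> depends_on s Z -> depends_on s Y ->
  (forall w, 0 <= Z w) -> (forall w, Z w != 0 -> 0 <= Y w) ->
  (\int[type_restr]_w (Z w * (if Y w < input i w then expR (- (b * input i w)) else 0))%:E =
   \int[type_restr]_w (Z w * (input_rate R i / (input_rate R i + b) *
      expR (- ((input_rate R i + b) * Y w))))%:E)%E.
Proof.
move=> us si b0 mZ mY Z0 Y0.
pose r0 : 0 < input_rate R i := input_rate_gt0 R i.
have mid : measurable_fun (setT : set Omega) (id : Omega -> inputs_space s).
  move=> _ B mB; rewrite setTI preimage_id.
  apply: (@smallest_sub _ _ _ (measurable : set (set Omega)) _ _ _ mB).
    exact: sigma_algebra_measurable.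
  exact: cylinder_measurable hE _.
pose g (z : R * inputs_space s) : \bar R :=
  (Z z.2 * (if Y z.2 < z.1 then expR (- (b * z.1)) else 0))%:E.
have m2 (f : Omega -> R) : depends_on s f ->
    measurable_fun [set: (R * inputs_space s)%type] (fun z => f z.2).
  by move=> mf; apply: measurableT_comp.
have mg : measurable_fun setT g.
  apply/measurable_EFinP; apply: measurable_funM; first exact: m2.
  apply: measurable_fun_ifT => //.
    by apply: measurable_fun_ltr; [exact: m2|exact: measurable_fst].
  apply: measurableT_comp => //; apply: measurableT_comp => //.
  by apply: measurable_funM => //; exact: measurable_fst.
have g0 z : (0 <= g z)%E.
  by rewrite lee_fin mulr_ge0//; case: ifP => // _; exact: expR_ge0.
have := @integral_independent _ _ _ Omega _ (inputs_space s) R type_restr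
  (exponential_measure r0) (input i) id (measurable_input hE i) mid _ g mg g0.
rewrite /g /= => -> ; last first.
  move=> D H mD mH; exact: (input_independent hE a us si mD mH).
apply: eq_integral => w _.
have [Zw|Zw] := eqVneq (Z w) 0.
  by rewrite Zw mul0r integral0_eq// => x _; rewrite mul0r.
under eq_integral do rewrite EFinM.
rewrite ge0_integralZl//; last 3 first.
- apply/measurable_EFinP; apply: measurable_fun_ifT => //.
    exact: measurable_fun_ltr.
  by apply: measurableT_comp => //; apply: measurableT_comp => //; exact: measurable_funM.
- by move=> x _; rewrite lee_fin; case: ifP => // _; exact: expR_ge0.
- by rewrite lee_fin.
by rewrite integral_exponential_tail// ?Y0// EFinM.
Qed.

(** Clocks are removed one at a time, a unit-rate input exceeding [Y x] with probability
    [expR (- Y x)]. *)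
Lemma integral_inputs_survive (I : eqType) (js : seq I) (idx : I -> index) s
    (Z : Omega -> R) (Y : I -> Omega -> R) :
  uniq (map idx js ++ s) -> (forall x, input_rate R (idx x) = 1) ->
  depends_on s Z -> (forall x, depends_on s (Y x)) ->
  (forall w, 0 <= Z w) -> (forall x w, Z w != 0 -> 0 <= Y x w) ->
  (\int[type_restr]_w (Z w * \prod_(x <- js) (if Y x w < input (idx x) w then 1 else 0))%:E =
   \int[type_restr]_w (Z w * expR (- \sum_(x <- js) Y x w))%:E)%E.
Proof.
elim: js Z => [|x js IH] Z /= us rate1 mZ mY Z0 Y0.
  by apply: eq_integral => w _; rewrite !big_nil oppr0 expR0.
case/andP: us => xs us.
have sub : {subset s <= map idx js ++ s} by move=> k ks; rewrite mem_cat ks orbT.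
transitivity (\int[type_restr]_w ((Z w * \prod_(y <- js) (if Y y w < input (idx y) w then 1 else 0)) *
   (if Y x w < input (idx x) w then expR (- (0 * input (idx x) w)) else 0))%:E)%E.
  apply: eq_integral => w _; congr EFin; rewrite big_cons mulrA mulrAC; congr (_ * _).
  by rewrite mul0r oppr0 expR0.
rewrite (@integral_input_tail (map idx js ++ s) (idx x)
  (fun w => Z w * \prod_(y <- js) (if Y y w < input (idx y) w then 1 else 0)) (Y x) 0)//; first last.
- by move=> w; rewrite mulf_eq0 negb_or => /andP[/Y0 + _]; apply.
- move=> w; rewrite mulr_ge0// big_seq; apply: prodr_ge0 => y _; by case: ifP.
- exact: sub_depends_on sub _.
- apply: depends_onM; first exact: sub_depends_on sub _.
  (* The membership guard changes no factor, and makes each one depend on the listed inputs even for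
     [y] outside [js]. *)
  have -> : (fun w => \prod_(y <- js) (if Y y w < input (idx y) w then 1 else 0)) =
     (fun w => \prod_(y <- js) (if (idx y) \in map idx js ++ s then (if Y y w < input (idx y) w then 1 else 0) else 0)) :> (Omega -> R).
    apply/funext => w; rewrite big_seq [RHS]big_seq; apply: eq_bigr => y yjs.
    by rewrite mem_cat map_f.
  apply: depends_on_prod => y.
  have [ys|_] := boolP (idx y \in map idx js ++ s); last exact: depends_on_cst.
  by apply: depends_on_ltr; [exact: sub_depends_on sub _|exact: depends_on_input].
transitivity (\int[type_restr]_w ((Z w * expR (- Y x w)) *
   \prod_(y <- js) (if Y y w < input (idx y) w then 1 else 0))%:E)%E.
  apply: eq_integral => w _; congr EFin.
  by rewrite rate1 addr0 divr1 !mul1r mulrAC.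
rewrite IH//.
- by apply: eq_integral => w _; congr EFin; rewrite big_cons opprD expRD mulrA.
- by apply: depends_onM => //; apply: depends_on_exp; exact: depends_onN.
- by move=> w; rewrite mulr_ge0// expR_ge0.
- by move=> y w; rewrite mulf_eq0 negb_or => /andP[/Y0 + _]; apply.
Qed.

End peeling.

(** * The probability of a history *)

Section clock_indices.
Context (K : nat).
Local Notation births := (seq (nat * 'I_K)).
Local Notation index := (option (seq nat * nat * 'I_K)).
Implicit Types (l : births) (b : 'I_K) (i p : nat).

Definition clock_index l (x : nat * 'I_K) : index := Some (ancestry l x.1, nkids l x.1, x.2).

(* The clocks that determine the birth times of the history [l]. *)
Fixpoint used l : seq index :=
  if l is e :: l' then map (fun b => clock_index l' (e.1, b)) (enum 'I_K) ++ used l' else [::].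

Lemma used_cons l (e : nat * 'I_K) b : clock_index l (e.1, b) \in used (e :: l).
Proof.
by rewrite mem_cat; apply/orP; left; apply/mapP; exists b => //; rewrite mem_enum.
Qed.

Lemma sub_used_cons l (e : nat * 'I_K) : {subset used l <= used (e :: l)}.
Proof. by move=> j jl; rewrite mem_cat jl orbT. Qed.

Lemma mem_used l u k b : hvalid l -> Some (u, k, b) \in used l ->
  exists i, [/\ (i <= size l)%N, u = ancestry l i & (k < nkids l i)%N].
Proof.
elim: l => //= -[p c] l IH /= /andP[pl vl]; rewrite mem_cat => /orP[|/(IH vl)[i [il -> ki]]].
  case/mapP => b' _ [-> -> _]; exists p; split; first exact: leqW.
    by rewrite ltn_eqF// ltnS.
  by rewrite /nkids /= eqxx add1n.
exists i; split; first exact: leqW.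
  by rewrite ltn_eqF// ltnS.
by rewrite /nkids /= (leq_trans ki)// leq_addl.
Qed.

(** Exponential variables are numbered by the children of their owner, so those already used have
    smaller numbers than the running ones. Hence the running clocks are independent of the past. *)
Lemma clock_index_fresh l x : hvalid l -> (x.1 <= size l)%N -> clock_index l x \notin used l.
Proof.
move=> vl xl; apply/negP => /(mem_used vl)[i [il ix ki]].
by move: ki; rewrite (as_inj (ancestry_specP vl) xl il ix) ltnn.
Qed.

Lemma clock_index_inj l x y : hvalid l -> (x.1 <= size l)%N -> (y.1 <= size l)%N ->
  clock_index l x = clock_index l y -> x = y.
Proof.
case: x y => [p b] [q c] vl pl ql [pq _ ->].
by have /= -> := as_inj (ancestry_specP vl) pl ql pq.
Qed.

Lemma None_notin_used l : None \notin used l.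
Proof.
elim: l => //= e l IH; rewrite mem_cat negb_or IH andbT.
by apply/mapP => -[].
Qed.

Lemma used_uniq l : hvalid l -> uniq (used l).
Proof.
elim: l => //= e l IH /andP[el vl]; rewrite cat_uniq IH// andbT; apply/andP; split.
  by rewrite map_inj_uniq ?enum_uniq// => b c [].
apply/hasPn => j js; apply/mapP => -[b _ jE].
by move: js; rewrite jE; apply/negP; exact: clock_index_fresh.
Qed.

Lemma clock_indices_uniq l (s : seq (nat * 'I_K)) : hvalid l -> uniq s ->
  {in s, forall x, (x.1 <= size l)%N} -> uniq (map (clock_index l) s ++ used l).
Proof.
move=> vl us sl; rewrite cat_uniq used_uniq// andbT; apply/andP; split.
  rewrite map_inj_in_uniq// => x y xs ys; apply: clock_index_inj => //; exact: sl.
apply/hasPn => j js; apply/mapP => -[x xs jE].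
by move: js; rewrite jE; apply/negP; apply: clock_index_fresh => //; exact: sl.
Qed.

End clock_indices.

Section history_probability.
Context (R : realType) (K : nat) (hK : (0 < K)%N) (pi : 'I_K -> R).
Context (d : measure_display) (Omega : measurableType d) (Q : probability Omega R).
Variables (A : Omega -> 'I_K) (tau : Omega -> R) (E : seq nat -> nat -> 'I_K -> Omega -> R).
Hypothesis hE : branching_inputs pi Q A tau E.
Variables (phi : 'I_K -> 'I_K -> R) (m : 'I_K -> nat).
Hypothesis (phi_gt0 : forall a b, 0 < phi a b) (m_ge1 : forall a, (1 <= m a)%N).
Variable a : 'I_K.

Local Notation births := (seq (nat * 'I_K)).
Local Notation index := (option (seq nat * nat * 'I_K)).
Implicit Types (l : births) (b : 'I_K) (i p : nat) (w : Omega).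
Local Notation input := (input tau E).
Local Notation type_restr := (type_restr hE a).
Local Notation depends_on := (depends_on tau E).
Local Notation Ew w := (fun u k b => E u k b w).
Local Notation rate l i b := (hrate phi m a l i b).
Local Notation S l := (total_rate phi m a l).

Definition hrestart l i w : R := restart phi m a (Ew w) l i.
Definition hring l i b w : R := ring_time phi m a (Ew w) l i b.
Definition hlast l w : R := last_birth phi m a (Ew w) l.

Let rate_gt0 l i b : 0 < rate l i b.
Proof. exact: hrate_gt0. Qed.

Lemma hringE l i b w : hring l i b w = hrestart l i w + input (clock_index l (i, b)) w / rate l i b.
Proof. by []. Qed.

Lemma hring_ltr (t : R) l i b w :
  (t < hring l i b w) = (rate l i b * (t - hrestart l i w) < input (clock_index l (i, b)) w).
Proof. by rewrite hringE -ltrBlDl ltr_pdivlMr// mulrC. Qed.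

Lemma depends_on_restart l i : depends_on (used l) (hrestart l i).
Proof.
elim: l i => [|e l IH] i; first exact: depends_on_cst.
have sub := @sub_used_cons _ l e.
rewrite /hrestart /=; case: (_ || _); last exact: sub_depends_on sub (IH i).
apply: depends_onD; first exact: sub_depends_on sub (IH _).
apply: depends_onM; last exact: depends_on_cst.
exact: (@depends_on_input _ _ _ _ tau E (used (e :: l)) (clock_index l (e.1, e.2)) (used_cons l e _)).
Qed.

Lemma depends_on_ring l i b (s : seq index) : {subset used l <= s} -> clock_index l (i, b) \in s ->
  depends_on s (hring l i b).
Proof.
move=> sub cs.
rewrite (_ : hring l i b = fun w => hrestart l i w + input (clock_index l (i, b)) w / rate l i b)//.
apply: depends_onD; first exact: sub_depends_on sub (@depends_on_restart l i).
apply: depends_onM; last exact: depends_on_cst.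
exact: (@depends_on_input _ _ _ _ tau E s (clock_index l (i, b))).
Qed.

Lemma depends_on_last l : depends_on (used l) (hlast l).
Proof.
case: l => [|e l]; first exact: depends_on_cst.
by apply: depends_on_ring; [exact: sub_used_cons|exact: used_cons].
Qed.

(** Indicator of [born_in_order], written as a product so that it can be integrated clock by
    clock. *)
Fixpoint order_ind l w : R :=
  if l is e :: l' then
    order_ind l' w * (if hlast l' w < hring l' e.1 e.2 w then 1 else 0) *
    \prod_(b <- [seq b <- enum 'I_K | b != e.2]) (if hring l' e.1 e.2 w < hring l' e.1 b w then 1 else 0)
  else 1.

Lemma prod_ind (I : eqType) (s : seq I) (P : pred I) :
  \prod_(x <- s) (if P x then 1 else 0) = (if all P s then 1 else 0) :> R.
Proof.
elim: s => [|x s IH]; first by rewrite big_nil.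
by rewrite big_cons IH /=; case: (P x); rewrite ?mul1r ?mul0r.
Qed.

Lemma order_indE l w :
  order_ind l w = if `[< born_in_order phi m a (Ew w) l >] then 1 else 0.
Proof.
elim: l => [|e l IH] /=; first by case: asboolP.
rewrite IH prod_ind.
case: (asboolP (born_in_order _ _ _ _ l)) => ol; last first.
  by rewrite !mul0r; case: asboolP => // -[].
case: ifP => lt; last first.
  by rewrite mulr0 mul0r; case: asboolP => // -[_ lt']; rewrite /hlast /hring lt' in lt.
rewrite !mul1r; case: allP => win; case: asboolP => // win'; exfalso; last first.
  apply: win => b; rewrite mem_filter => /andP[be _]; by have [_ _] := win'; apply.
by apply: win'; split => // b be; apply: win; rewrite mem_filter be mem_enum.
Qed.

Lemma order_ind_ge0 l w : 0 <= order_ind l w.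
Proof. by rewrite order_indE; case: ifP. Qed.

Lemma order_ind_neq0 l w : order_ind l w != 0 -> born_in_order phi m a (Ew w) l.
Proof. by rewrite order_indE; case: asboolP => //; rewrite eqxx. Qed.

Lemma depends_on_order l : depends_on (used l) (order_ind l).
Proof.
elim: l => [|e l IH]; first exact: depends_on_cst.
have sub := @sub_used_cons _ l e.
have ring b : depends_on (used (e :: l)) (hring l e.1 b).
  by apply: depends_on_ring => //; exact: used_cons.
apply: depends_onM; first apply: depends_onM.
- exact: sub_depends_on sub IH.
- by apply: depends_on_ltr => //; exact: sub_depends_on sub (@depends_on_last l).
- by apply: depends_on_prod => b; exact: depends_on_ltr.
Qed.

(* [expo l t] is minus the logarithm of the probability that, given the past,
   no clock rings between its last restart and time [t], nor [tau] before [t]. *)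
Definition expo l (t : R) w : R :=
  2 * t + \sum_(i <- iota 0 (size l).+1) \sum_b rate l i b * (t - hrestart l i w).

Lemma expo_shift l t t' w : expo l t w = expo l t' w + (2 + S l) * (t - t').
Proof.
rewrite /expo [(2 + _) * _]mulrDl [RHS]addrACA -mulrDr [t' + _]addrC subrK; congr (_ + _).
rewrite /total_rate mulr_suml -big_split; apply: eq_bigr => i _ /=.
rewrite mulr_suml -big_split; apply: eq_bigr => b _ /=; ring.
Qed.

(** By memorylessness, the probability that the root has type [a], the births of [l] occur in order,
    and neither [tau] nor a running clock rings before the last birth. *)
Definition order_weight l : \bar R :=
  (\int[type_restr]_w (order_ind l w * expR (- expo l (hlast l w) w))%:E)%E.

Lemma rate_cons e l i b : (i <= size l)%N -> i != e.1 -> rate (e :: l) i b = rate l i b.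
Proof.
move=> il ie; rewrite /hrate /hdegree /= ltn_eqF ?ltnS//.
by rewrite /nkids /= eq_sym (negbTE ie).
Qed.

Lemma expo_cons e l t w : (e.1 <= size l)%N -> t = hlast (e :: l) w ->
  expo (e :: l) t w = expo l t w - \sum_b rate l e.1 b * (t - hrestart l e.1 w).
Proof.
move=> el tE; rewrite /expo -addrA; congr (_ + _).
have E1 : \sum_(i <- iota 0 (size l).+1) \sum_b rate l i b * (t - hrestart l i w) =
    \sum_b rate l e.1 b * (t - hrestart l e.1 w) +
    \sum_(i <- iota 0 (size l).+1 | i != e.1) \sum_b rate l i b * (t - hrestart l i w).
  by rewrite (bigD1_seq e.1) ?iota_uniq// mem_iota add0n ltnS.
rewrite E1 addrC addKr.
have re i : (i == e.1) || (i == (size l).+1) -> hrestart (e :: l) i w = t.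
  by move=> H; rewrite /hrestart /= H tE.
have z i b : (i == e.1) || (i == (size l).+1) -> rate (e :: l) i b * (t - hrestart (e :: l) i w) = 0.
  by move=> /re ->; rewrite subrr mulr0.
rewrite [size (e :: l)]/= -(addn1 (size l).+1) iotaD big_cat add0n big_seq1.
have -> : \sum_b rate (e :: l) (size l).+1 b * (t - hrestart (e :: l) (size l).+1 w) = 0.
  by apply: big1 => b _; rewrite z// eqxx orbT.
apply: (etrans (addr0 _)); rewrite [RHS]big_mkcond big_seq [RHS]big_seq.
apply: eq_bigr => i; rewrite mem_iota add0n ltnS => /andP[_ il].
case: (eqVneq i e.1) => [ie|ie]; first by rewrite big1// => b _; rewrite z// ie eqxx.
apply: eq_bigr => b _; rewrite rate_cons//; congr (_ * (_ - _)).
by rewrite /hrestart /= (negbTE ie) ltn_eqF ?ltnS.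
Qed.

Lemma rate_le_total l p c : (p <= size l)%N -> rate l p c <= S l.
Proof.
move=> pl; rewrite /total_rate (bigD1_seq p) ?iota_uniq ?mem_iota//= (bigD1 c)//= -addrA lerDl.
by rewrite addr_ge0// sumr_ge0// => *; rewrite ?sumr_ge0// => *; exact: ltW.
Qed.

Lemma depends_on_expo l (s : seq index) (t : Omega -> R) : {subset used l <= s} -> depends_on s t ->
  depends_on s (fun w => expo l (t w) w).
Proof.
move=> sub mt; apply: depends_onD; first by apply: depends_onM => //; exact: depends_on_cst.
apply: depends_on_sum => i; apply: depends_on_sum => b.
apply: depends_onM; first exact: depends_on_cst.
by apply: depends_onB => //; exact: sub_depends_on sub (@depends_on_restart l i).
Qed.

Let denom_gt0 l : 0 < 2 + S l.
Proof. by rewrite ltr_wpDr// total_rate_ge0. Qed.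

Let order_weightZ l (k : R) : 0 <= k ->
  (\int[type_restr]_w (k * (order_ind l w * expR (- expo l (hlast l w) w)))%:E =
   k%:E * order_weight l)%E.
Proof.
move=> k0; rewrite /order_weight -ge0_integralZl//.
- apply/measurable_EFinP; apply: (@depends_on_measurable _ _ _ _ _ _ _ _ _ hE (used l)).
  apply: depends_onM; first exact: depends_on_order.
  apply: depends_on_exp; apply: depends_onN.
  by apply: depends_on_expo => //; exact: depends_on_last.
- by move=> w _; rewrite lee_fin mulr_ge0 ?expR_ge0 ?order_ind_ge0.
Qed.

(** The losing clocks of the parent are integrated out, then the winning one. The exponent grows at
    rate [2 + S l] in the birth time, of which the winner takes its share. *)
Lemma order_weight_cons e l : hvalid (e :: l) ->
  order_weight (e :: l) = ((rate l e.1 e.2 / (2 + S l))%:E * order_weight l)%E.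
Proof.
case: e => p c /= /andP[pl vl]; set h := rate l p c.
pose idx b := clock_index l (p, b); pose t := hring l p c.
pose js := [seq b <- enum 'I_K | b != c].
have h0 : 0 < h by exact: rate_gt0.
pose Y b w := rate l p b * (t w - hrestart l p w).
pose D w := expo l (hlast l w) w.
pose Z w := order_ind l w * (if hlast l w < t w then 1 else 0) *
  expR (- (expo l (t w) w - \sum_b Y b w)).
have us : uniq (map idx js ++ (idx c :: used l)).
  have -> : map idx js ++ (idx c :: used l) =
      map (clock_index l) (map (pair p) js ++ [:: (p, c)]) ++ used l.
    by rewrite map_cat -catA -map_comp.
  apply: clock_indices_uniq => //.
    rewrite cat_uniq /= andbT orbF map_inj_uniq; last by move=> ? ? [].
    rewrite filter_uniq ?enum_uniq//=; apply/mapP => -[b]; rewrite mem_filter => /andP[bc _] [cb].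
    by rewrite cb eqxx in bc.
  by move=> x; rewrite mem_cat inE => /orP[/mapP[b _ ->//]|/eqP->].
have sub : {subset used l <= idx c :: used l} by move=> j jl; rewrite inE jl orbT.
have dt : depends_on (idx c :: used l) t by apply: depends_on_ring => //; exact: mem_head.
have drest i : depends_on (idx c :: used l) (hrestart l i).
  exact: sub_depends_on sub (@depends_on_restart l i).
have dY b : depends_on (idx c :: used l) (Y b).
  by apply: depends_onM; [exact: depends_on_cst|exact: depends_onB].
have dZ : depends_on (idx c :: used l) Z.
  apply: depends_onM; first apply: depends_onM.
  - exact: sub_depends_on sub (@depends_on_order l).
  - by apply: depends_on_ltr => //; exact: sub_depends_on sub (@depends_on_last l).
  - apply: depends_on_exp; apply: depends_onN.
    by apply: depends_onB; [exact: depends_on_expo|exact: depends_on_sum].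
have Zborn w : Z w != 0 -> born_in_order phi m a (Ew w) l /\ hlast l w < t w.
  rewrite /Z !mulf_eq0 !negb_or => /andP[/andP[/order_ind_neq0 ol]].
  by case: ifP => // _; rewrite eqxx.
have Z0 w : 0 <= Z w.
  by rewrite !mulr_ge0 ?expR_ge0 ?order_ind_ge0//; case: ifP.
have Y0 b w : Z w != 0 -> 0 <= Y b w.
  case/Zborn => ol lt; rewrite mulr_ge0 ?ltW// subr_gt0; apply: le_lt_trans lt.
  exact: restart_le.
(* In terms of the winning variable, time runs with factor 1 / h. The total exponent [(2 + S l) / h]
   includes the exponential density itself, whence the -1. *)
pose beta := (2 + S l) / h - 1.
have beta0 : 0 <= beta.
  rewrite subr_ge0 ler_pdivlMr// mul1r (le_trans (rate_le_total c pl))//.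
  by rewrite lerDr.
(* Threshold the winning variable must pass for its birth to follow the previous one. *)
pose Yc w := h * (hlast l w - hrestart l p w).
pose Zc w := order_ind l w * expR ((2 + S l) / h * Yc w - D w).
have dYc : depends_on (used l) Yc.
  apply: depends_onM; first exact: depends_on_cst.
  by apply: depends_onB; [exact: depends_on_last|exact: depends_on_restart].
have dD : depends_on (used l) D by apply: depends_on_expo => //; exact: depends_on_last.
have dZc : depends_on (used l) Zc.
  apply: depends_onM; first exact: depends_on_order.
  apply: depends_on_exp; apply: depends_onB => //.
  by apply: depends_onM => //; exact: depends_on_cst.
transitivity (\int[type_restr]_w (Z w *
    \prod_(b <- js) (if Y b w < input (idx b) w then 1 else 0))%:E)%E.
  apply: eq_integral => w _; congr EFin.
  rewrite (@expo_cons (p, c) l _ w pl erefl) /Z /= mulrAC; congr (_ * _).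
  by apply: eq_bigr => b _; rewrite hring_ltr.
rewrite (@integral_inputs_survive _ _ _ _ _ _ _ _ _ hE a _ js idx (idx c :: used l) Z Y us)//.
transitivity (\int[type_restr]_w (Zc w * (if Yc w < input (idx c) w then
    expR (- (beta * input (idx c) w)) else 0))%:E)%E.
  apply: eq_integral => w _; congr EFin.
  rewrite /Z /Zc /t hring_ltr -/(Yc w) -/(idx c) -!mulrA; congr (_ * _).
  case: ifP => _; last by rewrite !mul0r mulr0.
  rewrite mul1r -!expRD; congr expR.
  rewrite (bigD1 c)//= big_filter big_enum_cond/= -/h (expo_shift l (t w) (hlast l w)) -/(D w).
  have xE : E (ancestry l p) (nkids l p) c w = h * (t w - hrestart l p w).
    rewrite /t hringE -/h addrAC subrr add0r mulrC divfK ?gt_eqF//.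
  rewrite /Y -/h xE /Yc /beta; set s := \sum_(_ | _) _; field; by rewrite gt_eqF.
rewrite (@integral_input_tail _ _ _ _ _ _ _ _ _ hE a (used l) (idx c) Zc Yc beta)//; first last.
- move=> w; rewrite /Zc mulf_eq0 negb_or => /andP[/order_ind_neq0 ol _].
  by apply: mulr_ge0; [exact: ltW|rewrite subr_ge0; exact: restart_le].
- by move=> w; rewrite mulr_ge0 ?expR_ge0 ?order_ind_ge0.
- exact: clock_index_fresh.
- exact: used_uniq.
rewrite -order_weightZ; last by rewrite divr_ge0 ?ltW.
apply: eq_integral => w _; congr EFin.
have beta1 : 1 + beta = (2 + S l) / h by rewrite /beta addrC subrK.
rewrite /Zc expRD -/(D w) -[input_rate R (idx c)]/(1 : R) beta1 [expR (- (_ * Yc w))]expRN.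
have := expR_gt0 ((2 + S l) / h * Yc w); set u := expR _ => u0.
by field; rewrite !gt_eqF ?u0 ?denom_gt0 ?h0.
Qed.

Lemma order_weight_nil : order_weight [::] = (pi a)%:E.
Proof.
transitivity (\int[type_restr]_w (1%:E : \bar R))%E.
  apply: eq_integral => w _; congr EFin; rewrite /= mul1r /expo big_seq1 mulr0 add0r.
  by rewrite big1 ?oppr0 ?expR0// => b _; rewrite addr0 mulr0.
rewrite integral_cst// mul1e -[LHS]/(Q (setT `&` [set w | A w = a])) setTI.
have := inputs_joint hE a (s := [::]) isT (fun=> measurableT : measurable setT).
rewrite big_nil mule1 => <-; congr (Q _); by apply/seteqP; split => w /=; [|case].
Qed.

Definition clocks_at l : seq (nat * 'I_K) :=
  [seq (i, b) | i <- iota 0 (size l).+1, b <- enum 'I_K].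

Definition hist_ind l w : R :=
  order_ind l w * (if hlast l w < tau w then 1 else 0) *
  \prod_(x <- clocks_at l) (if tau w < hring l x.1 x.2 w then 1 else 0).

Lemma mem_clocks_at l i b : (i, b) \in clocks_at l = (i <= size l)%N.
Proof.
apply/allpairsP/idP => [[[i' b'] [il _ [-> _]]]|il].
  by rewrite mem_iota add0n ltnS in il.
by exists (i, b); split; rewrite ?mem_iota ?mem_enum.
Qed.

Lemma hist_indE l w :
  hist_ind l w = if `[< history_at phi m a (Ew w) (tau w) l >] then 1 else 0.
Proof.
rewrite /hist_ind order_indE prod_ind.
case: (asboolP (born_in_order _ _ _ _ l)) => ol; last first.
  by rewrite !mul0r; case: asboolP => // -[].
case: ifP => lt; last first.
  by rewrite mulr0 mul0r; case: asboolP => // -[_ lt']; rewrite /hlast lt' in lt.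
rewrite !mul1r; case: allP => win; case: asboolP => // win'; exfalso; last first.
  apply: win => -[i b]; rewrite mem_clocks_at => il.
  by have [_ _] := win'; apply.
by apply: win'; split => // i b il; apply: (win (i, b)); rewrite mem_clocks_at.
Qed.

Lemma measurable_hist_ind l : measurable_fun setT (hist_ind l).
Proof.
pose s := None :: map (clock_index l) (clocks_at l) ++ used l.
have sub : {subset used l <= s} by move=> j jl; rewrite inE mem_cat jl !orbT.
have dt : depends_on s tau by exact: (@depends_on_input _ _ _ _ tau E s None (mem_head _ _)).
apply: (@depends_on_measurable _ _ _ _ _ _ _ _ _ hE s).
apply: depends_onM; first apply: depends_onM.
- exact: sub_depends_on sub (@depends_on_order l).
- by apply: depends_on_ltr => //; exact: sub_depends_on sub (@depends_on_last l).
have -> : (fun w => \prod_(x <- clocks_at l) (if tau w < hring l x.1 x.2 w then 1 else 0)) =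
    (fun w => \prod_(x <- clocks_at l) (if x \in clocks_at l then if tau w < hring l x.1 x.2 w then 1 else 0 else 0)) :> (Omega -> R).
  by apply/funext => w; rewrite big_seq [RHS]big_seq; apply: eq_bigr => x ->.
apply: depends_on_prod => -[i b]; have [xl|_] := boolP ((i, b) \in clocks_at l); last exact: depends_on_cst.
apply: depends_on_ltr => //; apply: depends_on_ring => //.
by rewrite inE mem_cat map_f ?orbT.
Qed.

Lemma history_event_measurable l :
  measurable [set w | history_at phi m a (Ew w) (tau w) l].
Proof.
rewrite (_ : [set w | _] = hist_ind l @^-1` [set 1]).
  by rewrite -[X in measurable X]setTI; exact: measurable_hist_ind.
apply/seteqP; split => w /=; rewrite hist_indE; case: asboolP => // _ /eqP.
by rewrite eq_sym oner_eq0.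
Qed.

(** After all running clocks are integrated out against [tau], the exponent grows at rate [2 + S l]
    in [tau], of which [tau] itself has share 2. *)
Lemma history_event_weight l : hvalid l ->
  Q [set w | A w = a /\ history_at phi m a (Ew w) (tau w) l] =
  ((2 / (2 + S l))%:E * order_weight l)%E.
Proof.
move=> vl; set H := [set w | history_at phi m a (Ew w) (tau w) l].
have -> : [set w | A w = a /\ history_at phi m a (Ew w) (tau w) l] = H `&` [set w | A w = a].
  by apply/seteqP; split => w [].
have ltE w : (if hlast l w < tau w then 1 else 0) = (if hlast l w < input None w then 1 else 0) :> R.
  by [].
pose Y x w := rate l x.1 x.2 * (tau w - hrestart l x.1 w).
pose Z w := order_ind l w * (if hlast l w < tau w then 1 else 0).
pose D w := expo l (hlast l w) w.
pose Zc w := order_ind l w * expR ((2 + S l) * hlast l w - D w).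
have sub : {subset used l <= None :: used l} by move=> j jl; rewrite inE jl orbT.
have dt : depends_on (None :: used l) tau.
  exact: (@depends_on_input _ _ _ _ tau E _ None (mem_head _ _)).
have us : uniq (map (clock_index l) (clocks_at l) ++ (None :: used l)).
  rewrite -cat1s uniq_catCA cat1s cons_uniq mem_cat negb_or None_notin_used andbT.
  apply/andP; split; first by apply/mapP => -[].
  apply: clock_indices_uniq => //.
    apply: allpairs_uniq; [exact: iota_uniq|exact: enum_uniq|].
    by move=> [i b] [i' b'] _ _ [-> ->].
  by move=> [i b]; rewrite mem_clocks_at.
have dZ : depends_on (None :: used l) Z.
  apply: depends_onM; first exact: sub_depends_on sub (@depends_on_order l).
  by apply: depends_on_ltr => //; exact: sub_depends_on sub (@depends_on_last l).
have dY x : depends_on (None :: used l) (Y x).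
  apply: depends_onM; first exact: depends_on_cst.
  by apply: depends_onB => //; exact: sub_depends_on sub (@depends_on_restart l x.1).
have Z0 w : 0 <= Z w by rewrite mulr_ge0 ?order_ind_ge0//; case: ifP.
have Y0 x w : Z w != 0 -> 0 <= Y x w.
  rewrite /Z mulf_eq0 negb_or => /andP[/order_ind_neq0 ol].
  case: ifP => [lt _|]; last by rewrite eqxx.
  by rewrite mulr_ge0 ?ltW// subr_gt0; apply: le_lt_trans lt; exact: restart_le.
have dD : depends_on (used l) D by apply: depends_on_expo => //; exact: depends_on_last.
have dZc : depends_on (used l) Zc.
  apply: depends_onM; first exact: depends_on_order.
  apply: depends_on_exp; apply: depends_onB => //.
  by apply: depends_onM; [exact: depends_on_cst|exact: depends_on_last].
transitivity (\int[type_restr]_w (\1_H w)%:E)%E.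
  by rewrite integral_indic ?setIT//; exact: history_event_measurable.
transitivity (\int[type_restr]_w (Z w *
    \prod_(x <- clocks_at l) (if Y x w < input (clock_index l x) w then 1 else 0))%:E)%E.
  apply: eq_integral => w _; congr EFin; transitivity (hist_ind l w).
    rewrite hist_indE indicE; case: asboolP => Hw; first by rewrite mem_set.
    by rewrite memNset.
  by congr (_ * _); apply: eq_bigr => -[i b] _; rewrite hring_ltr.
rewrite (@integral_inputs_survive _ _ _ _ _ _ _ _ _ hE a _ _ _ (None :: used l) Z Y us)//.
transitivity (\int[type_restr]_w (Zc w * (if hlast l w < input None w then
    expR (- (S l * input None w)) else 0))%:E)%E.
  apply: eq_integral => w _; congr EFin.
  rewrite /Z /Zc ltE -!mulrA; congr (_ * _).
  case: ifP => _; last by rewrite !mul0r mulr0.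
  rewrite mul1r -expRD; congr expR.
  have -> : \sum_(x <- clocks_at l) Y x w = expo l (tau w) w - 2 * tau w.
    by rewrite big_allpairs_dep /expo [RHS]addrAC subrr add0r; apply: eq_bigr => i _; rewrite big_enum.
  rewrite (expo_shift l (tau w) (hlast l w)) -/(D w) -[input None w]/(tau w); ring.
rewrite (@integral_input_tail _ _ _ _ _ _ _ _ _ hE a (used l) None Zc (hlast l) (S l))//; first last.
- move=> w; rewrite /Zc mulf_eq0 negb_or => /andP[/order_ind_neq0 ol _].
  exact: last_birth_ge0 ol.
- by move=> w; rewrite mulr_ge0 ?expR_ge0 ?order_ind_ge0.
- exact: depends_on_last.
- exact: total_rate_ge0.
- exact: None_notin_used.
- exact: used_uniq.
rewrite -order_weightZ; last by rewrite divr_ge0 ?ltW.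
apply: eq_integral => w _; congr EFin.
rewrite /Zc expRD -/(D w) -[input_rate R None]/(2 : R) [expR (- ((_ + _) * _))]expRN.
have := expR_gt0 ((2 + S l) * hlast l w); set u := expR _ => u0.
by field; rewrite !gt_eqF ?u0 ?denom_gt0.
Qed.

Lemma history_event_law l : hvalid l ->
  Q [set w | A w = a /\ history_at phi m a (Ew w) (tau w) l] = (hist_law pi phi m a l)%:E.
Proof.
move=> vl; rewrite history_event_weight//.
elim: l vl => [|e l IH] vl.
  by rewrite order_weight_nil -EFinM /hist_law; congr EFin; field; rewrite !gt_eqF.
have /andP[el vl'] := vl.
have := IH vl'; rewrite order_weight_cons//.
have : (0 <= order_weight l)%E.
  by apply: integral_ge0 => w _; rewrite lee_fin mulr_ge0 ?expR_ge0 ?order_ind_ge0.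
(* An infinite weight contradicts the induction hypothesis, whose right-hand side is finite. *)
case: (order_weight l) => [r _|_|//]; last by rewrite gt0_muley ?lte_fin ?divr_gt0.
rewrite -!EFinM => -[IHl]; congr EFin.
have -> : hist_law pi phi m a (e :: l) = (if (e.1 <= size l)%N
  then rate l e.1 e.2 / 2 * hist_law pi phi m a l else 0) / (1 + S (e :: l) / 2) by [].
rewrite el -IHl; have := denom_gt0 (e :: l); have := denom_gt0 l.
set x := S (e :: l); set y := S l => y0 x0.
by field; rewrite !gt_eqF//; lra.
Qed.

End history_probability.

(** * Expectations over the branching process *)

Section nonmeasurable_integrals.
Context (d : measure_display) (Omega : measurableType d) (R : realType).

(* Unlike [ge0_le_integral], without measurability. *)
Lemma ge0_le_integral_nonmeas (mu : {measure set Omega -> \bar R}) (f g : Omega -> \bar R) :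
  (forall w, 0 <= f w)%E -> (forall w, f w <= g w)%E ->
  (\int[mu]_w f w <= \int[mu]_w g w)%E.
Proof.
move=> f0 fg; rewrite !ge0_integralTE//; last by move=> w; exact: le_trans (f0 w) (fg w).
apply: le_ereal_sup => _ [h hf <-]; exists h => //= w.
exact: le_trans (hf w) (fg w).
Qed.

Variables (Q : probability Omega R) (I : eqType) (s : seq I) (W : I -> set Omega) (p : I -> R).
Hypotheses (us : uniq s) (mW : forall x, measurable (W x))
  (disjW : forall x y w, W x w -> W y w -> x = y)
  (QW : forall x, x \in s -> Q (W x) = (p x)%:E).

Let sum_indic_in (g : I -> R) x w : x \in s -> W x w -> \sum_(y <- s) g y * \1_(W y) w = g x.
Proof.
move=> xs Wx; rewrite (bigD1_seq x)//= indicE mem_set// mulr1 big1 ?addr0// => y yx.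
rewrite indicE memNset ?mulr0// => Wy; move: yx.
by rewrite (disjW Wy Wx) eqxx.
Qed.

Let sum_indic_cases (g : I -> R) w : (exists2 x, x \in s & W x w) \/
  ((forall x, x \in s -> ~ W x w) /\ \sum_(y <- s) g y * \1_(W y) w = 0).
Proof.
have [[x xs Wx]|no] := pselect (exists2 x, x \in s & W x w); first by left; exists x.
have out x : x \in s -> ~ W x w by move=> xs Wx; apply: no; exists x.
right; split=> //; rewrite big_seq big1// => y ys.
by rewrite indicE memNset ?mulr0//; exact: out.
Qed.

Let measurable_sum_indic (g : I -> R) :
  measurable_fun setT (fun w => \sum_(x <- s) g x * \1_(W x) w).
Proof.
by apply: measurable_sum => x; apply: measurable_funM => //; exact: measurable_indic.
Qed.

Let integral_sum_indic (g : I -> R) : (forall x, 0 <= g x) ->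
  (\int[Q]_w (\sum_(x <- s) g x * \1_(W x) w)%:E = (\sum_(x <- s) g x * p x)%:E)%E.
Proof.
move=> g0; under eq_integral do rewrite -sumEFin.
rewrite ge0_integral_sum//; last 2 first.
- by move=> x; apply/measurable_EFinP; apply: measurable_funM => //; exact: measurable_indic.
- by move=> x w _; rewrite lee_fin mulr_ge0.
rewrite -sumEFin; apply: eq_big_seq => x xs.
under eq_integral do rewrite EFinM.
rewrite ge0_integralZl//; last 2 first.
- by apply/measurable_EFinP; exact: measurable_indic.
- by rewrite lee_fin.
by rewrite integral_indic// setIT EFinM; congr (_ * _)%E; exact: QW.
Qed.

(** Integrals of nonnegative functions are monotone even off the measurable ones, so [h] is squeezed
    between step functions equal to [c x] on [W x], and to 0 or [M] off the listed events. *)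
Let integral_ge0_approx (h : Omega -> R) (c : I -> R) (M : R) :
  (forall w, 0 <= h w <= M) -> (forall x, 0 <= c x <= M) ->
  (forall x w, x \in s -> W x w -> h w = c x) ->
  exists2 r : R, (\int[Q]_w (h w)%:E)%E = r%:E &
    \sum_(x <- s) c x * p x <= r <= \sum_(x <- s) c x * p x + M * (1 - \sum_(x <- s) p x).
Proof.
move=> hM cM hc.
have lo : ((\sum_(x <- s) c x * p x)%:E <= \int[Q]_w (h w)%:E)%E.
  rewrite -integral_sum_indic; last by move=> x; have /andP[] := cM x.
  apply: ge0_le_integral_nonmeas => w; rewrite lee_fin.
    by apply: sumr_ge0 => x _; rewrite mulr_ge0//; have /andP[] := cM x.
  have [[x xs Wx]|[_ ->]] := sum_indic_cases c w; last by have /andP[] := hM w.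
  by rewrite (sum_indic_in c xs Wx) (hc x w).
pose u w := M - \sum_(x <- s) (M - c x) * \1_(W x) w.
have cM0 x : 0 <= M - c x by rewrite subr_ge0; have /andP[] := cM x.
have hu w : h w <= u w.
  rewrite /u; have [[x xs Wx]|[_ ->]] := sum_indic_cases (fun x => M - c x) w.
    by rewrite (sum_indic_in _ xs Wx) (hc x w)// opprB addrC subrK.
  by rewrite subr0; have /andP[] := hM w.
have u0 w : 0 <= u w by apply: le_trans (hu w); have /andP[] := hM w.
have mu : measurable_fun setT u by apply: measurable_funB.
have Iu : (\int[Q]_w (u w)%:E + (\sum_(x <- s) (M - c x) * p x)%:E = M%:E)%E.
  rewrite -integral_sum_indic// -ge0_integralD//; last 4 first.
  - by move=> w _; rewrite lee_fin.
  - exact/measurable_EFinP.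
  - by move=> w _; rewrite lee_fin sumr_ge0// => x _; rewrite mulr_ge0.
  - exact/measurable_EFinP.
  transitivity (\int[Q]_w (cst M%:E w))%E.
    by apply: eq_integral => w _; rewrite -EFinD /u subrK.
  transitivity (M%:E * Q setT)%E; first exact: integral_cst.
  by rewrite probability_setT mule1.
have hi : (\int[Q]_w (h w)%:E <= (M - \sum_(x <- s) (M - c x) * p x)%:E)%E.
  rewrite EFinB -Iu addeK//; apply: ge0_le_integral_nonmeas => w; rewrite lee_fin//.
  by have /andP[] := hM w.
have fin : (\int[Q]_w (h w)%:E)%E \is a fin_num.
  by rewrite fin_numE gt_eqF ?lt_eqF// ?(le_lt_trans hi) ?ltry// (lt_le_trans _ lo) ?ltNyr.
exists (fine (\int[Q]_w (h w)%:E)%E); first by rewrite fineK.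
rewrite -lee_fin -[X in _ && X]lee_fin fineK// lo/=; apply: le_trans hi _.
have -> : \sum_(x <- s) (M - c x) * p x = M * (\sum_(x <- s) p x) - \sum_(x <- s) c x * p x.
  by rewrite mulr_sumr -sumrB; apply: eq_bigr => x _; ring.
by rewrite lee_fin; lra.
Qed.

Lemma integral_partition_approx (h : Omega -> R) (c : I -> R) (M : R) :
  (forall w, `|h w| <= M) -> (forall x, `|c x| <= M) ->
  (forall x w, x \in s -> W x w -> h w = c x) ->
  exists2 r : R, (\int[Q]_w (h w)%:E)%E = r%:E &
    `|r - \sum_(x <- s) c x * p x| <= M * (1 - \sum_(x <- s) p x).
Proof.
move=> hM cM hc.
have part (y : R) : `|y| <= M -> 0 <= Num.max y 0 <= M.
  move=> yM; rewrite le_max lexx orbT ge_max (le_trans (ler_norm y) yM).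
  exact: le_trans (normr_ge0 _) yM.
have [r1 E1 /andP[l1 u1]] := @integral_ge0_approx (fun w => Num.max (h w) 0)
  (fun x => Num.max (c x) 0) M (fun w => part _ (hM w)) (fun x => part _ (cM x))
  (fun x w xs Wx => congr1 (fun y => Num.max y 0) (hc x w xs Wx)).
have partN (y : R) : `|y| <= M -> 0 <= Num.max (- y) 0 <= M.
  by move=> yM; apply: part; rewrite normrN.
have [r2 E2 /andP[l2 u2]] := @integral_ge0_approx (fun w => Num.max (- h w) 0)
  (fun x => Num.max (- c x) 0) M (fun w => partN _ (hM w)) (fun x => partN _ (cM x))
  (fun x w xs Wx => congr1 (fun y => Num.max (- y) 0) (hc x w xs Wx)).
exists (r1 - r2).
  rewrite integralE EFinB -E1 -E2; congr (_ - _)%E; apply: eq_integral => w _.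
  - by rewrite funeposE -EFin_max.
  - by rewrite funenegE -EFin_max.
have -> : \sum_(x <- s) c x * p x =
    \sum_(x <- s) Num.max (c x) 0 * p x - \sum_(x <- s) Num.max (- c x) 0 * p x.
  rewrite -sumrB; apply: eq_bigr => x _; rewrite -mulrBl; congr (_ * _).
  by rewrite /Num.max; case: ifP; case: ifP => ? ?; lra.
by rewrite ler_norml; lra.
Qed.

End nonmeasurable_integrals.

Lemma ae_forall_countable (d : measure_display) (Omega : measurableType d) (R : realType)
    (mu : {measure set Omega -> \bar R}) (T : countType) (P : T -> Omega -> Prop) :
  (forall x, {ae mu, forall w, P x w}) -> {ae mu, forall w, forall x, P x w}.
Proof.
move=> H.
have : {ae mu, forall w, forall n, if unpickle n is Some x then P x w else True}.
  apply: ae_foralln => n; case: (unpickle n) => [x|]; first exact: H.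
  exact: aeW.
by apply: filterS => w Hw x; have := Hw (pickle x); rewrite pickleK.
Qed.

(** The tree is read off its history for nonnegative clocks. The joint law is given on each event
    [A w = a], hence the detour through the types. *)
Lemma ae_clocks_gt0 (R : realType) (K : nat) (pi : 'I_K -> R) (d : measure_display)
    (Omega : measurableType d) (Q : probability Omega R)
    (A : Omega -> 'I_K) (tau : Omega -> R) (E : seq nat -> nat -> 'I_K -> Omega -> R) :
  branching_inputs pi Q A tau E -> {ae Q, forall w, forall u k b, 0 < E u k b w}.
Proof.
move=> hE.
have : {ae Q, forall w, forall x : 'I_K * (seq nat * nat * 'I_K),
    A w = x.1 -> 0 < E x.2.1.1 x.2.1.2 x.2.2 w}.
  apply: ae_forall_countable => -[a x] /=.
  pose C : set R := ~` `]0, +oo[%classic.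
  have mC : measurable C by exact: measurableC.
  have := inputs_joint hE a (s := [:: Some x]) isT (fun=> mC).
  rewrite big_seq1 /=.
  have -> : exponential_prob 1 C = 0%E :> \bar R.
    rewrite -(exponential_measureE ltr01) probability_setC// exponential_measureE.
    by rewrite exponential_tail// mulr0 oppr0 expR0 subee.
  rewrite mule0 => Q0; set B := [set w | _] in Q0; exists B; split => //.
    rewrite (_ : B = [set w | A w = a] `&` (E x.1.1 x.1.2 x.2 @^-1` C)).
      apply: measurableI; first exact: measurable_type hE a.
      rewrite -[X in measurable X]setTI.
      exact: (measurable_input hE (Some x)).
    apply/seteqP; split => w /= -[Aw H]; split => //.
      by have := H (Some x); rewrite inE eqxx; apply.
    by move=> j; rewrite inE => /eqP ->.
  move=> w /= /not_implyP[Aw /negP En]; split => // j; rewrite inE => /eqP -> /=.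
  by rewrite /C /= in_itv/= andbT; exact/negP.
apply: filterS => w H u k b; exact: (H (A w, (u, k, b)) erefl).
Qed.

(** * Local weak convergence *)

Section graph_side.
Context (R : realType) (K : nat) (hK : (0 < K)%N).
Variables (pi : 'I_K -> R) (kappa : 'I_K -> 'I_K -> R) (m : 'I_K -> nat).
Hypotheses (pi_gt0 : forall a, 0 < pi a) (pi_sum : \sum_a pi a = 1).
Hypotheses (kappa_gt0 : forall a b, 0 < kappa a b) (m_ge1 : forall a, (1 <= m a)%N).
Variable (G0 : fmgraph K).
Hypothesis hG0 : seed_graph G0.
Context (d : measure_display) (Omega : measurableType d) (P : probability Omega R).
Variable (X : nat -> Omega -> arrival K).
Hypothesis hX : attachment_process pi kappa m G0 P X.

Lemma past_rpast n w : past X n w = rev (rpast X n w).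
Proof.
elim: n => //= n IH; rewrite rev_cons -IH /past -[in iota 0 n.+1]addn1 iotaD map_cat.
by rewrite cats1.
Qed.

Let mX n s : measurable [set w | X n w = s].
Proof. by case: hX. Qed.

Let PX n r s : P [set w | rpast X n w = r /\ X n w = s] =
  (P [set w | rpast X n w = r] * (step_prob pi kappa m G0 r s)%:E)%E.
Proof.
have [_ H] := hX; have E w : (past X n w = rev r) = (rpast X n w = r).
  by apply/propext; rewrite past_rpast; split => [/(can_inj revK)|->].
have := H n (rev r) s; rewrite grow_rev.
have -> : [set w | past X n w = rev r] = [set w | rpast X n w = r].
  by apply/funext => w /=; rewrite E.
have -> // : [set w | past X n w = rev r /\ X n w = s] = [set w | rpast X n w = r /\ X n w = s].
by apply/funext => w /=; rewrite E.
Qed.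

Lemma ae_cvg_hist_count : {ae P, forall w,
  (forall n, wf m G0 (rpast X n w)) /\
  forall a l, (fun n => hist_count R hK G0 a l (rpast X n w) / n%:R) @ \oo -->
    hist_law pi (phi pi kappa m) m a l}.
Proof.
have un := arrivals_uniq m G0.
have ge0 := step_prob_ge0 m pi_gt0 kappa_gt0 G0.
have sum1 r := @step_prob_sum R K hK pi kappa m pi_sum kappa_gt0 m_ge1 G0 hG0 r.
have Hr := ae_rpast_paths un sum1 mX PX.
have Hd : {ae P, forall w, forall a,
    (fun n => mart (step_prob pi kappa m G0) (arrivals m G0) (type_degree R hK G0 ^~ a)
       (rpast X n w) / n%:R) @ \oo --> 0}.
  apply: ae_forall_countable => a.
  by apply: (mart_slln un ge0 sum1 _ mX PX) => r s; exact: type_degree_step.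
have Hh : {ae P, forall w, forall x : 'I_K * seq (nat * 'I_K),
    (fun n => mart (step_prob pi kappa m G0) (arrivals m G0) (hist_count R hK G0 x.1 x.2)
       (rpast X n w) / n%:R) @ \oo --> 0}.
  apply: ae_forall_countable => -[a l]; have [C HC] := hist_count_step R hK m_ge1 G0 a l.
  exact: (mart_slln un ge0 sum1 HC mX PX).
move: Hr Hd Hh; apply: filterS3 => w wr wd wh.
have reach n : reachable (arrivals m G0) (rpast X n w) by exact: mem_paths (wr n).
split=> [n|a l]; first exact: reachable_wf.
apply: (@cvg_hist_count R K hK pi kappa m pi_gt0 pi_sum kappa_gt0 m_ge1 G0 hG0
  (fun n => rpast X n w)) => // [n|a' l']; first by exists (X n w).
exact: (wh (a', l')).
Qed.

End graph_side.

Lemma mem_hist_upto_valid K N l : l \in hist_upto K N -> hvalid l.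
Proof. by case/flattenP => s /mapP[k _ ->] /mem_histories[]. Qed.

Section tree_side.
Context (R : realType) (K : nat) (hK : (0 < K)%N) (pi : 'I_K -> R).
Context (d : measure_display) (Omega : measurableType d) (Q : probability Omega R).
Variables (A : Omega -> 'I_K) (tau : Omega -> R) (E : seq nat -> nat -> 'I_K -> Omega -> R).
Hypothesis hE : branching_inputs pi Q A tau E.
Variables (phi : 'I_K -> 'I_K -> R) (m : 'I_K -> nat).
Hypothesis (phi_gt0 : forall a b, 0 < phi a b) (m_ge1 : forall a, (1 <= m a)%N).

Lemma expectation_family_tree (f : Gstar R K -> R) (M : R) N : (forall x, `|f x| <= M) ->
  exists2 r : R,
    ('E_Q[f \o (fun w => to_Gstar R (family_tree phi m (A w) (fun u k b => E u k b w) (tau w)))])%E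
      = r%:E &
    `|r - \sum_a \sum_(l <- hist_upto K N) hist_law pi phi m a l * f (to_Gstar R (hist_graph a l))|
    <= M * (1 - \sum_a \sum_(l <- hist_upto K N) hist_law pi phi m a l).
Proof.
move=> fM; have [B [mB B0 HB]] := ae_clocks_gt0 hE.
(* The null set [B], which contains all failures of positivity, is removed so that the tree can be
   read off on all of [W x]; invalid histories get the empty event so that disjointness holds for
   all indices. *)
pose W (x : 'I_K * seq (nat * 'I_K)) : set Omega := if hvalid x.2 then
  [set w | A w = x.1 /\ history_at phi m x.1 (fun u k b => E u k b w) (tau w) x.2] `\` B else set0.
pose s := [seq (a, l) | a <- enum 'I_K, l <- hist_upto K N].
pose p (x : 'I_K * seq (nat * 'I_K)) := hist_law pi phi m x.1 x.2.
pose c (x : 'I_K * seq (nat * 'I_K)) := f (to_Gstar R (hist_graph x.1 x.2)).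
have mH a l : measurable [set w | A w = a /\ history_at phi m a (fun u k b => E u k b w) (tau w) l].
  rewrite (_ : [set w | _] = [set w | A w = a] `&`
    [set w | history_at phi m a (fun u k b => E u k b w) (tau w) l])//.
  by apply: measurableI; [exact: measurable_type hE a|exact: history_event_measurable hE phi m a l].
have us : uniq s.
  by apply: allpairs_uniq; [exact: enum_uniq|exact: hist_upto_uniq|move=> [? ?] [? ?] _ _ [-> ->]].
have mW x : measurable (W x).
  by rewrite /W; case: ifP => // _; exact: measurableD.
have disjW x y w : W x w -> W y w -> x = y.
  rewrite /W; case: ifP => // vx; case: ifP => // vy [[Ax hx] _] [[Ay hy] _].
  case: x y Ax hx vx Ay hy vy => [a l] [a' l'] /= <- hx vx <- hy vy.
  by rewrite (history_unique vx vy hx hy).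
have QW x : x \in s -> Q (W x) = (p x)%:E.
  case/allpairsP => -[a l] /= [_ lN ->]; rewrite /W /= (mem_hist_upto_valid lN).
  rewrite measureD//; last by rewrite ltey_eq fin_num_measure.
  transitivity ((p (a, l))%:E - 0)%E; last by rewrite sube0.
  have law := history_event_law hE phi_gt0 m_ge1 a (mem_hist_upto_valid lN).
  congr (_ - _)%E; first exact: law.
  apply/eqP; rewrite eq_le measure_ge0 andbT -B0; apply: le_measure; rewrite ?inE//.
  exact: measurableI.
have fW x w : x \in s -> W x w ->
   f (to_Gstar R (family_tree phi m (A w) (fun u k b => E u k b w) (tau w))) = c x.
  move=> _; rewrite /W; case: ifP => // vx [[-> hx] Bw]; congr f.
  apply: family_tree_history => // u k b.
  by apply: ltW; apply: contrapT => nE; apply: Bw; apply: HB => /= H; apply: nE; exact: H.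
have [r rE rN] := integral_partition_approx us mW disjW QW (fun w => fM _) (fun x => fM _) fW.
exists r; first by rewrite unlock.
by move: rN; rewrite !big_allpairs_dep !big_enum /=; under eq_bigr do under eq_bigr do rewrite mulrC.
Qed.

End tree_side.

Lemma cvg_of_approx (R : realType) (u : nat -> R) (x : R) :
  (forall e : R, 0 < e -> exists v : nat -> R, exists2 y : R, (v @ \oo --> y) &
     y <= e /\ forall n, `|u n - x| <= v n) -> u @ \oo --> x.
Proof.
move=> H; apply/cvgrPdist_lt => e e0.
have e20 : 0 < e / 2 by rewrite divr_gt0.
have [v [y vy [ye uv]]] := H (e / 2) e20.
have ylt : y < e by apply: le_lt_trans ye _; lra.
have /cvgrPdist_lt/(_ (e - y)) := vy; rewrite subr_gt0 => /(_ ylt); apply: filterS => n.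
rewrite ltr_norml => /andP[vn _]; rewrite distrC; apply: le_lt_trans (uv n) _.
by move: vn; lra.
Qed.

(** The graph has [size_fg G0 + n] vertices after [n] arrivals, whereas the counts are normalized by
    [n]. *)
Lemma cvg_div_shift (R : realType) (k : nat) (x : nat -> R) (y : R) :
  (fun n => x n / n%:R) @ \oo --> y -> (fun n => (k.+1 + n)%N%:R^-1 * x n) @ \oo --> y.
Proof.
move=> xy.
have h0 : (fun n => ((k.+1 + n)%N%:R : R)^-1) @ \oo --> (0 : R).
  rewrite (_ : (fun n => _) = [sequence (harmonic (n + k)%N : R)]_n).
    by have := @cvg_harmonic R; rewrite -(@cvg_shiftn k R).
  by apply/funext => n; rewrite /harmonic /= addSn addnC.
have H : (fun n => (1 - k.+1%:R * ((k.+1 + n)%N%:R : R)^-1) * (x n / n%:R)) @ \oo --> y.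
  rewrite -[X in _ --> X]mul1r; apply: cvgM => //.
  rewrite -[X in _ --> X]subr0; apply: cvgB; first exact: cvg_cst.
  by rewrite -[X in _ --> X](mulr0 k.+1%:R); apply: cvgMr; exact: h0.
apply: cvg_trans H; apply: near_eq_cvg; exists 1%N => // n /= n1.
have n0 : (n%:R : R) != 0 by rewrite pnatr_eq0 -lt0n.
have k0 : ((k.+1 + n)%N%:R : R) != 0 by rewrite pnatr_eq0.
move: n0 k0; rewrite natrD; move: (n%:R) (k.+1%:R) => z kk n0 k0.
by field; rewrite n0 k0.
Qed.

Theorem theorem4p3 (R : realType) (K : nat) (hK : (1 <= K)%N)
  (pi : 'I_K -> R) (kappa : 'I_K -> 'I_K -> R) (m : 'I_K -> nat)
  (pi_gt0 : forall a, 0 < pi a) (pi_sum : \sum_a pi a = 1)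
  (kappa_gt0 : forall a b, 0 < kappa a b) (m_ge1 : forall a, (1 <= m a)%N)
  (G0 : fmgraph K) (hG0 : seed_graph G0)
  (d : measure_display) (Omega : measurableType d) (P : probability Omega R)
  (X : nat -> Omega -> arrival K)
  (hX : attachment_process pi kappa m G0 P X)
  (d' : measure_display) (Omega' : measurableType d')
  (Q : probability Omega' R)
  (A : Omega' -> 'I_K) (tau : Omega' -> R)
  (E : seq nat -> nat -> 'I_K -> Omega' -> R)
  (hE : branching_inputs pi Q A tau E) :
  as_local_weak_cvg P (attachment_graph G0 X) Q
    (fun w => to_Gstar R
      (family_tree (phi pi kappa m) m (A w) (fun u k b => E u k b w) (tau w))).
Proof.
move=> f [M fM] _; have ph0 := phi_gt0 hK pi_gt0 kappa_gt0 m_ge1.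
have := ae_cvg_hist_count hK pi_gt0 pi_sum kappa_gt0 m_ge1 hG0 hX.
apply: filterS => w [wfw cv].
pose law a l := hist_law pi (phi pi kappa m) m a l.
pose g a l := f (to_Gstar R (hist_graph a l)).
pose cnt n a l := hist_count R hK G0 a l (rpast X n w).
have M0 : 0 <= M by apply: le_trans (normr_ge0 _) (fM (to_Gstar R (hist_graph (Ordinal hK) [::]))).
(* The case [N = 0] names the expectation as a real [x]; the bounds for all other [N] then concern
   the same [x]. *)
have [x xE _] := expectation_family_tree hE ph0 m_ge1 0 fM.
have xN N : `|x - \sum_a \sum_(l <- hist_upto K N) law a l * g a l| <=
    M * (1 - \sum_a \sum_(l <- hist_upto K N) law a l).
  by have [x'] := expectation_family_tree hE ph0 m_ge1 N fM; rewrite xE => -[<-].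
rewrite xE; apply/fine_cvgP; split; first exact: nearW.
suff avg : (fun n => graph_average f (rgrow G0 (rpast X n w))) @ \oo --> x.
  apply: cvg_trans avg; apply: near_eq_cvg; apply: nearW => n /=.
  by rewrite /attachment_graph past_rpast grow_rev.
have cvg_cnt N (h : 'I_K -> seq (nat * 'I_K) -> R) :
    (fun n => (vcount G0 (rpast X n w))%:R^-1 *
      \sum_a \sum_(l <- hist_upto K N) cnt n a l * h a l) @ \oo -->
    \sum_a \sum_(l <- hist_upto K N) law a l * h a l.
  have n0 : (0 < size_fg G0)%N by case: hG0.
  have -> : (fun n => (vcount G0 (rpast X n w))%:R^-1 *
      \sum_a \sum_(l <- hist_upto K N) cnt n a l * h a l) =
    (fun n => ((size_fg G0).-1.+1 + n)%N%:R^-1 *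
      \sum_a \sum_(l <- hist_upto K N) cnt n a l * h a l).
    apply/funext => n; rewrite prednK// /vcount; congr (_%:R^-1 * _).
    by congr addn; elim: n => //= n ->.
  apply: cvg_div_shift.
  have -> : (fun n => (\sum_a \sum_(l <- hist_upto K N) cnt n a l * h a l) / n%:R) =
      (fun n => \sum_a \sum_(l <- hist_upto K N) cnt n a l / n%:R * h a l).
    apply/funext => n; rewrite mulr_suml; apply: eq_bigr => a _.
    by rewrite mulr_suml; apply: eq_bigr => l _; rewrite mulrAC.
  apply: cvg_finsum => a; apply: cvg_finsum => l.
  by apply: cvgMl; exact: cv.
apply: cvg_of_approx => e e0.
(* The uncovered mass enters twice, from the graph and from the tree, each time with factor [M];
   [M + 1] avoids a division by 0. *)
have e1 : 0 < e / (2 * (M + 1)) by rewrite divr_gt0// mulr_gt0// ltr_wpDl.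
have [N HN] := hist_law_exhausts m pi_gt0 pi_sum ph0 e1.
pose mass := \sum_a \sum_(l <- hist_upto K N) law a l.
have massE : \sum_(0 <= k < N.+1) level_mass pi (phi pi kappa m) m k = mass.
  rewrite /mass /level_mass exchange_big; apply: eq_bigr => a _.
  by rewrite big_hist_upto.
pose S := \sum_a \sum_(l <- hist_upto K N) law a l * g a l.
pose S_ n := (vcount G0 (rpast X n w))%:R^-1 *
  \sum_a \sum_(l <- hist_upto K N) cnt n a l * g a l.
pose mass_ n := (vcount G0 (rpast X n w))%:R^-1 *
  \sum_a \sum_(l <- hist_upto K N) cnt n a l.
have cS : S_ @ \oo --> S by exact: cvg_cnt.
have cm : mass_ @ \oo --> mass.
  have := cvg_cnt N (fun _ _ => 1).
  rewrite (_ : \sum_a _ = mass); last by apply: eq_bigr => a _; apply: eq_bigr => l _; rewrite mulr1.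
  rewrite (_ : (fun n => _) = mass_)//; apply/funext => n; congr (_ * _).
  by apply: eq_bigr => a _; apply: eq_bigr => l _; rewrite mulr1.
(* From the graph average to its truncation, to the limit of the truncation, to the expectation. *)
exists (fun n => M * (1 - mass_ n) + `|S_ n - S| + M * (1 - mass)).
exists (M * (1 - mass) + `|S - S| + M * (1 - mass)).
  apply: cvgD; last exact: cvg_cst.
  apply: cvgD; first by apply: cvgMr; apply: cvgB => //; exact: cvg_cst.
  by apply: cvg_norm; apply: cvgB => //; exact: cvg_cst.
split.
  rewrite subrr normr0 addr0 -massE.
  set q := \sum_(0 <= k < N.+1) _ in HN *.
  apply: (@le_trans _ _ (2 * M * (e / (2 * (M + 1))))).
    rewrite -mulr2n -[_ *+ 2]mulr_natl mulrA; apply: ler_wpM2l; first by rewrite mulr_ge0.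
    by rewrite lerBlDl -lerBlDr ltW.
  by rewrite mulrA ler_pdivrMr ?mulr_gt0 ?ltr_wpDl//; nra.
move=> n; have /= hn := graph_average_approx hK N fM (wfw n).
have := xN N; rewrite -/mass -/S => hx.
rewrite (_ : graph_average f _ - x = (graph_average f (rgrow G0 (rpast X n w)) - S_ n) + (S_ n - S) + (S - x)); last by ring.
apply: le_trans (ler_normD _ _) _; apply: lerD; last by rewrite distrC.
by apply: le_trans (ler_normD _ _) _; apply: lerD.
Qed.
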